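(* Let $\alpha>2$ and let $C_0<\infty$ be a constant depending only on $\alpha$. There exist $\varepsilon_0>0$ and $C<\infty$, depending only on $\alpha$, such that the following holds. Let $u_0\in U_\alpha$ with $\|u_0\|_{U_\alpha}\le\varepsilon_0$ and let $u:[0,\infty)^2\to\mathbb R$, $u=u(t,x)$, be locally integrable with $u=0$ at $x=0$, satisfying $$\sup_{t\ge0}\int_0^\infty\big(u^2+x^{\alpha+2}|\partial_x^2u|^{\alpha+1}\big)dx+\int_0^\infty\!\!\int_0^\infty\Big((\partial_tu)^2+x^{\alpha+2}|\partial_x^2u|^{\alpha+1}+\big(\partial_x^2(x^{\alpha+2}g_\alpha(\partial_x^2u))\big)^2\Big)dx\,dt\le C_0\int_0^\infty\big(u_0^2+x^{\alpha+2}|\partial_x^2u_0|^{\alpha+1}\big)dx,$$ the equation $\partial_tu+\partial_x^2(x^{\alpha+2}g_\alpha(\partial_x^2u))=N(u)$ almost everywhere in $(0,\infty)^2$, $u\in C^{1/2}([0,\infty);L^2(0,\infty))\cap C^0([0,\infty);U_\alpha)$, and $u(0,\cdot)=u_0$. Then the velocity $$V:=\tfrac12x^{\alpha+1}(1+u)^{\frac\alpha2}g_\alpha(\partial_x^2u)$$ satisfies $V\in L^2(0,\infty;BC^0([0,\infty)))$ and $$\|V\|_{L^2(0,\infty;BC^0([0,\infty)))}^2=\int_0^\infty\sup_{x\ge0}|V(t,x)|^2\,dt\le C\int_0^\infty\big(u_0^2+x^{\alpha+2}|\partial_x^2u_0|^{\alpha+1}\big)\,dx.$$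
   Context: For $\alpha>1$ and $v\in\mathbb R$, $g_\alpha(v):=|v|^{\alpha-1}v$. The space $$U_\alpha:=\{u\in L^2(0,\infty):\ x^{\frac{\alpha+2}{\alpha+1}}\partial_x^2u\in L^{\alpha+1}(0,\infty),\ u=0\text{ at }x=0\}$$ (weak derivatives; elements are continuous on $(0,\infty)$ with a limit as $x\downarrow0$, and ''$u=0$ at $x=0$'' means this limit is $0$) carries the norm $\|u\|_{U_\alpha}:=\|u\|_{L^2(0,\infty)}+\|x^{\frac{\alpha+2}{\alpha+1}}\partial_x^2u\|_{L^{\alpha+1}(0,\infty)}$. The nonlinearity is $$N(u):=\big(1-(1+u)^{3/2}\big)\,\partial_x^2\big(x^{\alpha+2}g_\alpha(\partial_x^2u)\big)+(1+u)^{3/2}\,\partial_x^2\Big(\big(1-(1+u)^{\alpha/2}\big)x^{\alpha+2}g_\alpha(\partial_x^2u)\Big).$$ $BC^0([0,\infty))$ is the space of bounded continuous functions on $[0,\infty)$ with the supremum norm; $V(t,\cdot)$ is extended continuously to $x=0$. *)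

(* Defs.v *)
From mathcomp Require Import all_boot all_order all_algebra.
From mathcomp Require Import all_classical all_reals all_analysis.
Set Implicit Arguments.
Unset Strict Implicit.
Unset Printing Implicit Defensive.
Import Order.TTheory GRing.Theory Num.Theory.
Import numFieldNormedType.Exports.
Local Open Scope classical_set_scope.
Local Open Scope ring_scope.

(* Functions of (t, x) are curried, [u t x], and functions on the half-line or
   on the quadrant are total functions whose other values are irrelevant.
   Measurability is Borel measurability, as in MathComp-Analysis. *)

Section Defs.
Context {R : realType}.
Implicit Types (f h : R -> R) (u w : R -> R -> R) (a p : R).

Local Notation mu := (@lebesgue_measure R).
Local Notation mu2 := (mu \x mu)%E.

Definition halfline : set R := `]0, +oo[.
Definition quadrant : set (R * R) := halfline `*` halfline.
Definition closed_quadrant : set (R * R) := `[0, +oo[ `*` `[0, +oo[.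

Definition test_fun f : Prop :=
  (forall n x, derivable (derive1n n f) x 1) /\
  exists K, [/\ compact K, K `<=` halfline & forall x, ~ K x -> f x = 0].

Definition pdt u : R -> R -> R := fun t x => derive1 (fun s => u s x) t.
Definition pdx u : R -> R -> R := fun t x => derive1 (u t) x.

Fixpoint Ck2 (k : nat) u : Prop :=
  continuous (fun z : R * R => u z.1 z.2) /\
  if k is k'.+1 then
    [/\ forall t x, derivable (fun s => u s x) t 1,
        forall t x, derivable (u t) x 1,
        Ck2 k' (pdt u) & Ck2 k' (pdx u)]
  else True.

Definition test_fun2 u : Prop :=
  (forall k, Ck2 k u) /\
  exists K, [/\ compact K, K `<=` quadrant &
    forall t x, ~ K (t, x) -> u t x = 0].

(* The operators [wD2], [wDt], [wDxx] select one
   representative of the weak derivative; they are meaningful only under the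
   corresponding existence predicates [has_...]. *)

Definition is_wD2 f h : Prop :=
  [/\ locally_integrable halfline f, locally_integrable halfline h &
    forall phi, test_fun phi ->
      (\int[mu]_(x in halfline) (f x * derive1n 2 phi x)%:E =
       \int[mu]_(x in halfline) (h x * phi x)%:E)%E].

Definition has_wD2 f : Prop := exists h, is_wD2 f h.
Definition wD2 f : R -> R := xget (fun=> 0) [set h | is_wD2 f h].

Definition locally_integrable2 (D : set (R * R)) u : Prop :=
  measurable_fun D (fun z : R * R => u z.1 z.2) /\
  forall K : set (R * R), K `<=` D -> compact K ->
    (\int[mu2]_(z in K) `|u z.1 z.2|%:E < +oo)%E.

Definition is_wDt u w : Prop :=
  [/\ locally_integrable2 quadrant u, locally_integrable2 quadrant w &
    forall phi, test_fun2 phi ->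
      (\int[mu2]_(z in quadrant) (u z.1 z.2 * pdt phi z.1 z.2)%:E =
       - \int[mu2]_(z in quadrant) (w z.1 z.2 * phi z.1 z.2)%:E)%E].

Definition is_wDxx u w : Prop :=
  [/\ locally_integrable2 quadrant u, locally_integrable2 quadrant w &
    forall phi, test_fun2 phi ->
      (\int[mu2]_(z in quadrant) (u z.1 z.2 * pdx (pdx phi) z.1 z.2)%:E =
       \int[mu2]_(z in quadrant) (w z.1 z.2 * phi z.1 z.2)%:E)%E].

Definition has_wDt u : Prop := exists w, is_wDt u w.
Definition has_wDxx u : Prop := exists w, is_wDxx u w.
Definition wDt u : R -> R -> R := xget (fun _ _ => 0) [set w | is_wDt u w].
Definition wDxx u : R -> R -> R := xget (fun _ _ => 0) [set w | is_wDxx u w].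

Definition normLp p f : \bar R := ('N[mu]_(p%:E)[EFin \o (f \_ halfline)])%E.

Definition inLp p f : Prop := measurable_fun halfline f /\ (normLp p f < +oo)%E.

(* [f] stands for its class modulo null sets, so the trace at 0 is that of the
   continuous representative. *)
Definition zero_trace f : Prop :=
  exists h, [/\ f = h %[ae mu in halfline],
    {in `]0, +oo[, continuous h} & h x @[x --> 0^'+] --> 0].

Definition weighted_D2 a f : R -> R :=
  fun x => x `^ ((a + 2) / (a + 1)) * wD2 f x.

Definition Uspace a f : Prop :=
  [/\ inLp 2 f, has_wD2 f, inLp (a + 1) (weighted_D2 a f) & zero_trace f].

Definition Unorm a f : \bar R :=
  (normLp 2 f + normLp (a + 1) (weighted_D2 a f))%E.

Definition energy a f : \bar R :=
  (\int[mu]_(x in halfline)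
     (f x ^+ 2 + x `^ (a + 2) * `|wD2 f x| `^ (a + 1))%:E)%E.

(* For a negative base [powR] returns 1 (or 0 at base 0): real
   powers of [1 + u] have their usual meaning as soon as [u > -1]. *)

Definition gfun a (v : R) : R := `|v| `^ (a - 1) * v.

Definition flux a u : R -> R -> R :=
  fun t x => x `^ (a + 2) * gfun a (wDxx u t x).

Definition flux_pert a u : R -> R -> R :=
  fun t x => (1 - (1 + u t x) `^ (a / 2)) * flux a u t x.

Definition nonlin a u : R -> R -> R := fun t x =>
  (1 - (1 + u t x) `^ (3 / 2)) * wDxx (flux a u) t x
  + (1 + u t x) `^ (3 / 2) * wDxx (flux_pert a u) t x.

Definition velocity a u : R -> R -> R := fun t x =>
  2^-1 * x `^ (a + 1) * (1 + u t x) `^ (a / 2) * gfun a (wDxx u t x).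

Definition dissipation a u : \bar R :=
  (\int[mu]_(t in halfline) \int[mu]_(x in halfline)
     ((wDt u t x) ^+ 2 + x `^ (a + 2) * `|wDxx u t x| `^ (a + 1)
      + (wDxx (flux a u) t x) ^+ 2)%:E)%E.

Definition sup_energy a u : \bar R :=
  ereal_sup [set energy a (u t) | t in `[0, +oo[].

Definition solves_equation a u : Prop :=
  [/\ has_wDt u, has_wDxx u, has_wDxx (flux a u), has_wDxx (flux_pert a u) &
    {ae mu2, forall z, quadrant z ->
      wDt u z.1 z.2 + wDxx (flux a u) z.1 z.2 = nonlin a u z.1 z.2}].

Definition holder_half_L2 u : Prop :=
  (forall t, 0 <= t -> inLp 2 (u t)) /\
  exists K : R, forall s t, 0 <= s -> 0 <= t ->
    (normLp 2 (u t \- u s)%R <= (K * Num.sqrt `|t - s|)%:E)%E.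

Definition continuous_U a u : Prop :=
  (forall t, 0 <= t -> Uspace a (u t)) /\
  forall t0, 0 <= t0 ->
    Unorm a (u t \- u t0)%R @[t --> within `[0, +oo[ (nbhs t0)] --> 0%E.

Definition BC0 f : Prop :=
  {within `[0, +oo[, continuous f} /\
  exists M : R, forall x, 0 <= x -> `|f x| <= M.

Definition supnorm f : \bar R := ereal_sup [set `|f x|%:E | x in `[0, +oo[].

Definition simple_BC0 (s : R -> R -> R) : Prop :=
  exists (m : nat) (A : 'I_m -> set R) (b : 'I_m -> R -> R),
    [/\ forall i, measurable (A i), forall i, BC0 (b i) &
      forall t x, s t x = \sum_(i < m) \1_(A i) t * b i x].

(* Strong measurability; it is not implied by scalar measurability since
   BC^0([0, oo)) is not separable. *)
Definition strongly_measurable_BC0 (v : R -> R -> R) : Prop :=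
  exists s : nat -> R -> R -> R,
    (forall n, simple_BC0 (s n)) /\
    {ae mu, forall t, halfline t ->
      supnorm (s n t \- v t)%R @[n --> \oo] --> 0%E}.

Definition normsq_L2BC0 (v : R -> R -> R) : \bar R :=
  (\int[mu]_(t in halfline) (supnorm (v t)) ^+ 2)%E.

Definition inL2BC0 (v : R -> R -> R) : Prop :=
  [/\ forall t, 0 < t -> BC0 (v t), strongly_measurable_BC0 v &
    (normsq_L2BC0 v < +oo)%E].

(* [v] represents the function [V], given almost everywhere on the quadrant,
   with [v t] the continuous extension of [V t] to [0, oo). *)
Definition continuous_version (V v : R -> R -> R) : Prop :=
  {ae mu, forall t, halfline t -> V t = v t %[ae mu in halfline]}.

End Defs.

(* Main.v *)
Require Import Defs.
From mathcomp Require Import all_boot all_order all_algebra.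
From mathcomp Require Import all_classical all_reals all_analysis.
From mathcomp Require Import ring lra measurable_realfun.
Set Implicit Arguments.
Unset Strict Implicit.
Unset Printing Implicit Defensive.
Import Order.TTheory GRing.Theory Num.Theory.
Import numFieldNormedType.Exports.
Local Open Scope classical_set_scope.
Local Open Scope ring_scope.

(** The estimate holds separately at almost every time [t] and is then integrated
    in [t]. Write [F] for the second derivative of [u t], [w = x `^ (a + 2) * gfun a F]
    for the flux and [H] for the second derivative of [w], so that the velocity is
    half of [(1 + u) `^ (a / 2) * (w / x)], and let [D] be the dissipation at time
    [t], which controls the integrals of [x `^ (a + 2) * `|F| `^ (a + 1)] and of
    [H ^+ 2].

    The supremum of the energy in time is at most [C0] times the initial energy, so
    for small initial data every slice has small energy, and this forces
    [`|u| <= 1/2] (lemma [energy_small_sup]): near infinity by comparing the values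
    at two points, near 0 by integrating twice a singular Young inequality. Hence
    the factor [(1 + u) `^ (a / 2)] is bounded.

    For the quotient [w / x] one needs a pointwise bound by a multiple of the square
    root of [D]. Since [H] is square integrable, [w] has a derivative that is Hoelder
    continuous of exponent 1/2. On a long interval starting at [x >= 1], the energy
    makes [w] small at two separated points, and the Hoelder bound propagates this to
    [x] with a gain, which also gives decay at infinity (lemma [flux_far]). Near 0
    finite energy makes [w] vanish along a sequence, so that [w / x] is a mean of the
    derivative of [w]: it is bounded and has a limit (lemmas [flux_near] and
    [flux_quotient_limit]). The result is [velocity_fixed_time]: a continuous
    representative of the velocity on [[0, oo)], vanishing at infinity, whose square
    is at most [K * D].

    Passing from the quadrant to time slices uses test functions that are products,
    and only countably many of them, so that the exceptional times form a null set
    (lemmas [slice_weak_D2] and [weak_D2_representative]). The representatives vanish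
    at infinity, hence live in a separable space, where strong measurability follows
    from measurability at each point (lemma [strongly_measurable_C0]); the latter
    holds because the value at a point is determined by the measures of sections
    (lemma [measurable_trace]). *)

(** * Smooth functions *)

Section Smooth.
Context {R : realType}.
Implicit Types f g : R -> R.

Definition smooth f : Prop := forall n x, derivable (derive1n n f) x 1.

(** Derivatives of products, or of [flat p] below, have no convenient closed form;
    exhibiting a class of functions stable under differentiation replaces an
    induction on the order. *)
Lemma smooth_coind (C : set (R -> R)) :
  (forall f, C f -> (forall x, derivable f x 1) /\ C (derive1 f)) ->
  forall f, C f -> smooth f.
Proof.
move=> Cd f Cf n; elim: n f Cf => [|n IH] f Cf x.
  by have [+ _] := Cd _ Cf; apply.
by rewrite derive1Sn; apply: IH; have [] := Cd _ Cf.
Qed.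

Lemma smooth_derivable f (x : R) : smooth f -> derivable f x 1.
Proof. by move=> sf; exact: (sf 0%N x). Qed.

Lemma smooth_derive1 f : smooth f -> smooth (derive1 f).
Proof. by move=> sf n x; rewrite -derive1Sn; exact: sf. Qed.

Lemma smooth_is_derive f (x : R) : smooth f -> is_derive x 1 f (derive1 f x).
Proof.
by move=> sf; rewrite derive1E; apply: derivableP; exact: smooth_derivable.
Qed.

Lemma smooth_continuous f : smooth f -> continuous f.
Proof.
move=> sf x; apply: differentiable_continuous.
by apply/derivable1_diffP; exact: smooth_derivable.
Qed.

Lemma is_derive_derive1 f (df : R -> R) :
  (forall x : R, is_derive x 1 f (df x)) -> derive1 f = df.
Proof. by move=> fdf; apply/funext => x; rewrite derive1E derive_val. Qed.

Lemma smooth_cst (c : R) : smooth (fun=> c).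
Proof.
apply: (@smooth_coind [set f | exists c : R, f = fun=> c]); last by exists c.
move=> _ [k ->]; split; first by move=> x; exact: derivable_cst.
by exists 0; apply: is_derive_derive1 => x; exact: is_derive_cst.
Qed.

Lemma smooth_add f g : smooth f -> smooth g -> smooth (fun x => f x + g x).
Proof.
move=> sf sg; apply: (@smooth_coind [set h | exists f g,
  [/\ smooth f, smooth g & h = fun x => f x + g x]]); last by exists f, g.
move=> _ [a [b [sa sb ->]]].
have d (x : R) : is_derive x 1 (fun x => a x + b x) (derive1 a x + derive1 b x).
  by apply: is_deriveD; exact: smooth_is_derive.
split; first by move=> x; apply: ex_derive.
exists (derive1 a), (derive1 b); split; [exact: smooth_derive1..|].
exact: is_derive_derive1.
Qed.

(** The class stable under differentiation that contains the products. *)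
Inductive sum_of_products : (R -> R) -> Prop :=
| sop_mul f g : smooth f -> smooth g -> sum_of_products (fun x => f x * g x)
| sop_add f g : sum_of_products f -> sum_of_products g ->
    sum_of_products (fun x => f x + g x).

Lemma smooth_mul f g : smooth f -> smooth g -> smooth (fun x => f x * g x).
Proof.
move=> sf sg; apply: (@smooth_coind sum_of_products); last exact: sop_mul.
move=> h; elim=> {h} [a b sa sb|a b _ [da Ca] _ [db Cb]].
  have d (x : R) : is_derive x 1 (fun x => a x * b x)
      (derive1 a x * b x + a x * derive1 b x).
    have := is_deriveM (smooth_is_derive x sa) (smooth_is_derive x sb).
    by move/is_derive_eq; apply; rewrite /GRing.scale/= addrC mulrC.
  split; first by move=> x; apply: ex_derive.
  rewrite (is_derive_derive1 d).
  exact (sop_add (sop_mul (smooth_derive1 sa) sb) (sop_mul sa (smooth_derive1 sb))).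
have d (x : R) : is_derive x 1 (fun x => a x + b x) (derive1 a x + derive1 b x).
  by apply: is_deriveD; rewrite derive1E; exact: derivableP.
split; first by move=> x; apply: ex_derive.
by rewrite (is_derive_derive1 d); exact: sop_add.
Qed.

Lemma smooth_affine f (c a b : R) :
  smooth f -> smooth (fun x => c * f (a * x + b)).
Proof.
move=> sf; apply: (@smooth_coind [set h | exists c f,
  smooth f /\ h = fun x => c * f (a * x + b)]); last by exists c, f.
move=> _ [k [g [sg ->]]].
have d (x : R) : is_derive x 1 (fun x => k * g (a * x + b))
    (k * a * derive1 g (a * x + b)).
  have l : is_derive x 1 (fun x : R => a * x + b) a.
    have := is_deriveD (is_deriveZ a (is_derive_id x 1)) (is_derive_cst b x 1).
    by move/is_derive_eq; apply; rewrite addr0 /GRing.scale/= mulr1.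
  have := is_deriveZ k (@is_derive1_comp _ g (fun x => a * x + b) x _ _
    (smooth_is_derive (a * x + b) sg) l).
  by move/is_derive_eq; apply; rewrite /GRing.scale/=; ring.
split; first by move=> x; apply: ex_derive.
exists (k * a), (derive1 g); split; first exact: smooth_derive1.
exact: is_derive_derive1.
Qed.

Lemma lipschitz_cvg f (x l C : R) :
  (forall z, `|f z - l| <= C * `|z - x|) -> f z @[z --> x] --> l.
Proof.
move=> fC; have C0 : 0 <= C.
  by have := fC (x + 1); rewrite addrAC subrr add0r normr1 mulr1; exact: le_trans.
have C1 : 0 < C + 1 by rewrite ltr_wpDl.
apply/cvgrPdist_le => e e0; apply/nbhs_ballP; exists (e / (C + 1)) => /=.
  by rewrite divr_gt0.
move=> z /=; rewrite /ball_/= distrC ltr_pdivlMr// => ze.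
rewrite distrC (le_trans (fC z))// (le_trans _ (ltW ze))// mulrC ler_wpM2l//.
by rewrite lerDl.
Qed.

Lemma is_derive_quadratic f (C : R) :
  (forall x, `|f x| <= C * x ^+ 2) -> is_derive (0 : R) 1 f 0.
Proof.
move=> fC; have f0 : f 0 = 0.
  by apply/eqP; rewrite -normr_eq0 eq_le normr_ge0 andbT (le_trans (fC _))// expr0n mulr0.
apply/is_derive1_caratheodory; exists (fun z => f z / z); split.
- move=> z; rewrite f0 !subr0; have [->|z0] := eqVneq z 0.
    by rewrite f0 mulr0.
  by rewrite divfK.
- apply: (@lipschitz_cvg _ _ _ C) => z.
  rewrite f0 mul0r !subr0 normrM normfV.
  have [->|z0] := eqVneq z 0; first by rewrite f0 normr0 mul0r mulr0.
  rewrite ler_pdivrMr ?normr_gt0// (le_trans (fC _))//.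
  by rewrite -(ger0_norm (sqr_ge0 z)) normrX expr2 mulrA.
- by rewrite f0 mul0r.
Qed.

(** The classical smooth but not analytic functions, with a polynomial
    prefactor so that differentiation only changes [p]. *)
Definition flat (p : {poly R}) (x : R) : R :=
  if 0 < x then p.[x^-1] * expR (- x^-1) else 0.

(** [exp (-1/x)] beats every power of [1/x]; the square is what the derivative
    at 0 needs, and knowing it for every [p] gives the higher derivatives. *)
Lemma flat_quadratic (p : {poly R}) :
  exists C : R, forall x, `|flat p x| <= C * x ^+ 2.
Proof.
exists (\sum_(i < size p) `|p`_i| * (i.+2)`!%:R) => x; rewrite /flat.
have C0 : 0 <= \sum_(i < size p) `|p`_i| * (i.+2)`!%:R.
  by apply: sumr_ge0 => i _; rewrite mulr_ge0.
case: ifPn => x0; last by rewrite normr0 mulr_ge0// sqr_ge0.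
rewrite normrM (gtr0_norm (expR_gt0 _)) horner_coef.
apply: (@le_trans _ _ ((\sum_(i < size p) `|p`_i| * x^-1 ^+ i) * expR (- x^-1))).
  rewrite ler_wpM2r ?expR_ge0// (le_trans (ler_norm_sum _ _ _))//.
  by apply: ler_sum => i _; rewrite normrM normrX normfV (gtr0_norm x0).
rewrite !mulr_suml; apply: ler_sum => i _; rewrite -!mulrA ler_wpM2l//.
rewrite expRN ler_pdivrMr ?expR_gt0//.
have y0 : 0 <= x^-1 by rewrite invr_ge0 ltW.
have := expR_ge1Dxn i.+1 y0; set E := expR _ => h.
have {}h : x^-1 ^+ i.+2 / (i.+2)`!%:R <= E by apply: le_trans h; rewrite lerDr.
have f0 : 0 < (i.+2)`!%:R :> R by rewrite ltr0n fact_gt0.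
rewrite ler_pdivrMr// in h.
rewrite mulrAC -ler_pdivrMr ?exprn_gt0// -exprVn -exprD addn2.
by rewrite mulrC.
Qed.

Lemma is_derive_flat (p : {poly R}) (x : R) :
  is_derive x 1 (flat p) (flat ('X ^+ 2 * (p - p^`())) x).
Proof.
have [x0|x0|->] := ltrgtP x 0.
- rewrite {2}/flat ltNge (ltW x0)/=.
  apply: (@near_eq_is_derive _ _ _ (cst 0)).
  near=> z; rewrite /flat ltNge ltW//; near: z; exact: lt_nbhsl.
- rewrite {2}/flat x0.
  apply: (@near_eq_is_derive R R R (fun z : R => p.[z^-1] * expR (- z^-1))).
  - by near=> z; rewrite /flat ifT//; near: z; exact: lt_nbhsr.
  - have i : is_derive x 1 (fun z : R => z^-1) (- x ^- 2).
      have := @is_deriveV _ id x 1 1 (lt0r_neq0 x0) (is_derive_id x 1).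
      by move/is_derive_eq; apply; rewrite /GRing.scale/= mulr1.
    have j := @is_derive1_comp _ (horner p) (fun z : R => z^-1) x _ _
      (is_derive_poly p _) i.
    have k := @is_derive1_comp _ expR (fun z : R => - z^-1) x _ _
      (is_derive_expR _) (is_deriveN i).
    have := is_deriveM j k.
    move/is_derive_eq; apply; rewrite /GRing.scale/= !hornerE/= exprVn; ring.
- rewrite {2}/flat ltxx; have [C hC] := flat_quadratic p.
  exact: is_derive_quadratic hC.
Unshelve. all: by end_near. Qed.

Lemma smooth_flat (p : {poly R}) : smooth (flat p).
Proof.
apply: (@smooth_coind [set f | exists p, f = flat p]); last by exists p.
move=> _ [q ->]; split; first by move=> x; apply: ex_derive; exact: is_derive_flat.
exists ('X ^+ 2 * (q - q^`())); apply: is_derive_derive1; exact: is_derive_flat.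
Qed.

End Smooth.

(** * Test functions on the line *)

Section TestFunctions.
Context {R : realType}.
Implicit Types (f g : R -> R) (a b c d : R).
Local Notation mu := (@lebesgue_measure R).

Definition supp c d f : Prop := forall x, f x != 0 -> c <= x <= d.

Definition test_on c d f : Prop := smooth f /\ supp c d f.

Lemma supp_widen c d c' d' f : c' <= c -> d <= d' -> supp c d f -> supp c' d' f.
Proof.
by move=> cc dd s x /s /andP[cx xd]; rewrite (le_trans cc cx) (le_trans xd dd).
Qed.

Lemma supp0 c d f x : supp c d f -> (x < c) || (d < x) -> f x = 0.
Proof.
move=> s xcd; apply/eqP/negPn/negP => /s /andP[cx xd].
by move: xcd; rewrite !ltNge cx xd.
Qed.

Lemma patch_supp c d f (D : set R) : supp c d f -> `[c, d] `<=` D -> f \_ D = f.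
Proof.
move=> s cdD; apply/funext => x; rewrite patchE; case: ifPn => // xD.
apply/esym/eqP/negPn/negP => /s xcd; move/negP: xD; apply.
by rewrite inE; apply: cdD; rewrite /= in_itv.
Qed.

Lemma Rintegral_supp c d f (D : set R) : supp c d f -> `[c, d] `<=` D ->
  \int[mu]_(x in D) f x = \int[mu]_(x in [set: R]) f x.
Proof. by move=> s cdD; rewrite Rintegral_mkcond (patch_supp s cdD). Qed.

Lemma integrable_supp c d f : continuous f -> supp c d f ->
  mu.-integrable [set: R] (EFin \o f).
Proof.
move=> cf s; rewrite -(patch_supp s (@subset_refl _ _)) -restrict_EFin.
refine ((@integrable_mkcond _ _ _ mu `[c, d] (EFin \o f) _).1 _) => //.
apply: continuous_compact_integrable.
  exact: segment_compact.
exact: continuous_subspaceT.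
Qed.

Lemma test_on_integrable c d f (i : interval R) : test_on c d f ->
  mu.-integrable [set` i] (EFin \o f).
Proof.
move=> [sf s]; apply: (@integrableS _ _ _ mu setT) => //.
by apply: integrable_supp s; exact: smooth_continuous.
Qed.

Lemma test_on_widen c d c' d' f : c' <= c -> d <= d' -> test_on c d f -> test_on c' d' f.
Proof. by move=> cc dd [sf s]; split=> //; exact: supp_widen s. Qed.

Lemma test_on_derive1 c d f : test_on c d f -> test_on c d (derive1 f).
Proof.
move=> [sf s]; split; first exact: smooth_derive1.
move=> x; apply: contra_neqT; rewrite negb_and -!ltNge => xcd.
rewrite derive1E; have -> : 'D_1 f x = 'D_1 (cst 0 : R -> R) x; last first.
  exact: derive_cst.
apply: near_eq_derive.
case/orP : xcd => h; near=> z; rewrite (supp0 s)//.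
  by apply/orP; left; near: z; exact: lt_nbhsl.
by apply/orP; right; near: z; exact: lt_nbhsr.
Unshelve. all: by end_near. Qed.

Lemma test_on_add c d f g : test_on c d f -> test_on c d g ->
  test_on c d (fun x => f x + g x).
Proof.
move=> [sf Sf] [sg Sg]; split; first exact: smooth_add.
move=> x; have [f0|/Sf//] := eqVneq (f x) 0.
by rewrite f0 add0r; exact: Sg.
Qed.

Lemma test_on_scale c d f (k : R) : test_on c d f -> test_on c d (fun x => k * f x).
Proof.
move=> [sf Sf]; split; first exact: (@smooth_mul R (fun=> k) f (@smooth_cst R k) sf).
by move=> x; rewrite mulf_eq0 negb_or => /andP[_ /Sf].
Qed.

Lemma test_on_test_fun c d f : 0 < c -> test_on c d f -> test_fun f.
Proof.
move=> c0 [sf s]; split=> //; exists [set` `[c, d]]; split.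
- exact: segment_compact.
- by move=> x /=; rewrite /halfline/= !in_itv/= andbT => /andP[cx _]; exact: lt_le_trans cx.
- by move=> x; apply: contra_notP => /eqP fx0; rewrite /= in_itv; exact: s.
Qed.

Lemma smooth_of_derive1 f g : (forall x : R, is_derive x 1 f (g x)) ->
  smooth g -> smooth f.
Proof.
move=> fg sg; apply: (@smooth_coind _ [set h | smooth h \/
  exists k, smooth k /\ forall x : R, is_derive x 1 h (k x)]); last first.
  by right; exists g.
move=> h [sh|[k [sk hk]]].
  by split; [move=> x; exact: smooth_derivable|left; exact: smooth_derive1].
split; first by move=> x; apply: ex_derive.
by rewrite (is_derive_derive1 hk); left.
Qed.

(** From minus infinity rather than from a base point: a primitive of a test
    function of zero integral is then again a test function. *)
Definition primitive f (x : R) : R := \int[mu]_(t in `]-oo, x]) f t.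

Lemma is_derive_primitive c d f (x : R) : test_on c d f ->
  is_derive x 1 (primitive f) (f x).
Proof.
move=> bf; have [sf s] := bf.
have := @continuous_FTC1 R f -oo%O x (x + 1).
case.
- by rewrite ltrDl.
- exact: test_on_integrable bf.
- by rewrite ltNyr.
- exact: smooth_continuous.
move=> dF F'; rewrite -F' derive1E; exact: derivableP.
Qed.

Lemma primitive_test_on c d f : test_on c d f -> \int[mu]_(x in [set: R]) f x = 0 ->
  test_on c d (primitive f).
Proof.
move=> bf If; have [sf s] := bf; split.
  by apply: (@smooth_of_derive1 _ f) => // x; exact: is_derive_primitive bf.
move=> x; apply: contra_neqT; rewrite negb_and -!ltNge => /orP[xc|dx].
  rewrite /primitive (@eq_Rintegral _ _ _ mu _ (cst 0)) ?Rintegral_cst ?mul0r//.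
  move=> y; rewrite inE/= in_itv/= => yx.
  by rewrite (supp0 s)// (le_lt_trans yx xc).
rewrite /primitive (Rintegral_supp s)// => y /=; rewrite !in_itv/= => /andP[_ yd].
by rewrite (le_trans yd)// ltW.
Qed.

Lemma derive1_primitive c d f : test_on c d f -> derive1 (primitive f) = f.
Proof.
by move=> bf; apply: is_derive_derive1 => x; exact: is_derive_primitive bf.
Qed.

(** As [n] grows, the two edges steepen and the plateau tends to the indicator
    of the open interval. With rational [a] and [b] these are countably many test
    functions, which is what statements at almost every time require. *)
Definition plateau (n : nat) a b (x : R) : R :=
  flat 1 (n.+1%:R * (x - a)) * flat 1 (n.+1%:R * (b - x)).

Lemma flat1_ge0 x : 0 <= flat (1 : {poly R}) x.
Proof. by rewrite /flat; case: ifP => // _; rewrite hornerE mul1r expR_ge0. Qed.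

Lemma flat1_gt0 x : 0 < x -> 0 < flat (1 : {poly R}) x.
Proof. by rewrite /flat => ->; rewrite hornerE mul1r expR_gt0. Qed.

Lemma flat1_le1 x : flat (1 : {poly R}) x <= 1.
Proof.
rewrite /flat; case: ifP => // x0; rewrite hornerE mul1r.
by rewrite -[leRHS]expR0 ler_expR lerNl oppr0 invr_ge0 ltW.
Qed.

Lemma plateau_ge0 n a b x : 0 <= plateau n a b x.
Proof. by rewrite mulr_ge0// flat1_ge0. Qed.

Lemma plateau_le1 n a b x : plateau n a b x <= 1.
Proof. by rewrite mulr_ile1 ?flat1_ge0 ?flat1_le1. Qed.

Lemma plateau_gt0 n a b x : a < x < b -> 0 < plateau n a b x.
Proof.
by move=> /andP[ax xb]; rewrite mulr_gt0// flat1_gt0// mulr_gt0// subr_gt0.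
Qed.

Lemma plateau_out n a b x : ~~ (a < x < b) -> plateau n a b x = 0.
Proof.
rewrite negb_and -!leNgt /plateau /flat => /orP[xa|bx].
  by rewrite ifN ?mul0r// -leNgt mulr_ge0_le0// subr_le0.
by rewrite [X in _ * X]ifN ?mulr0// -leNgt mulr_ge0_le0// subr_le0.
Qed.

Lemma test_on_plateau n a b : test_on a b (plateau n a b).
Proof.
split; last first.
  move=> x; apply: contra_neqT => xab; apply: plateau_out.
  by apply: contra xab => /andP[ax xb]; rewrite !ltW.
have s := @smooth_flat R 1.
have -> : plateau n a b = fun x =>
    (1 * flat 1 (n.+1%:R * x + - (n.+1%:R * a))) *
    (1 * flat 1 (- n.+1%:R * x + n.+1%:R * b)).
  apply/funext => x; rewrite /plateau !mul1r; congr (flat _ _ * flat _ _); ring.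
by apply: smooth_mul; exact: smooth_affine.
Qed.

Lemma flat1_cvg (x : R) : 0 < x -> flat (1 : {poly R}) (n.+1%:R * x) @[n --> \oo] --> (1 : R).
Proof.
move=> x0; have -> : (fun n => flat 1 (n.+1%:R * x)) =
    (fun n => expR (- (x^-1 * n.+1%:R^-1))).
  apply/funext => n; rewrite /flat mulr_gt0// hornerE mul1r invfM//.
  by rewrite mulrC.
have h : - (x^-1 * n.+1%:R^-1) @[n --> \oo] --> (0 : R).
  rewrite -oppr0; apply: cvgN; rewrite -(mulr0 x^-1); apply: cvgM.
    exact: cvg_cst.
  exact: cvg_harmonic.
have e : expR (- (x^-1 * n.+1%:R^-1)) @[n --> \oo] --> expR (0 : R).
  by apply: continuous_cvg => //; exact: continuous_expR.
by move: e; rewrite expR0.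
Qed.

Lemma plateau_cvg a b x :
  plateau n a b x @[n --> \oo] --> (\1_(`]a, b[ : set R) x : R).
Proof.
rewrite indicE; case: (boolP (a < x < b)) => xab.
  rewrite mem_set/= ?in_itv//; move/andP: xab => [ax xb].
  by rewrite -[X in _ --> X](mulr1 1); apply: cvgM; apply: flat1_cvg; rewrite subr_gt0.
rewrite memNset/= ?in_itv/=; last exact/negP.
by under eq_fun do rewrite plateau_out//; exact: cvg_cst.
Qed.

(** Were the integral zero, the primitive would vanish at both ends and the mean
    value theorem would produce an interior zero of the plateau. *)
Lemma plateau_integral_gt0 n a b : a < b -> 0 < \int[mu]_(x in [set: R]) plateau n a b x.
Proof.
move=> ab; have bp := test_on_plateau n a b.
have I0 : 0 <= \int[mu]_(x in [set: R]) plateau n a b x.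
  by apply: Rintegral_ge0 => x _; exact: plateau_ge0.
rewrite lt_neqAle I0 andbT; apply/eqP => /esym Ip.
have [sP SP] := primitive_test_on bp Ip.
have [c cab] : exists2 c, c \in `]a, b[ & primitive (plateau n a b) b -
    primitive (plateau n a b) a = plateau n a b c * (b - a).
  apply: MVT => // [x _|]; first exact: is_derive_primitive bp.
  by apply: continuous_subspaceT; exact: smooth_continuous.
have P0 x : x <= a \/ b <= x -> primitive (plateau n a b) x = 0.
  case=> h; last first.
    rewrite /primitive (Rintegral_supp bp.2)// => y /=.
    by rewrite !in_itv/= => /andP[_ yb]; exact: le_trans h.
  rewrite /primitive (@eq_Rintegral _ _ _ mu _ (cst 0)) ?Rintegral_cst ?mul0r//.
  move=> y; rewrite inE/= in_itv/= => yx.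
  by rewrite plateau_out// ltNge (le_trans yx h).
rewrite !P0 ?lexx; [|by left|by right].
rewrite subrr => /esym/eqP; rewrite mulf_eq0 subr_eq0 (gt_eqF ab) orbF.
rewrite gt_eqF// plateau_gt0//; by rewrite in_itv in cab.
Qed.

End TestFunctions.

(** * The fundamental lemma of the calculus of variations *)

Section Fundamental.
Context {R : realType}.
Implicit Types (f g h : R -> R) (a b c d : R).
Local Notation mu := (@lebesgue_measure R).
Local Notation RM := (measurableTypeR R).

Lemma integrable_mul_bounded (D : set RM) (f h : R -> R) (M : R) :
  measurable D -> mu.-integrable D (EFin \o f) ->
  measurable_fun D h -> (forall x, D x -> `|h x| <= M) ->
  mu.-integrable D (fun x => (f x * h x)%:E).
Proof.
move=> mD fi mh hM.
have : mu.-integrable D (fun x => (M%:E * (EFin \o f) x)%E).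
  exact: integrableZl.
apply: le_integrable => //.
  apply/measurable_EFinP; apply: measurable_funM => //.
  by apply/measurable_EFinP; exact: measurable_int fi.
move=> x Dx /=; rewrite lee_fin !normrM mulrC ler_wpM2r//.
by rewrite (le_trans (hM _ Dx))// ler_norm.
Qed.

Lemma itv_halfline c d : 0 < c -> [set` `[c, d]] `<=` (halfline : set R).
Proof.
move=> c0 x; rewrite /halfline/= !in_itv/= andbT => /andP[cx _].
exact: lt_le_trans cx.
Qed.

Lemma measurable_halfline : measurable (halfline : set RM).
Proof. by rewrite /halfline; exact: measurable_itv. Qed.

Lemma loc_int_itv c d f : 0 < c -> locally_integrable halfline f ->
  mu.-integrable `[c, d] (EFin \o f).
Proof.
move=> c0 [mf _ fi]; apply/integrableP; split.
  apply/measurable_EFinP; apply: measurable_funS mf => //; first exact: measurable_halfline.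
  exact: itv_halfline.
apply: fi; first exact: itv_halfline.
exact: segment_compact.
Qed.

Lemma continuous_bounded_itv c d h : continuous h ->
  exists M : R, forall x, `[c, d]%classic x -> `|h x| <= M.
Proof.
move=> ch; have [cd|dc] := leP c d; last first.
  by exists 0 => x; rewrite /= in_itv/= => /andP[cx /(le_trans cx)]; rewrite leNgt dc.
have cn : {within `[c, d], continuous (fun x => `|h x|)}.
  by apply: continuous_subspaceT => x; apply: (@cvg_norm _ R); exact: ch.
have [x _ xM] := EVT_max cd cn.
by exists `|h x| => y; rewrite /= in_itv => yi; exact: xM.
Qed.

Lemma integrable_loc_mul c d f h (D : set RM) : 0 < c -> measurable D ->
  [set` `[c, d]] `<=` D -> locally_integrable halfline f ->
  continuous h -> supp c d h ->
  mu.-integrable D (fun x => (f x * h x)%:E).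
Proof.
move=> c0 mD cdD fi ch sh.
have sfh : supp c d (fun x => f x * h x).
  by move=> x; rewrite mulf_eq0 negb_or => /andP[_ /sh].
have [M hM] := continuous_bounded_itv c d ch.
have i : mu.-integrable `[c, d] (EFin \o (fun x => f x * h x)).
  apply: integrable_mul_bounded hM => //; first exact: loc_int_itv.
  by apply: measurable_funTS; exact: continuous_measurable_fun.
rewrite -/(EFin \o (fun x => f x * h x)).
rewrite -(patch_supp sfh (@subset_refl _ _)) -restrict_EFin.
apply/integrable_restrict => //.
apply: (@integrableS _ _ _ mu `[c, d]) => //.
exact: measurableI.
Qed.

Lemma integrable_pairing c d f h : 0 < c -> locally_integrable halfline f ->
  continuous h -> supp c d h ->
  mu.-integrable halfline (fun x => (f x * h x)%:E).
Proof.
move=> c0; apply: integrable_loc_mul => //; first exact: measurable_halfline.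
exact: itv_halfline.
Qed.

Definition pairing f h : R := \int[mu]_(x in halfline) (f x * h x).

Lemma pairingE c d f h : 0 < c -> locally_integrable halfline f ->
  continuous h -> supp c d h ->
  (\int[mu]_(x in halfline) (f x * h x)%:E = (pairing f h)%:E)%E.
Proof.
move=> c0 fi ch sh; rewrite /pairing /Rintegral fineK//.
apply: integrable_fin_num; first exact: measurable_halfline.
exact: integrable_pairing sh.
Qed.

Lemma plateau_pairing_cvg f a b : 0 < a -> locally_integrable halfline f ->
  pairing f (plateau n a b) @[n --> \oo] --> \int[mu]_(x in `]a, b[) f x.
Proof.
move=> a0 fi; have iab : mu.-integrable `]a, b[ (EFin \o f).
  apply: (@integrableS _ _ _ mu `[a, b]) => //; last exact: loc_int_itv.
  exact: subset_itv_oo_cc.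
have mab := measurable_int mu iab.
have mfp n : measurable_fun `]a, b[ (EFin \o (fun x => f x * plateau n a b x)).
  apply/measurable_EFinP; apply: measurable_funM; first exact/measurable_EFinP.
  apply: measurable_funTS; apply: continuous_measurable_fun.
  by apply: smooth_continuous; have [] := test_on_plateau n a b.
have e n : pairing f (plateau n a b) =
    \int[mu]_(x in `]a, b[) (f x * plateau n a b x).
  rewrite /pairing Rintegral_mkcond [RHS]Rintegral_mkcond.
  congr Rintegral; apply/funext => x; rewrite !patchE.
  have [xab|xab] := boolP (a < x < b).
    rewrite !mem_set//= ?in_itv//=; rewrite /halfline/= in_itv/= andbT.
    by move/andP : xab => [ax _]; exact: lt_trans ax.
  by rewrite plateau_out// mulr0; case: ifP; case: ifP.
have [] := @dominated_convergence _ _ _ mu `]a, b[ (measurable_itv _)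
  (fun n => EFin \o (fun x => f x * plateau n a b x)) (EFin \o f)
  (fun x => `|(f x)%:E|%E) mfp mab.
- apply: aeW => x /=; rewrite in_itv/= => xab; apply: cvg_EFin; first exact: nearW.
  rewrite -[X in _ --> X]mulr1; apply: cvgM; first exact: cvg_cst.
  by have := @plateau_cvg R a b x; rewrite indicE mem_set//= in_itv.
- exact: integrable_abse iab.
- apply: aeW => x n _; rewrite /= lee_fin normrM ler_piMr//.
  by rewrite ger0_norm ?plateau_ge0// plateau_le1.
move=> _ _.
move=> h; under eq_fun do rewrite e /Rintegral.
have fn : (\int[mu]_(x in `]a, b[) (f x)%:E)%E \is a fin_num.
  exact: integrable_fin_num iab.
by apply: fine_cvg; rewrite fineK.
Qed.

(** In the limit, [f] has zero integral over every interval with rational ends,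
    so its indefinite integral vanishes by continuity; Lebesgue differentiation
    returns [f]. Only countably many tests are made, so that the hypothesis can be
    met simultaneously by almost all time slices. *)
Lemma plateau_orthogonal_eq0 f : locally_integrable halfline f ->
  (forall n (a b : rat), 0 < ratr a :> R -> (ratr a : R) < ratr b ->
    pairing f (plateau n (ratr a) (ratr b)) = 0) ->
  f = cst 0 %[ae mu in halfline].
Proof.
move=> fi f0.
have int0 (a b : rat) : 0 < ratr a :> R -> (ratr a : R) < ratr b ->
    \int[mu]_(x in `[ratr a, ratr b]) f x = 0.
  move=> a0 ab.
  have h := @plateau_pairing_cvg f (ratr a) (ratr b) a0 fi.
  have {h} : \int[mu]_(x in `]ratr a, ratr b[) f x = 0.
    have z : pairing f (plateau n (ratr a) (ratr b)) @[n --> \oo] --> (0 : R).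
      by under eq_fun do rewrite f0//; exact: cvg_cst.
    exact: cvg_unique h z.
  have ic : mu.-integrable `[ratr a, ratr b] (EFin \o f) by exact: loc_int_itv.
  rewrite Rintegral_itv_obnd_cbnd; last first.
    by apply: integrableS ic => //; exact: subset_itv_oo_cc.
  rewrite Rintegral_itv_bndo_bndc//.
  by apply: integrableS ic => // x /=; rewrite !in_itv/= => /andP[-> /ltW].
suff main (c : rat) (d : R) : 0 < ratr c :> R -> (ratr c : R) < d ->
    {ae mu, forall x, ratr c < x < d -> f x = 0}.
  have : {ae mu, forall x (n : nat),
      ratr n.+1%:R^-1 < x < n.+2%:R -> f x = 0}.
    apply/ae_foralln => n; apply: main; rewrite fmorphV/= ratr_nat.
      by rewrite invr_gt0 ltr0n.
    by rewrite (@le_lt_trans _ _ 1) ?ltr1n// invf_le1 ?ler1n ?ltr0n.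
  apply: filterS; first exact: (ae_filter_ringOfSetsType mu).
  move=> x xn; rewrite /halfline/= in_itv/= andbT => x0.
  have [k1 k1x] := ltr_add_invr x0; rewrite add0r in k1x.
  have k2x := archi_boundP (ltW x0); set k2 := Num.Def.archi_bound x in k2x.
  apply: (xn (maxn k1 k2)); rewrite fmorphV/= ratr_nat.
  rewrite (le_lt_trans _ k1x)/=; last first.
    by rewrite lef_pV2 ?posrE ?ltr0n// ler_nat ltnS leq_maxl.
  by rewrite (lt_le_trans k2x)// ler_nat ltnW// ltnW// ltnS ltnS leq_maxr.
move=> c0 cd; set a : R := ratr c.
(* The cutoff makes [f] integrable up to the boundary point [a]. *)
pose g := f \_ `[a, d].
have fad : mu.-integrable `[a, d] (EFin \o f) by exact: loc_int_itv.
have gi (y : R) : mu.-integrable `[a, y] (EFin \o g).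
  rewrite /g -restrict_EFin; apply/integrable_restrict => //.
  by apply: (@integrableS _ _ _ mu `[a, d]) => //; exact: measurableI.
have gl : locally_integrable [set: R] g by exact: integrable_locally.
pose F x := \int[mu]_(t in `[a, x]) g t.
have Fq (q : rat) : a < ratr q < d -> F (ratr q) = 0.
  move=> /andP[aq qd]; rewrite -(int0 c q c0 aq); apply: eq_Rintegral => x.
  rewrite inE/= in_itv/= => /andP[ax xq]; rewrite /g patchE mem_set//=.
  by rewrite in_itv/= ax (le_trans xq (ltW qd)).
have Fc : {in `]a, d[, continuous F}.
  have := parameterized_integral_continuous (ltW cd) (gi d).
  by move/(continuous_within_itvP _ cd) => [].
have F0 x : a < x < d -> F x = 0.
  move=> axd; apply/eqP/negPn/negP => Fx0.
  have : F y @[y --> x] --> F x by apply: Fc; rewrite in_itv.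
  move/cvgrPdist_lt => /(_ `|F x|); rewrite normr_gt0 => /(_ Fx0).
  move=> /nbhs_ballP[e /= e0 xe]; move/andP: axd => [ax xd].
  have /rat_in_itvoo[q] : x < Num.min (x + e) d by rewrite lt_min ltrDl e0.
  rewrite in_itv/= lt_min => /and3P[xq qe qd].
  have : ball x e (ratr q).
    by rewrite /ball/= ltr_distlC (lt_le_trans _ (ltW xq))// ltrBlDr ltrDl.
  move=> /xe /=; rewrite Fq ?subr0 ?ltxx//; first by rewrite (lt_trans ax xq).
have := @FTC1 R g (BLeft a) gi gl.
apply: filterS; first exact: (ae_filter_ringOfSetsType mu).
move=> x H /andP[ax xd].
case: H => [|_ F']; first by rewrite lte_fin.
have -> : f x = g x.
  by rewrite /g patchE mem_set//= in_itv/= !ltW.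
rewrite -F' -/F derive1E.
transitivity ('D_1 (cst 0 : R -> R) x); last exact: derive_cst.
apply: near_eq_derive; near=> z; rewrite F0//.
by apply/andP; split; near: z; [exact: lt_nbhsr|exact: lt_nbhsl].
Unshelve. all: by end_near. Qed.

End Fundamental.

(** * Integration by parts against test functions *)

Section Parts.
Context {R : realType}.
Implicit Types (f g h : R -> R) (a b c d : R).
Local Notation mu := (@lebesgue_measure R).
Local Notation RM := (measurableTypeR R).

Lemma continuous_loc_int f : (forall x, 0 < x -> {for x, continuous f}) ->
  locally_integrable halfline f.
Proof.
move=> cf; have oh : open (halfline : set R) by exact: interval_open.
have cf' : {in (halfline : set R), continuous f}.
  by move=> x; rewrite inE /halfline/= in_itv/= andbT; exact: cf.
split => //; first exact: open_continuous_measurable_fun.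
move=> K Kh cK.
have /integrableP[] // : mu.-integrable K (EFin \o f).
apply: continuous_compact_integrable => //.
by apply: continuous_in_subspaceT => x; rewrite inE => /Kh xh; apply: cf'; rewrite inE.
Qed.

Lemma loc_intB f g : locally_integrable halfline f ->
  locally_integrable halfline g ->
  locally_integrable halfline (fun x => f x - g x).
Proof.
by move=> fi gi; apply: locally_integrableD => //; exact: locally_integrableN.
Qed.

Section pairing_linear.
Variables (c d : R) (c0 : 0 < c).
Variables (f g u v : R -> R).
Hypotheses (fi : locally_integrable halfline f)
  (gi : locally_integrable halfline g).
Hypotheses (bu : test_on c d u) (bv : test_on c d v).

Let cu := smooth_continuous bu.1.
Let cv := smooth_continuous bv.1.

Lemma pairingDr : pairing f (fun x => u x + v x) = pairing f u + pairing f v.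
Proof.
rewrite /pairing -RintegralD; first by under eq_Rintegral do rewrite mulrDr.
- exact: measurable_halfline.
- exact: integrable_pairing bu.2.
- exact: integrable_pairing bv.2.
Qed.

Lemma pairingZr k : pairing f (fun x => k * u x) = k * pairing f u.
Proof.
rewrite /pairing -RintegralZl; first by under eq_Rintegral do rewrite mulrCA.
- exact: measurable_halfline.
- exact: integrable_pairing bu.2.
Qed.

Lemma pairingBl : pairing (fun x => f x - g x) u = pairing f u - pairing g u.
Proof.
rewrite /pairing -RintegralB; first by under eq_Rintegral do rewrite mulrBl.
- exact: measurable_halfline.
- exact: integrable_pairing bu.2.
- exact: integrable_pairing bu.2.
Qed.

Lemma pairingZl k : pairing (fun x => k * f x) u = k * pairing f u.
Proof.
rewrite /pairing -RintegralZl; first by under eq_Rintegral do rewrite -mulrA.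
- exact: measurable_halfline.
- exact: integrable_pairing bu.2.
Qed.

End pairing_linear.

Lemma pairing_itv c d f u (D : set R) : supp c d u ->
  [set` `[c, d]] `<=` D -> [set` `[c, d]] `<=` halfline ->
  pairing f u = \int[mu]_(x in D) (f x * u x).
Proof.
move=> su cdD cdh.
have s : supp c d (fun x => f x * u x).
  by move=> x; rewrite mulf_eq0 negb_or => /andP[_ /su].
by rewrite /pairing (Rintegral_supp s cdh) (Rintegral_supp s cdD).
Qed.

Lemma is_derive_continuous f (x df : R) : is_derive x 1 f df ->
  {for x, continuous f}.
Proof.
move=> h; apply: differentiable_continuous; apply/derivable1_diffP.
exact: ex_derive.
Qed.

(** Away from the ends of the support, so that no boundary term survives. *)
Lemma test_on_frame c d : 0 < c -> exists a b : R,
  [/\ 0 < a, a < c, d < b & a < b].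
Proof.
move=> c0; exists (c / 2), (Num.max c d + 1).
have h : c <= Num.max c d by rewrite le_max lexx.
have h' : d <= Num.max c d by rewrite le_max lexx orbT.
split; lra.
Qed.

Lemma pairing_by_parts F F1 c d u : 0 < c -> test_on c d u ->
  (forall x : R, 0 < x -> is_derive x 1 F (F1 x)) ->
  (forall x, 0 < x -> {for x, continuous F1}) ->
  pairing F (derive1 u) = - pairing F1 u.
Proof.
move=> c0 bu FF1 cF1; have [su Su] := bu.
have [a [b [a0 ac db ab]]] := test_on_frame d c0.
have cdab : [set` `[c, d]] `<=` [set` `[a, b]].
  by move=> x /=; rewrite !in_itv/= => /andP[cx xd]; rewrite !ltW ?(lt_le_trans ac cx) ?(le_lt_trans xd db).
have cdh := @itv_halfline R c d c0.
have du := test_on_derive1 bu.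
rewrite (pairing_itv F du.2 cdab cdh) (pairing_itv F1 Su cdab cdh).
have c1 (g : R -> R) : (forall x, 0 < x -> {for x, continuous g}) ->
    {within `[a, b], continuous g}.
  move=> cg; apply: continuous_in_subspaceT => x.
  by rewrite inE/= in_itv/= => /andP[ax _]; apply: cg; exact: lt_le_trans ax.
have cF x : 0 < x -> {for x, continuous F}.
  by move=> x0; apply: is_derive_continuous (FF1 _ x0).
rewrite (@Rintegration_by_parts R F u F1 (derive1 u))//.
- rewrite (supp0 Su (x := b)) ?db ?orbT// (supp0 Su (x := a)) ?ac//.
  by rewrite !mulr0 subrr sub0r.
- exact: c1.
- have [h1 h2 h3] := (continuous_within_itvP _ ab).1 (c1 _ cF); split => //.
  move=> x; rewrite in_itv/= => /andP[ax _].
  by apply: ex_derive; apply: FF1; exact: lt_trans ax.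
- move=> x; rewrite in_itv/= => /andP[ax _].
  have := FF1 _ (lt_trans a0 ax) => d1.
  by rewrite derive1E derive_val.
- by apply: c1 => x _; apply: smooth_continuous; exact: du.1.
- split.
  + by move=> x _; exact: smooth_derivable.
  + by apply: cvg_at_right_filter; exact: smooth_continuous.
  + by apply: cvg_at_left_filter; exact: smooth_continuous.
Qed.

Section triangle.
Variables (h v : R -> R).
Hypotheses (hi : mu.-integrable setT (EFin \o h))
  (vi : mu.-integrable setT (EFin \o v)).

Let mh : measurable_fun (setT : set RM) h.
Proof. by apply/measurable_EFinP; exact: measurable_int hi. Qed.

Let mv : measurable_fun (setT : set RM) v.
Proof. by apply/measurable_EFinP; exact: measurable_int vi. Qed.

Let mprod : measurable_fun (setT : set (RM * RM))
  (fun z => (v z.1 * h z.2)%:E).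
Proof.
apply/measurable_EFinP; apply: measurable_funM.
  exact: measurableT_comp measurable_fst.
exact: measurableT_comp measurable_snd.
Qed.

Lemma integrable_tensor :
  (mu \x mu)%E.-integrable setT (fun z : RM * RM => (v z.1 * h z.2)%:E).
Proof.
apply/integrable12ltyP => //=.
have e (x : RM) : (\int[mu]_y `|(v x * h y)%:E| =
    `|(v x)%:E| * \int[mu]_y `|(h y)%:E|)%E.
  rewrite -ge0_integralZl//.
    by apply: eq_integral => y _; rewrite EFinM abseM.
  by apply: measurableT_comp => //; exact/measurable_EFinP.
under eq_integral do rewrite e.
have /integrableP[_ hoo] := hi; have /integrableP[_ voo] := vi.
rewrite ge0_integralZr//.
- apply: lte_mul_pinfty => //; first exact: integral_ge0.
  by rewrite ge0_fin_numE//; exact: integral_ge0.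
- by apply: measurableT_comp => //; exact/measurable_EFinP.
- exact: integral_ge0.
Qed.

Let f (z : RM * RM) : \bar R := (if z.2 <= z.1 then v z.1 * h z.2 else 0)%:E.

Let fi : (mu \x mu)%E.-integrable setT f.
Proof.
apply: le_integrable integrable_tensor => //.
  apply/measurable_EFinP; apply: measurable_fun_ifT => //.
  - by apply: measurable_fun_ler; [exact: measurable_snd|exact: measurable_fst].
  - by apply/measurable_EFinP; exact: mprod.
move=> z _; rewrite /f lee_fin; case: ifP => // _.
by rewrite normr0.
Qed.

(** Both sides integrate [v x * h y] over the half-plane [y <= x]. For [v] a
    derivative this is integration by parts against an indefinite integral of
    [h], where [h] has no regularity. *)
Lemma triangle_fubini :
  \int[mu]_x (v x * \int[mu]_(y in `]-oo, x]) h y) =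
  \int[mu]_y (h y * \int[mu]_(x in `[y, +oo[) v x).
Proof.
congr fine.
have hiD (i : interval R) : mu.-integrable [set` i] (EFin \o h).
  by apply: (@integrableS _ _ _ mu setT).
have viD (i : interval R) : mu.-integrable [set` i] (EFin \o v).
  by apply: (@integrableS _ _ _ mu setT).
have e1 (x : R) : (\int[mu]_y f (x, y) =
    (v x * \int[mu]_(y in `]-oo, x]) h y)%:E)%E.
  rewrite EFinM [X in (_ * X)%E]fineK; last exact: integrable_fin_num (hiD _).
  rewrite -(@integralZl _ _ _ mu _ _ _ (hiD _))//.
  rewrite [RHS]integral_mkcond; apply: eq_integral => y _.
  rewrite /f/= patchE; case: ifPn => yx; first by rewrite mem_set//= in_itv.
  by rewrite memNset//= in_itv/=; exact/negP.
have e2 (y : R) : (\int[mu]_x f (x, y) =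
    (h y * \int[mu]_(x in `[y, +oo[) v x)%:E)%E.
  rewrite EFinM [X in (_ * X)%E]fineK; last exact: integrable_fin_num (viD _).
  rewrite -(@integralZl _ _ _ mu _ _ _ (viD _))//.
  rewrite [RHS]integral_mkcond; apply: eq_integral => x _.
  rewrite /f/= patchE; case: ifPn => yx.
    by rewrite mem_set//= ?in_itv/= ?yx// mulrC.
  by rewrite memNset//= in_itv/= andbT; exact/negP.
under eq_integral do rewrite -e1.
rewrite (Fubini fi).
by apply: eq_integral => y _; rewrite e2.
Qed.

End triangle.

End Parts.

(** * Regular representatives of functions with a weak second derivative *)

Section Representative.
Context {R : realType}.
Implicit Types (f g h : R -> R) (a b c d x y : R).
Local Notation mu := (@lebesgue_measure R).

Lemma Rintegral_itv_split h a x b : a <= x -> x <= b ->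
  mu.-integrable `[a, b] (EFin \o h) ->
  \int[mu]_(t in `[a, b]) h t - \int[mu]_(t in `[a, x]) h t =
  \int[mu]_(t in `[x, b]) h t.
Proof.
move=> ax xb hi; rewrite Rintegral_itvB//.
rewrite Rintegral_itv_obnd_cbnd//.
apply: (@integrableS _ _ _ mu `[a, b]) => // t /=.
by rewrite !in_itv/= => /andP[/ltW xt ->]; rewrite (le_trans ax).
Qed.

(** Signed integral from the base point 1. *)
Definition sint h x : R :=
  \int[mu]_(t in `[1, x]) h t - \int[mu]_(t in `[x, 1]) h t.

Lemma Rintegral_itv_degenerate h a b : b <= a ->
  \int[mu]_(t in `[a, b]) h t = 0.
Proof.
rewrite le_eqVlt => /predU1P[->|ba]; first by rewrite set_itv1 Rintegral_set1.
by rewrite set_itv_ge ?Rintegral_set0// bnd_simp -ltNge.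
Qed.

Lemma sint_base h a x : 0 < a -> a <= 1 -> a <= x ->
  locally_integrable halfline h ->
  sint h x = \int[mu]_(t in `[a, x]) h t - \int[mu]_(t in `[a, 1]) h t.
Proof.
move=> a0 a1 ax hi; rewrite /sint; have [x1|/ltW x1] := leP 1 x.
  rewrite (Rintegral_itv_degenerate h x1) subr0 Rintegral_itv_split//.
  exact: loc_int_itv.
rewrite (Rintegral_itv_degenerate h x1) sub0r -(@Rintegral_itv_split h a x 1)//.
  by rewrite opprB.
exact: loc_int_itv.
Qed.

Lemma sint_incr h x y : 0 < x -> x <= y -> locally_integrable halfline h ->
  sint h y - sint h x = \int[mu]_(t in `[x, y]) h t.
Proof.
move=> x0 xy hi; pose a := Num.min x 1.
have a0 : 0 < a by rewrite lt_min x0 ltr01.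
have a1 : a <= 1 by rewrite ge_min lexx orbT.
have ax : a <= x by rewrite ge_min lexx.
rewrite !(sint_base (a := a))// ?(le_trans ax)//.
rewrite -(@Rintegral_itv_split h a x y)//; last exact: loc_int_itv.
ring.
Qed.

Lemma sint_near h x : 0 < x -> locally_integrable halfline h ->
  \forall y \near x, sint h y =
    sint h (x / 2) + \int[mu]_(t in `[x / 2, y]) h t.
Proof.
move=> x0 hi; near=> y; rewrite -(@sint_incr h (x / 2) y)//.
- by rewrite addrC subrK.
- by rewrite divr_gt0.
- by apply: ltW; near: y; apply: lt_nbhsr; lra.
Unshelve. all: by end_near. Qed.

Lemma continuous_sint h x : 0 < x -> locally_integrable halfline h ->
  {for x, continuous (sint h)}.
Proof.
move=> x0 hi; have nx := sint_near x0 hi.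
have x2 : 0 < x / 2 by rewrite divr_gt0.
have xx : x / 2 < x + 1 by lra.
have i : mu.-integrable `[x / 2, x + 1] (EFin \o h) by exact: loc_int_itv.
have := parameterized_integral_continuous (ltW xx) i.
move=> /(continuous_within_itvP _ xx)[c _ _].
have cx : {for x, continuous (fun y => sint h (x / 2) +
    parameterized_integral mu (x / 2) y h)}.
  apply: cvgD; first exact: cvg_cst.
  by apply: c; rewrite in_itv/=; apply/andP; split; lra.
rewrite /prop_for /continuous_at (nbhs_singleton nx).
by apply: cvg_trans cx; apply: near_eq_cvg; apply: filterS nx => y ->.
Qed.

Lemma is_derive_sint h x : 0 < x -> locally_integrable halfline h ->
  {for x, continuous h} -> is_derive x 1 (sint h) (h x).
Proof.
move=> x0 hi ch; have nx := sint_near x0 hi.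
have x2 : 0 < x / 2 by rewrite divr_gt0.
have i : mu.-integrable `[x / 2, x + 1] (EFin \o h) by exact: loc_int_itv.
have x2x : x / 2 < x by rewrite ltr_pdivrMr// mulr_natr mulr2n ltrDl.
have xx1 : x < x + 1 by rewrite ltrDl.
have [dF F'] := continuous_FTC1_closed xx1 i x2x ch.
apply: (@near_eq_is_derive R R R (fun y => sint h (x / 2) +
    \int[mu]_(t in `[x / 2, y]) h t)).
  by apply: filterS nx => y ->.
rewrite -[h x]add0r; apply: is_deriveD.
by rewrite -F' derive1E; exact: derivableP.
Qed.

Lemma test_on_right_integral c d u y : test_on c d u ->
  \int[mu]_(x in `[y, +oo[) derive1 u x = - u y.
Proof.
move=> bu; have du := test_on_derive1 bu.
pose b := Num.max y d + 1.
have yb : y < b by rewrite ltr_pwDr// le_max lexx.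
have db : d < b by rewrite ltr_pwDr// le_max lexx orbT.
have -> : \int[mu]_(x in `[y, +oo[) derive1 u x =
    \int[mu]_(x in `[y, b]) derive1 u x.
  rewrite Rintegral_mkcond [RHS]Rintegral_mkcond; congr Rintegral.
  apply/funext => x; rewrite !patchE; have [xb|bx] := leP x b.
    congr (if _ then _ else _); apply/idP/idP; rewrite !inE/= !in_itv/= andbT.
      by move=> ->.
    by case/andP.
  rewrite (supp0 du.2); first by case: ifP; case: ifP.
  by rewrite (lt_trans db bx) orbT.
rewrite /Rintegral (@continuous_FTC2 R (derive1 u) u)//.
- by rewrite (supp0 bu.2 (x := b)) ?db ?orbT//= sub0r.
- by apply: continuous_subspaceT; exact: smooth_continuous du.1.
- split.
  + by move=> x _; exact: smooth_derivable bu.1.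
  + by apply: cvg_at_right_filter; apply: smooth_continuous; exact: bu.1.
  + by apply: cvg_at_left_filter; apply: smooth_continuous; exact: bu.1.
Qed.

Lemma pairing_cst_derive1 k c d u : 0 < c -> test_on c d u ->
  pairing (fun=> k) (derive1 u) = 0.
Proof.
move=> c0 bu; rewrite (@pairing_by_parts _ _ (fun=> 0) _ _ _ c0 bu).
- rewrite /pairing (@eq_Rintegral _ _ _ mu _ (cst 0)) ?Rintegral_cst ?mul0r ?oppr0//.
    exact: measurable_halfline.
  by move=> x _; rewrite mul0r.
- by move=> x _; exact: cvg_cst.
Qed.

(** Integration by parts against an antiderivative of a function that is merely
    integrable: exchange the order of integration. *)
Lemma pairing_sint h c d u : 0 < c -> test_on c d u ->
  locally_integrable halfline h ->
  pairing (sint h) (derive1 u) = - pairing h u.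
Proof.
move=> c0 bu hi; have du := test_on_derive1 bu.
have [a [b [a0 ac db ab]]] := test_on_frame d c0.
have Si : locally_integrable halfline (sint h).
  by apply: continuous_loc_int => x x0; exact: continuous_sint.
have ki : locally_integrable halfline (fun=> sint h a : R).
  by apply: continuous_loc_int => x x0; exact: cvg_cst.
have hab : mu.-integrable `[a, b] (EFin \o h) by exact: loc_int_itv.
pose hp := h \_ `[a, b].
have hpi : mu.-integrable setT (EFin \o hp).
  by rewrite /hp -restrict_EFin; apply/integrable_restrict => //; rewrite ?setTI.
have vi : mu.-integrable setT (EFin \o derive1 u).
  exact: integrable_supp (smooth_continuous du.1) du.2.
have := triangle_fubini hpi vi.
under [in X in _ = X]eq_Rintegral do rewrite (test_on_right_integral _ bu).
have -> : \int[mu]_x (hp x * - u x) = - pairing h u.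
  transitivity (\int[mu]_(x in [set: R]) (- 1 * (hp x * u x))).
    by apply: eq_Rintegral => x _; rewrite mulrN mulN1r.
  have e : (fun x => hp x * u x) = (fun x => h x * u x) \_ halfline.
    apply/funext => x; rewrite /hp !patchE.
    have [->|/bu.2/andP[cx xd]] := eqVneq (u x) 0; first by rewrite !mulr0; case: ifP.
    rewrite !mem_set//= ?in_itv/=; last 2 first.
    - by rewrite /halfline/= in_itv/= andbT (lt_le_trans c0).
    - by rewrite (le_trans (ltW ac) cx) (le_trans xd (ltW db)).
  rewrite RintegralZl//; first by rewrite mulN1r e /pairing [in RHS]Rintegral_mkcond.
  rewrite -/(EFin \o (fun x => hp x * u x)) e -restrict_EFin.
  apply/integrable_restrict => //; first exact: measurable_halfline.
  by rewrite ?setTI; exact: integrable_pairing (smooth_continuous bu.1) bu.2.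
move=> <-; have -> : pairing (sint h) (derive1 u) =
    pairing (fun x => sint h x - sint h a) (derive1 u).
  by rewrite (pairingBl c0 Si ki du) (pairing_cst_derive1 _ c0 bu) subr0.
rewrite (pairing_itv _ du.2 (@subsetT _ _) (itv_halfline c0)).
apply: eq_Rintegral => x _; rewrite mulrC.
have [->|/du.2/andP[cx xd]] := eqVneq (derive1 u x) 0; first by rewrite !mul0r.
congr (_ * _); rewrite sint_incr// ?(le_trans (ltW ac))//.
rewrite Rintegral_mkcond [RHS]Rintegral_mkcond; congr Rintegral.
apply/funext => y; rewrite /hp !patchE.
have im (i : interval R) : (y \in [set` i]) = (y \in i).
  by apply/idP/idP => [/set_mem|h']; [|exact/mem_set].
rewrite !im !in_itv/=; have [ay|ya] := leP a y => /=; last by case: ifP.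
have [yx|//] := leP y x.
by rewrite (le_trans yx)// (le_trans xd)// ltW.
Qed.

(** Any test function of integral 1 supported away from 0 would do. *)
Definition unit_bump x : R :=
  (\int[mu]_(t in [set: R]) plateau 0 1 2 t)^-1 * plateau 0 1 2 x.

Lemma test_on_unit_bump : test_on 1 2 unit_bump.
Proof. by apply: test_on_scale; exact: test_on_plateau. Qed.

Lemma unit_bump_integral : \int[mu]_(x in [set: R]) unit_bump x = 1.
Proof.
have i0 : 0 < \int[mu]_(t in [set: R]) plateau (0 : nat) (1 : R) 2 t.
  by apply: plateau_integral_gt0; rewrite ltr1n.
rewrite /unit_bump RintegralZl//; first by rewrite mulVf// gt_eqF.
have b := @test_on_plateau R 0 1 2.
exact: integrable_supp (smooth_continuous b.1) b.2.
Qed.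

(** Antiderivative of a test function corrected to have zero integral, so that
    it is again a test function. *)
Definition balanced_primitive f : R -> R := primitive
  (fun x => f x + (- \int[mu]_(t in [set: R]) f t) * unit_bump x).

Section balanced.
Variables (c d : R) (f : R -> R).
Hypotheses (c1 : c <= 1) (d2 : 2 <= d) (bf : test_on c d f).

Let be : test_on c d unit_bump.
Proof. exact: test_on_widen test_on_unit_bump. Qed.

Let bsum : test_on c d
  (fun x => f x + (- \int[mu]_(t in [set: R]) f t) * unit_bump x).
Proof. by apply: test_on_add => //; exact: test_on_scale. Qed.

Lemma test_on_balanced_primitive : test_on c d (balanced_primitive f).
Proof.
apply: primitive_test_on bsum _.
have fi := integrable_supp (smooth_continuous bf.1) bf.2.
have ei := integrable_supp (smooth_continuous be.1) be.2.
have kb := test_on_scale (- \int[mu]_(t in [set: R]) f t) be.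
have ki := integrable_supp (smooth_continuous kb.1) kb.2.
by rewrite RintegralD// RintegralZl// unit_bump_integral mulr1 subrr.
Qed.

Lemma derive1_balanced_primitive : derive1 (balanced_primitive f) =
  fun x => f x + (- \int[mu]_(t in [set: R]) f t) * unit_bump x.
Proof. exact: derive1_primitive bsum. Qed.

End balanced.

Definition second_primitive f : R -> R :=
  balanced_primitive (balanced_primitive f).

Lemma test_on_second_primitive c d f : c <= 1 -> 2 <= d -> test_on c d f ->
  test_on c d (second_primitive f).
Proof. by move=> c1 d2 bf; do 2 apply: test_on_balanced_primitive => //. Qed.

(** Every test function is a second derivative of a test function up to a
    combination of two fixed ones: second derivatives are exactly the test
    functions orthogonal to the affine functions. *)
Lemma second_primitive_decomposition c d f : c <= 1 -> 2 <= d -> test_on c d f ->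
  f = fun x => derive1n 2 (second_primitive f) x +
    (\int[mu]_(t in [set: R]) f t * unit_bump x +
     \int[mu]_(t in [set: R]) balanced_primitive f t * derive1 unit_bump x).
Proof.
move=> c1 d2 bf.
have b1 := test_on_balanced_primitive c1 d2 bf.
have -> : derive1n 2 (second_primitive f) = fun x => f x +
    (- \int[mu]_(t in [set: R]) f t) * unit_bump x +
    (- \int[mu]_(t in [set: R]) balanced_primitive f t) * derive1 unit_bump x.
  rewrite /= (derive1_balanced_primitive c1 d2 b1); apply: is_derive_derive1 => x.
  have d1 := smooth_is_derive x b1.1; have de := smooth_is_derive x test_on_unit_bump.1.
  rewrite (derive1_balanced_primitive c1 d2 bf) in d1.
  have := is_deriveD d1
    (is_deriveZ (- \int[mu]_(t in [set: R]) balanced_primitive f t) de).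
  by [].
apply/funext => x; ring.
Qed.

Lemma pairing_decomposition c d f g : 0 < c -> c <= 1 -> 2 <= d ->
  test_on c d f -> locally_integrable halfline g ->
  pairing g f = pairing g (derive1n 2 (second_primitive f)) +
    (\int[mu]_(t in [set: R]) f t * pairing g unit_bump +
     \int[mu]_(t in [set: R]) balanced_primitive f t *
       pairing g (derive1 unit_bump)).
Proof.
move=> c0 c1 d2 bf gi.
have be : test_on c d unit_bump by exact: test_on_widen test_on_unit_bump.
have bd := test_on_derive1 be.
have b2 := test_on_derive1 (test_on_derive1 (test_on_second_primitive c1 d2 bf)).
rewrite [in LHS](second_primitive_decomposition c1 d2 bf).
have s1 := test_on_scale (\int[mu]_(t in [set: R]) f t) be.
have s2 := test_on_scale (\int[mu]_(t in [set: R]) balanced_primitive f t) bd.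
rewrite (pairingDr c0 gi b2 (test_on_add s1 s2)) (pairingDr c0 gi s1 s2).
by rewrite (pairingZr c0 gi be) (pairingZr c0 gi bd).
Qed.

(** Subtract from [f] a twice iterated integral of [h]. What remains is
    orthogonal to the tested second derivatives, hence, by the decomposition
    above, to all plateaus after subtraction of a suitable affine function; by the
    fundamental lemma it is that affine function. *)
Lemma weak_D2_representative f h : locally_integrable halfline f ->
  locally_integrable halfline h ->
  (forall n (a b : rat), 0 < ratr a :> R -> (ratr a : R) < ratr b ->
    let psi := second_primitive (plateau n (ratr a) (ratr b)) in
    pairing f (derive1n 2 psi) = pairing h psi) ->
  exists F F1 : R -> R,
    [/\ forall x : R, 0 < x -> is_derive x 1 F (F1 x),
        f = F %[ae mu in halfline] &
        forall x y, 0 < x -> x <= y ->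
          F1 y - F1 x = \int[mu]_(t in `[x, y]) h t].
Proof.
move=> fi hi fh.
have cS x : 0 < x -> {for x, continuous (sint h)} by move=> x0; exact: continuous_sint.
have Si := continuous_loc_int cS.
pose W := sint (sint h).
have dW (x : R) : 0 < x -> is_derive x 1 W (sint h x).
  by move=> x0; apply: is_derive_sint => //; exact: cS.
have Wi : locally_integrable halfline W.
  by apply: continuous_loc_int => x x0; apply: is_derive_continuous (dW x x0).
have ii : locally_integrable halfline (id : R -> R).
  by apply: continuous_loc_int => x x0; exact: cvg_id.
have ki (k : R) : locally_integrable halfline (fun=> k).
  by apply: continuous_loc_int => x x0; exact: cvg_cst.
pose g x := f x - W x.
have gi : locally_integrable halfline g by exact: loc_intB.
pose A := pairing g unit_bump; pose B := pairing g (derive1 unit_bump).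
pose k := pairing id unit_bump.
have zero : (fun x => g x - ((A + k * B) - B * x)) = cst 0 %[ae mu in halfline].
  have ai : locally_integrable halfline (fun x => (A + k * B) - B * x).
    apply: loc_intB => //.
    apply: continuous_loc_int => x x0; apply: cvgM; first exact: cvg_cst.
    exact: cvg_id.
  have Bi : locally_integrable halfline (fun x => B * x).
    apply: continuous_loc_int => x x0; apply: cvgM; first exact: cvg_cst.
    exact: cvg_id.
  apply: plateau_orthogonal_eq0; first exact: loc_intB.
  move=> n qa qb a0 ab; set a : R := ratr qa; set b : R := ratr qb.
  pose c := Num.min a 1; pose d := Num.max b 2.
  have c0 : 0 < c by rewrite lt_min a0 ltr01.
  have c1 : c <= 1 by rewrite ge_min lexx orbT.
  have d2 : 2 <= d by rewrite le_max lexx orbT.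
  pose chi := plateau n a b.
  have bchi : test_on c d chi.
    apply: test_on_widen (test_on_plateau n a b); first by rewrite ge_min lexx.
    by rewrite le_max lexx.
  have be : test_on c d unit_bump by exact: test_on_widen test_on_unit_bump.
  have bpsi := test_on_second_primitive c1 d2 bchi.
  have bpsi1 := test_on_derive1 bpsi.
  set m := \int[mu]_(t in [set: R]) chi t.
  set m' := \int[mu]_(t in [set: R]) balanced_primitive chi t.
  have cdh := itv_halfline (d := d) c0.
  have one1 u : test_on c d u -> pairing (fun=> 1) u = \int[mu]_(t in [set: R]) u t.
    move=> bu; rewrite (pairing_itv _ bu.2 (@subsetT _ _) cdh).
    by apply: eq_Rintegral => x _; rewrite mul1r.
  have idd u : test_on c d u -> pairing id (derive1 u) = - \int[mu]_(t in [set: R]) u t.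
    move=> bu; rewrite (pairing_by_parts (F1 := fun=> 1) c0 bu)//.
    - by rewrite one1.
    - by move=> x _; exact: cvg_cst.
  have g2 : pairing g (derive1n 2 (second_primitive chi)) = 0.
    rewrite (pairingBl c0 fi Wi (test_on_derive1 bpsi1)) fh//.
    rewrite [X in _ - X](pairing_by_parts c0 bpsi1 dW cS).
    by rewrite opprK (pairing_sint c0 bpsi hi) subrr.
  have mE : m' = m * k - pairing id chi.
    rewrite (pairing_decomposition c0 c1 d2 bchi ii) -/m -/m' -/k.
    rewrite (idd _ be) unit_bump_integral.
    rewrite [pairing id (derive1n 2 _)](idd _ bpsi1).
    rewrite -(one1 _ bpsi1) (pairing_cst_derive1 1 c0 bpsi); ring.
  rewrite (pairingBl c0 gi ai bchi) (pairing_decomposition c0 c1 d2 bchi gi) g2.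
  rewrite -/A -/B -/m -/m' (pairingBl c0 (ki _) Bi bchi) (pairingZl c0 ii bchi).
  have -> : (fun=> A + k * B) = (fun x : R => (A + k * B) * (fun=> 1) x).
    by apply/funext => x; rewrite mulr1.
  rewrite (pairingZl c0 (ki 1) bchi) (one1 _ bchi) -/m mE; ring.
exists (fun x => W x + ((A + k * B) - B * x)), (fun x => sint h x + - B); split.
- move=> x x0; apply: is_deriveD; first exact: dW.
  rewrite -sub0r; apply: is_deriveB.
  rewrite -[X in is_derive _ _ _ X]mulr1.
  exact: (@is_deriveZ R R R id B x 1 1).
- apply: filterS zero; first exact: (ae_filter_ringOfSetsType mu).
  move=> x H xh; have /eqP := H xh; rewrite subr_eq0 /g => /eqP <-.
  by rewrite addrC subrK.
- by move=> x y x0 xy; rewrite -(sint_incr x0 xy hi); ring.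
Qed.

End Representative.

(** * Elementary one-dimensional estimates *)

Section Estimates.
Context {R : realType}.
Implicit Types (f g h : R -> R) (a b c x y : R).
Local Notation mu := (@lebesgue_measure R).

Lemma halflineE x : (halfline x : Prop) = (0 < x).
Proof. by rewrite /halfline/= in_itv/= andbT. Qed.

(** The mean value theorem for [s * f - g] with [s = 1] and [s = -1]. *)
Lemma derive_compare f f1 g g1 a b : a <= b ->
  (forall x : R, a <= x <= b -> is_derive x 1 f (f1 x)) ->
  (forall x : R, a <= x <= b -> is_derive x 1 g (g1 x)) ->
  (forall x, a <= x <= b -> `|f1 x| <= g1 x) ->
  `|f b - f a| <= g b - g a.
Proof.
move=> ab df dg fg.
have key (s : R) : `|s| <= 1 -> s * f b - g b <= s * f a - g a.
  move=> s1.
  have dh (x : R) : a <= x <= b ->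
      is_derive x 1 (fun x => s * f x - g x) (s * f1 x - g1 x).
    by move=> xab; apply: is_deriveB (dg _ xab); exact: is_deriveZ (df _ xab).
  have [c cab e] : exists2 c, c \in `[a, b] &
      (s * f b - g b) - (s * f a - g a) = (s * f1 c - g1 c) * (b - a).
    apply: (@MVT_segment R (fun x => s * f x - g x)
      (fun x => s * f1 x - g1 x)) => //.
      by move=> x; rewrite in_itv/= => /andP[ax xb]; apply: dh; rewrite !ltW.
    apply: continuous_in_subspaceT => x; rewrite inE/= in_itv/= => xab.
    exact: is_derive_continuous (dh _ xab).
  rewrite -subr_le0 e; rewrite in_itv/= in cab.
  rewrite mulr_le0_ge0// ?subr_ge0// subr_le0 (le_trans _ (fg _ cab))//.
  by rewrite (le_trans (ler_norm _))// normrM ler_piMl.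
rewrite ler_norml; have k1 := key 1; have k2 := key (-1).
move: k1 k2; rewrite normrN normr1 lexx => /(_ isT) + /(_ isT); lra.
Qed.

(** Young's inequality typically bounds an integrand by an explicit function, to
    be integrated exactly, plus a part [g] whose integral the energy controls. *)
Lemma abs_integral_bound h g (C c : R -> R) (G x y : R) : 0 < x -> x <= y ->
  locally_integrable halfline h ->
  (forall t : R, 0 < t -> is_derive t 1 C (c t)) ->
  (forall t, 0 < t -> {for t, continuous c}) ->
  measurable_fun halfline g -> (forall t, 0 < t -> 0 <= g t) ->
  (\int[mu]_(t in halfline) (g t)%:E <= G%:E)%E ->
  (forall t, x <= t <= y -> `|h t| <= c t + g t) ->
  `|\int[mu]_(t in `[x, y]) h t| <= C y - C x + G.
Proof.
move=> x0 xy hi dC cc mg g0 gG hcg.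
have G0 : 0 <= G.
  rewrite -lee_fin (le_trans _ gG)// integral_ge0// => t.
  by rewrite halflineE => t0; rewrite lee_fin g0.
move: xy; rewrite le_eqVlt => /predU1P[<-|xy].
  by rewrite set_itv1 Rintegral_set1 normr0 subrr add0r.
have hxy : mu.-integrable `[x, y] (EFin \o h) by exact: loc_int_itv.
have sub : [set` `[x, y]] `<=` (halfline : set R) by exact: itv_halfline.
have ghi : mu.-integrable halfline (EFin \o g).
  apply/integrableP; split; first exact/measurable_EFinP.
  have e : (\int[mu]_(t in halfline) `|(EFin \o g) t| =
      \int[mu]_(t in halfline) (g t)%:E)%E.
    apply: eq_integral => t; rewrite inE halflineE => t0.
    by rewrite gee0_abs// lee_fin g0.
  by rewrite e (le_lt_trans gG)// ltry.
have gxy : mu.-integrable `[x, y] (EFin \o g).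
  apply: (@integrableS _ _ _ mu halfline) => //; exact: measurable_halfline.
have cw : {within `[x, y], continuous c}.
  apply: continuous_in_subspaceT => t; rewrite inE/= in_itv/= => /andP[xt _].
  by apply: cc; exact: lt_le_trans xt.
have cxy : mu.-integrable `[x, y] (EFin \o c).
  by apply: continuous_compact_integrable => //; exact: segment_compact.
apply: (le_trans (le_normr_Rintegral _ hxy)) => //.
apply: (@le_trans _ _ (\int[mu]_(t in `[x, y]) (c t + g t))).
  apply: le_Rintegral => //.
  - exact: (integrable_norm hxy).
  - exact: (@integrableD _ _ _ mu _ (measurable_itv _) _ _ cxy gxy).
rewrite RintegralD// lerD//.
  rewrite /Rintegral (@continuous_FTC2 R c C)//.
  - have cC (t : R) : 0 < t -> {for t, continuous C}.
      by move=> t0; exact: is_derive_continuous (dC _ t0).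
    have : {within `[x, y], continuous C}.
      apply: continuous_in_subspaceT => t; rewrite inE/= in_itv/= => /andP[xt _].
      by apply: cC; exact: lt_le_trans xt.
    move=> /(continuous_within_itvP _ xy)[h1 h2 h3]; split => //.
    move=> t; rewrite in_itv/= => /andP[xt _].
    by apply: ex_derive; apply: dC; exact: lt_trans xt.
  - move=> t; rewrite in_itv/= => /andP[xt _].
    have := dC _ (lt_trans x0 xt) => d1; by rewrite derive1E derive_val.
rewrite -lee_fin /Rintegral fineK; last exact: integrable_fin_num gxy.
apply: le_trans gG; apply: ge0_subset_integral => //.
- exact: measurable_halfline.
- exact/measurable_EFinP.
- by move=> t; rewrite halflineE => t0; rewrite lee_fin g0.
Qed.

Lemma abs_integral_bound_cst h g (k G x y : R) : 0 < x -> x <= y ->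
  locally_integrable halfline h ->
  measurable_fun halfline g -> (forall t, 0 < t -> 0 <= g t) ->
  (\int[mu]_(t in halfline) (g t)%:E <= G%:E)%E ->
  (forall t, x <= t <= y -> `|h t| <= k + g t) ->
  `|\int[mu]_(t in `[x, y]) h t| <= k * (y - x) + G.
Proof.
move=> x0 xy hi mg g0 gG hk; rewrite mulrBr.
apply: (@abs_integral_bound h g (fun t => k * t) (fun=> k)) => //.
- move=> t _; rewrite -[X in is_derive _ _ _ X]mulr1.
  exact: (@is_deriveZ R R R id k t 1 1).
- by move=> t _; exact: cvg_cst.
Qed.

(** Chebyshev: a function with small integral is small somewhere on every
    interval, and there any almost sure property may be assumed as well. *)
Lemma exists_small_point h (P : R -> Prop) a b (M : R) : 0 <= a -> a < b ->
  measurable_fun halfline h -> (forall t, 0 < t -> 0 <= h t) ->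
  {ae mu, forall t, halfline t -> P t} ->
  (\int[mu]_(t in halfline) (h t)%:E < M%:E)%E ->
  exists t, [/\ a < t < b, P t & (b - a) * h t <= M].
Proof.
move=> a0 ab mh h0 aeP hM; apply: contrapT => H.
have sub : [set` `]a, b[] `<=` (halfline : set R).
  by move=> t /=; rewrite in_itv halflineE/= => /andP[at_ _]; exact: le_lt_trans at_.
have M0 : 0 <= M.
  rewrite -lee_fin (le_trans _ (ltW hM))// integral_ge0// => t.
  by rewrite halflineE => t0; rewrite lee_fin h0.
move: hM; apply/negP; rewrite -leNgt.
apply: (@le_trans _ _ (\int[mu]_(t in `]a, b[) (h t)%:E)%E); last first.
  apply: ge0_subset_integral => //.
  - exact: measurable_halfline.
  - exact/measurable_EFinP.
  - by move=> t; rewrite halflineE => t0; rewrite lee_fin h0.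
have -> : (M%:E = \int[mu]_(t in `]a, b[) (cst (M / (b - a))%:E) t)%E.
  have e := @lebesgue_measure_itv R `]a, b[.
  rewrite integral_cst// [X in (_ * X)%E]e/= lte_fin ab -EFinD -EFinM.
  by rewrite divfK// subr_eq0 gt_eqF.
apply: ae_ge0_le_integral => //.
- by move=> t _; rewrite lee_fin divr_ge0// subr_ge0 ltW.
- by move=> t /sub; rewrite halflineE => t0; rewrite lee_fin h0.
- apply/measurable_EFinP; apply: measurable_funS mh => //.
  exact: measurable_halfline.
apply: filterS aeP; first exact: (ae_filter_ringOfSetsType mu).
move=> t Pt tab; rewrite lee_fin leNgt; apply/negP => tM; apply: H; exists t.
split; first by move: tab; rewrite /= in_itv.
  exact: Pt (sub _ tab).
by rewrite mulrC -ler_pdivlMr ?subr_gt0// ltW.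
Qed.

(** The mean value theorem between [y1] and [y2] bounds the derivative at one
    point, hence everywhere up to its oscillation [M]. *)
Lemma two_point_bound f f1 a l (m M : R) y1 y2 : 0 < l ->
  (forall x : R, a <= x <= a + l -> is_derive x 1 f (f1 x)) ->
  (forall x y, a <= x -> x <= y -> y <= a + l -> `|f1 y - f1 x| <= M) ->
  a <= y1 -> y1 + l / 3 <= y2 -> y2 <= a + l ->
  `|f y1| <= m -> `|f y2| <= m ->
  forall x, a <= x <= a + l ->
    `|f1 x| <= 6 * m / l + M /\ `|f x| <= 7 * m + l * M.
Proof.
move=> l0 df osc ay1 y12 y2l fy1 fy2 x /andP[ax xl].
have y1y2 : y1 < y2 by lra.
have m0 : 0 <= m by rewrite (le_trans _ fy1).
have cont u v : a <= u -> v <= a + l -> {within `[u, v], continuous f}.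
  move=> au vl; apply: continuous_in_subspaceT => t; rewrite inE/= in_itv/= => /andP[ut tv].
  apply: is_derive_continuous (df t _).
  by rewrite (le_trans au ut) (le_trans tv vl).
have [c cy fc] : exists2 c, c \in `]y1, y2[ & f y2 - f y1 = f1 c * (y2 - y1).
  apply: MVT => //; last exact: cont.
  by move=> t; rewrite in_itv/= => /andP[ut tv]; apply: df; apply/andP; split; lra.
rewrite in_itv/= in cy; case/andP: cy => c1 c2.
have f1c : `|f1 c| <= 6 * m / l.
  rewrite ler_pdivlMr//.
  have : `|f1 c| * (y2 - y1) <= 2 * m.
    rewrite -[X in _ * X]ger0_norm ?subr_ge0 ?(ltW y1y2)// -normrM -fc.
    by rewrite (le_trans (ler_normB _ _))// mulr2n mulrDl !mul1r lerD.
  have n0 : 0 <= `|f1 c| by [].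
  by nra.
have f1b t : a <= t <= a + l -> `|f1 t| <= 6 * m / l + M.
  move=> /andP[at_ tl]; have [ct|tc] := leP c t.
    have := osc c t (le_trans ay1 (ltW c1)) ct tl.
    by have := ler_normD (f1 t - f1 c) (f1 c); rewrite subrK; lra.
  have := osc t c at_ (ltW tc) (le_trans (ltW c2) y2l).
  by have := ler_normB (f1 c) (f1 c - f1 t); rewrite opprB addrC subrK; lra.
split; first by apply: f1b; rewrite ax.
set K := 6 * m / l + M.
have comp u v : a <= u -> u <= v -> v <= a + l -> `|f v - f u| <= K * v - K * u.
  move=> au uv vl; apply: (@derive_compare f f1 (fun t => K * t) (fun=> K)) => //.
  - by move=> t /andP[ut tv]; apply: df; rewrite (le_trans au ut) (le_trans tv vl).
  - move=> t _; rewrite -[X in is_derive _ _ _ X]mulr1.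
    exact: (@is_deriveZ R R R id K t 1 1).
  - by move=> t /andP[ut tv]; apply: f1b; rewrite (le_trans au ut) (le_trans tv vl).
have K0 : 0 <= K by rewrite (le_trans _ (f1b x _))// ax.
have Kl : K * l = 6 * m + l * M.
  by rewrite /K mulrDl divfK ?gt_eqF// mulrC [M * l]mulrC; ring.
have fx : `|f x - f y1| <= K * l.
  have [y1x|xy1] := leP y1 x.
    by apply: (le_trans (comp y1 x ay1 y1x xl)); nra.
  rewrite distrC; apply: (le_trans (comp x y1 ax (ltW xy1) _)); first by lra.
  by nra.
have := ler_normD (f x - f y1) (f y1); rewrite subrK => h.
by rewrite Kl in fx; lra.
Qed.

End Estimates.

(** * Small energy bounds the solution by one half *)

Section SmallSup.
Context {R : realType}.
Implicit Types (f F : R -> R) (a s t x y : R).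
Local Notation mu := (@lebesgue_measure R).

Definition weight a F x : R := x `^ (a + 2) * `|F x| `^ (a + 1).

Lemma weight_ge0 a F x : 0 <= weight a F x.
Proof. by rewrite mulr_ge0// powR_ge0. Qed.

Lemma measurable_weight a F : measurable_fun halfline F ->
  measurable_fun halfline (weight a F).
Proof.
move=> mF; apply: measurable_funM; first exact: measurable_funTS (measurable_powR _).
apply: (measurableT_comp (measurable_powR _)).
exact: measurableT_comp.
Qed.

Lemma powRS a x : 0 < x -> x `^ (a + 1) = x * x `^ a.
Proof.
by move=> x0; rewrite addrC powRD ?powRr1 ?ltW// (gt_eqF x0) implybT.
Qed.

(** Splitting at the level [x = s] bounds a power by a constant plus the next
    power that occurs in the energy; likewise in the next lemma. *)
Lemma young1 a x s : 0 <= a -> 0 <= x -> 0 < s ->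
  x <= s + x `^ (a + 1) / s `^ a.
Proof.
move=> a0 x0 s0; have sa : 0 < s `^ a by rewrite powR_gt0.
have [xs|sx] := leP x s.
  by rewrite (le_trans xs)// lerDl divr_ge0// ?powR_ge0// ltW.
have x1 : 0 < x by exact: lt_trans sx.
apply: (@le_trans _ _ (x `^ (a + 1) / s `^ a)); last by rewrite lerDr ltW.
rewrite ler_pdivlMr// powRS// ler_wpM2l// ge0_ler_powR ?nnegrE//.
  exact: ltW.
exact: ltW.
Qed.

Lemma young2 a x s : 0 <= a -> 0 <= x -> 0 < s ->
  x `^ a <= s `^ a + x `^ (a + 1) / s.
Proof.
move=> a0 x0 s0.
have [xs|sx] := leP x s.
  apply: (@le_trans _ _ (s `^ a)).
    by rewrite ge0_ler_powR// ?nnegrE// ltW.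
  by rewrite lerDl divr_ge0// ?powR_ge0// ltW.
have x1 : 0 < x by exact: lt_trans sx.
apply: (@le_trans _ _ (x `^ (a + 1) / s)); last by rewrite lerDr powR_ge0.
by rewrite ler_pdivlMr// powRS// mulrC ler_wpM2r ?powR_ge0// ltW.
Qed.

(** The truncation level [s * t `^ (- 7/4)] may be integrated twice up to 0,
    because the exponent is below 2, while [- 7/4 * a + a + 2 <= 1/2] for
    [2 <= a] keeps the weighted remainder no more singular than [t `^ (- 1/2)]. *)
Lemma young_singular a s t x : 2 < a -> 0 <= x -> 0 < s -> 0 < t <= 1 ->
  x <= s * t `^ (- (7 / 4)) +
       (s `^ a)^-1 * t `^ (- (1 / 2)) * (t `^ (a + 2) * x `^ (a + 1)).
Proof.
move=> a2 x0 s0 /andP[t0 t1]; have a0 : 0 <= a by lra.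
have p0 : 0 < t `^ (- (7 / 4)) by rewrite powR_gt0.
have sa : 0 < s `^ a by rewrite powR_gt0.
set k := s * _; have k0 : 0 < k by rewrite mulr_gt0.
have r0 : 0 <= (s `^ a)^-1 * t `^ (- (1 / 2)) * (t `^ (a + 2) * x `^ (a + 1)).
  by rewrite !mulr_ge0// ?powR_ge0// invr_ge0 ltW.
have [xk|kx] := leP x k; first by rewrite (le_trans xk)// lerDl.
have x1 : 0 < x by exact: lt_trans kx.
apply: (@le_trans _ _ ((s `^ a)^-1 * t `^ (- (1 / 2)) *
    (t `^ (a + 2) * x `^ (a + 1)))); last by rewrite lerDr ltW.
have kax : k `^ a <= x `^ a by rewrite ge0_ler_powR// ?nnegrE// ltW.
rewrite powRS// -[leLHS]mulr1.
have -> : (s `^ a)^-1 * t `^ (- (1 / 2)) * (t `^ (a + 2) * (x * x `^ a)) =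
   x * ((s `^ a)^-1 * (t `^ (- (1 / 2)) * t `^ (a + 2)) * x `^ a) by ring.
rewrite ler_wpM2l//.
apply: (@le_trans _ _ ((s `^ a)^-1 * (t `^ (- (1 / 2)) * t `^ (a + 2)) * k `^ a)); last first.
  by rewrite ler_wpM2l// !mulr_ge0// ?powR_ge0// invr_ge0 ltW.
have tn : t != 0 by rewrite gt_eqF.
rewrite /k powRM ?(ltW s0) ?(ltW p0)// -powRrM.
have -> : (s `^ a)^-1 * (t `^ (- (1 / 2)) * t `^ (a + 2)) *
    (s `^ a * t `^ (- (7 / 4) * a)) =
   (s `^ a)^-1 * s `^ a * (t `^ (- (1 / 2)) * t `^ (a + 2) * t `^ (- (7 / 4) * a)).
  by ring.
rewrite mulVf ?gt_eqF// mul1r -!powRD ?tn ?implybT//.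
apply: (@le_trans _ _ (t `^ 0)); first by rewrite powRr0.
by rewrite ?mul1r; apply: ger_powR; [rewrite t0|lra].
Qed.

Lemma is_derive_powR (p x : R) : 0 < x -> p != 0 ->
  is_derive x 1 (fun t => p^-1 * t `^ p) (x `^ (p - 1)).
Proof.
move=> x0 p0; rewrite -[X in is_derive _ _ _ X](mulKf p0).
exact: (@is_deriveZ R R R (fun t => t `^ p) p^-1 x 1 _ (is_derive1_powR p x0)).
Qed.

Lemma continuous_powR (p x : R) : 0 < x -> {for x, continuous (fun t => t `^ p)}.
Proof. by move=> x0; exact: is_derive_continuous (is_derive1_powR p x0). Qed.

(** Beyond 1 the function is small at two separated points of a unit interval,
    by Chebyshev, and its derivative oscillates little, by Young. Below 1 one
    integrates twice from 1 with the singular Young inequality. *)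
Lemma energy_small_sup a : 2 < a -> exists2 e : R, 0 < e &
  forall f F U U1,
    (forall x : R, 0 < x -> is_derive x 1 U (U1 x)) ->
    (forall x y, 0 < x -> x <= y ->
       U1 y - U1 x = \int[mu]_(t in `[x, y]) F t) ->
    f = U %[ae mu in halfline] ->
    locally_integrable halfline F -> measurable_fun halfline f ->
    (\int[mu]_(x in halfline) (f x ^+ 2 + weight a F x)%:E < e%:E)%E ->
    forall x, 0 < x -> `|U x| <= 2^-1.
Proof.
move=> a2; have a0 : 0 <= a by lra.
(* The final bound is [29 * s], which has to stay below one half. *)
pose s : R := 60^-1; have s0 : 0 < s by rewrite invr_gt0.
have sa : 0 < s `^ a by rewrite powR_gt0.
(* Young costs [e / s `^ a], and Chebyshev on intervals of length 1/3 costs [3 * e]. *)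
pose e := Num.min (s `^ (a + 1)) (s ^+ 2 / 3).
have e0 : 0 < e by rewrite lt_min powR_gt0//= divr_gt0// exprn_gt0.
have e1 : e <= s * s `^ a by rewrite -powRS// ge_min lexx.
have e2 : 3 * e <= s ^+ 2.
  have : e <= s ^+ 2 / 3 by rewrite ge_min lexx orbT.
  by rewrite ler_pdivlMr// mulrC.
exists e => // f F U U1 dU incU fU Fi mf ee.
have [mF _ _] := Fi; have mw := measurable_weight a mF.
have f2 x : 0 < x -> 0 <= f x ^+ 2 + weight a F x.
  by move=> _; rewrite addr_ge0// ?sqr_ge0// weight_ge0.
have me : measurable_fun halfline (fun x => f x ^+ 2 + weight a F x).
  by apply: measurable_funD => //; exact: measurable_funX.
have wle : (\int[mu]_(x in halfline) (weight a F x)%:E <= e%:E)%E.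
  apply: le_trans (ltW ee); apply: ge0_le_integral => //.
  - exact: measurable_halfline.
  - by move=> x _; rewrite lee_fin weight_ge0.
  - exact/measurable_EFinP.
  - exact/measurable_EFinP.
  - by move=> x _; rewrite lee_fin lerDr sqr_ge0.
have es : e / s `^ a <= s by rewrite ler_pdivrMr.
have far x : 1 <= x -> `|U1 x| <= 8 * s /\ `|U x| <= 9 * s.
  move=> x1; have x0 : 0 < x by exact: lt_le_trans x1.
  have small (b c : R) : x <= b -> c = b + 3^-1 ->
      exists2 y, b < y < c & `|U y| <= s.
    move=> xb cb; have bc : b < c by rewrite cb ltrDl.
    have [|y [bcy fy ye]] := exists_small_point _ bc me f2 fU ee.
      by rewrite (le_trans _ xb)// ltW.
    exists y => //; rewrite -fy; rewrite cb addrAC subrr add0r in ye.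
    have : f y ^+ 2 <= s ^+ 2.
      have := weight_ge0 a F y; move: ye e2; lra.
    by rewrite -[f y ^+ 2]real_normK ?num_real// ler_sqr ?nnegrE// ltW.
  have [y1 /andP[y1a y1b] Uy1] := small x (x + 3^-1) (lexx _) erefl.
  have [y2 /andP[y2a y2b] Uy2] :
      exists2 y, x + 2 / 3 < y < x + 1 & `|U y| <= s.
    by apply: small; lra.
  have osc u v : x <= u -> u <= v -> v <= x + 1 -> `|U1 v - U1 u| <= 2 * s.
    move=> xu uv vx; have u0 : 0 < u by exact: lt_le_trans xu.
    rewrite incU//; have -> : 2 * s = s + s by ring.
    apply: (@le_trans _ _ (s * (v - u) + e / s `^ a)); last first.
      by rewrite lerD// -[leRHS]mulr1 ler_wpM2l ?(ltW s0)//; lra.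
    apply: (@abs_integral_bound_cst _ F (fun t => weight a F t / s `^ a)) => //.
    - by apply: measurable_funM => //; exact: measurable_cst.
    - by move=> t _; rewrite divr_ge0 ?weight_ge0// ltW.
    - under eq_integral do rewrite EFinM.
      rewrite ge0_integralZr//; first last.
      + by rewrite lee_fin invr_ge0 ltW.
      + by move=> t _; rewrite lee_fin weight_ge0.
      + exact/measurable_EFinP.
      + exact: measurable_halfline.
      + by rewrite EFinM lee_wpmul2r// lee_fin invr_ge0 ltW.
    - move=> t /andP[ut tv]; have t1 : 1 <= t by lra.
      apply: (le_trans (young1 a0 (normr_ge0 (F t)) s0)).
      rewrite lerD2l ler_wpM2r ?invr_ge0 ?(ltW sa)//.
      rewrite /weight -[leLHS]mul1r ler_wpM2r ?powR_ge0//.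
      apply: (@le_trans _ _ (t `^ 0)); first by rewrite powRr0.
      by apply: ler_powR => //; lra.
  have dU' (t : R) : x <= t <= x + 1 -> is_derive t 1 U (U1 t).
    by move=> /andP[xt _]; apply: dU; exact: lt_le_trans xt.
  have xx : x <= x <= x + 1 by rewrite lexx lerDl ler01.
  have [] := two_point_bound (y1 := y1) (y2 := y2) ltr01 dU' osc _ _ _ Uy1 Uy2 xx.
  - exact: ltW.
  - lra.
  - exact: ltW.
  by rewrite divr1 mul1r; split; lra.
move=> x x0; have s60 : s * 60 = 1 by rewrite mulVf.
have [x1|/ltW x1] := leP 1 x; first by have [_] := far x x1; lra.
have [U11 U01] := far 1 (lexx _).
pose p1 : R := - (3 / 4); pose p2 : R := 1 / 4.
have p1n : p1 != 0 by rewrite /p1 oppr_eq0; lra.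
have p2n : p2 != 0 by rewrite /p2; lra.
have near0 y : 0 < y -> y <= 1 -> `|U1 y| <= 8 * s + 3 * s * y `^ (p2 - 1).
  move=> y0 y1.
  have := @abs_integral_bound _ F
    (fun t => (s `^ a)^-1 * y `^ (- (1 / 2)) * weight a F t)
    (fun t => s * (p1^-1 * t `^ p1)) (fun t => s * t `^ (p1 - 1))
    ((s `^ a)^-1 * y `^ (- (1 / 2)) * e) y 1 y0 y1 Fi.
  have k0 : 0 <= (s `^ a)^-1 * y `^ (- (1 / 2)).
    by rewrite mulr_ge0 ?powR_ge0// invr_ge0 ltW.
  rewrite -(incU y 1 y0 y1) => H.
  have {}H : `|U1 1 - U1 y| <= s * (p1^-1 * 1 `^ p1) - s * (p1^-1 * y `^ p1) +
      (s `^ a)^-1 * y `^ (- (1 / 2)) * e.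
    apply: H.
    - by move=> t t0; apply: (@is_deriveZ R R R _ s t 1 _); exact: is_derive_powR.
    - move=> t t0; apply: cvgM; first exact: cvg_cst.
      exact: continuous_powR.
    - by apply: measurable_funM => //; exact: measurable_cst.
    - by move=> t t0; rewrite mulr_ge0// weight_ge0.
    - under eq_integral do rewrite EFinM.
      rewrite ge0_integralZl//; first last.
      + by move=> t _; rewrite lee_fin weight_ge0.
      + exact/measurable_EFinP.
      + exact: measurable_halfline.
      + by rewrite [leRHS]EFinM lee_wpmul2l// lee_fin.
    - move=> t /andP[yt t1]; have t0 : 0 < t by exact: lt_le_trans yt.
      have t01 : 0 < t <= 1 by rewrite t0.
      apply: (le_trans (young_singular a2 (normr_ge0 (F t)) s0 t01)).
      have -> : p1 - 1 = - (7 / 4) by rewrite /p1; lra.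
      rewrite lerD2l ler_wpM2r ?weight_ge0// ler_wpM2l ?invr_ge0 ?(ltW sa)//.
      rewrite !powRN lef_pV2 ?posrE ?powR_gt0//.
      by rewrite ge0_ler_powR ?nnegrE// ?(ltW y0) ?(ltW t0)//; lra.
  have yp : y `^ (- (1 / 2)) <= y `^ p1.
    by apply: ger_powR; rewrite ?y0// /p1; lra.
  have -> : p2 - 1 = p1 by rewrite /p1 /p2; lra.
  have P0 : 0 <= y `^ p1 by exact: powR_ge0.
  have last_le : (s `^ a)^-1 * y `^ (- (1 / 2)) * e <= s * y `^ p1.
    rewrite mulrAC ler_pM ?mulr_ge0 ?powR_ge0 ?invr_ge0 ?(ltW sa) ?(ltW e0)//.
    by rewrite mulrC.
  have pV : p1^-1 = - (4 / 3) by rewrite /p1 invrN invf_div.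
  rewrite pV powR1 mulr1 in H.
  have := ler_normB (U1 1) (U1 1 - U1 y); rewrite opprB addrC subrK => tri.
  have sp : 0 <= s * y `^ p1 by rewrite mulr_ge0// ltW.
  have s1 := ltW s0.
  nra.
have : `|U 1 - U x| <= (8 * s * 1 + 3 * s * (p2^-1 * 1 `^ p2)) -
    (8 * s * x + 3 * s * (p2^-1 * x `^ p2)).
  apply: (@derive_compare _ U U1 (fun y => 8 * s * y + 3 * s * (p2^-1 * y `^ p2))
    (fun y => 8 * s + 3 * s * y `^ (p2 - 1))).
  - exact: x1.
  - by move=> y /andP[xy _]; apply: dU; exact: lt_le_trans xy.
  - move=> y /andP[xy _]; have y0 : 0 < y by exact: lt_le_trans xy.
    apply: is_deriveD; last first.
      by apply: (@is_deriveZ R R R _ (3 * s) y 1 _); exact: is_derive_powR.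
    rewrite -[X in is_derive _ _ _ X]mulr1.
    exact: (@is_deriveZ R R R id (8 * s) y 1 1).
  - by move=> y /andP[xy y1]; apply: near0 => //; exact: lt_le_trans xy.
rewrite powR1 mulr1 => H.
have := ler_normB (U 1) (U 1 - U x); rewrite opprB addrC subrK => tri.
have pV : p2^-1 = 4 by rewrite /p2 div1r invrK.
have P0 : 0 <= x `^ p2 by exact: powR_ge0.
rewrite pV in H.
have sx : 0 <= s * x by rewrite mulr_ge0// ltW.
have sp : 0 <= s * x `^ p2 by rewrite mulr_ge0// ltW.
lra.
Qed.

End SmallSup.

(** * The flux divided by x *)

Section FluxEstimates.
Context {R : realType}.
Implicit Types (s t x y r q : R).
Local Notation mu := (@lebesgue_measure R).

Lemma norm_gfun a (v : R) : 0 < a -> `|gfun a v| = `|v| `^ a.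
Proof.
move=> a0; rewrite /gfun normrM (ger0_norm (powR_ge0 _ _)) mulrC.
by rewrite mulr_powRB1.
Qed.

Lemma powR_le a x y : 0 <= a -> 0 <= x -> x <= y -> x `^ a <= y `^ a.
Proof.
by move=> a0 x0 xy; rewrite ge0_ler_powR ?nnegrE// (le_trans x0).
Qed.

Variables (a : R) (a2 : 2 < a) (F H W W1 : R -> R).
Hypothesis dW : forall x : R, 0 < x -> is_derive x 1 W (W1 x).
Hypothesis incW : forall x y, 0 < x -> x <= y ->
  W1 y - W1 x = \int[mu]_(t in `[x, y]) H t.
Hypothesis Hi : locally_integrable halfline H.
Hypothesis mF : measurable_fun halfline F.
Hypothesis WF : {ae mu, forall t, halfline t -> W t = t `^ (a + 2) * gfun a (F t)}.

Variables (s b : R) (s0 : 0 < s) (s1 : s <= 1) (b0 : 0 < b).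
Hypothesis Fs : (\int[mu]_(x in halfline) (weight a F x)%:E < (s ^+ 2)%:E)%E.
Hypothesis Hb : (\int[mu]_(x in halfline) (H x ^+ 2)%:E <= (b ^+ 2)%:E)%E.

Let a0 : 0 <= a. Proof. by apply: ltW; exact: lt_trans a2. Qed.
Let a0' : 0 < a. Proof. exact: lt_trans a2. Qed.

(** Cauchy-Schwarz, in the form [|H| <= 1 / (4 * k) + k * H ^+ 2] with the [k]
    that is optimal for an interval of length [q ^+ 2]. *)
Lemma flux_osc x y q : 0 < x -> x <= y -> 0 < q -> y - x <= q ^+ 2 ->
  `|W1 y - W1 x| <= b * q.
Proof.
move=> x0 xy q0 yxq; rewrite incW//.
have [mH _ _] := Hi.
pose k := q / (2 * b); have k0 : 0 <= k by rewrite divr_ge0 ?mulr_ge0 ?ltW.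
have bn : b != 0 by rewrite gt_eqF.
have qn : q != 0 by rewrite gt_eqF.
have mH2 : measurable_fun halfline (fun t => H t ^+ 2) by exact: measurable_funX.
apply: (@le_trans _ _ (b / q / 2 * (y - x) + k * b ^+ 2)).
  apply: (@abs_integral_bound_cst _ H (fun t => k * H t ^+ 2)) => //.
  - by apply: measurable_funM => //; exact: measurable_cst.
  - by move=> t _; rewrite mulr_ge0// sqr_ge0.
  - under eq_integral do rewrite EFinM.
    rewrite ge0_integralZl//; first last.
    + by move=> t _; rewrite lee_fin sqr_ge0.
    + exact/measurable_EFinP.
    + exact: measurable_halfline.
    + by rewrite [leRHS]EFinM lee_wpmul2l// lee_fin.
  - move=> t _; rewrite -[H t ^+ 2]real_normK ?num_real//.
    have := sqr_ge0 (q * `|H t| - b); set h := `|H t| => sq.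
    have -> : b / q / 2 + k * h ^+ 2 = (b ^+ 2 + (q * h) ^+ 2) / (2 * b * q).
      by rewrite /k; field; rewrite bn qn.
    rewrite ler_pdivlMr ?mulr_gt0//; nra.
apply: (@le_trans _ _ (b / q / 2 * q ^+ 2 + k * b ^+ 2)).
  by rewrite lerD2r ler_wpM2l// !divr_ge0 ?ltW.
rewrite le_eqVlt; apply/orP; left; apply/eqP; rewrite /k; field.
by rewrite bn qn.
Qed.

(** The flux carries the power [a] of [F] and the energy the power [a + 1]:
    truncating [|F|] at a level [r] compares them, and Chebyshev picks the point. *)
Lemma flux_small_point x y r : 0 <= x -> x < y -> 0 < r ->
  exists2 t, x < t < y &
    `|W t| <= t `^ (a + 2) * r `^ a + s ^+ 2 / ((y - x) * r).
Proof.
move=> x0 xy r0.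
have w0 t : 0 < t -> 0 <= weight a F t by move=> _; exact: weight_ge0.
have [t [xty Wt wt]] := exists_small_point x0 xy (measurable_weight a mF) w0 WF Fs.
exists t => //; rewrite Wt normrM (ger0_norm (powR_ge0 _ _)) norm_gfun//.
have yx : 0 < y - x by rewrite subr_gt0.
apply: (@le_trans _ _ (t `^ (a + 2) * (r `^ a + `|F t| `^ (a + 1) / r))).
  by rewrite ler_wpM2l ?powR_ge0//; exact: young2.
rewrite mulrDr lerD2l mulrA -/(weight a F t) invfM mulrA ler_wpM2r ?invr_ge0 ?(ltW r0)//.
by rewrite ler_pdivlMr// mulrC.
Qed.

Definition flux_const : R := 7 * (4 * 2 `^ a + 3) + 1.

(** At [x = r ^+ 20], take an interval of length [x `^ p] with [p = 3/5] and the
    truncation level [s * x `^ (- q)] with [q = 31/20]. The conditions [p < 2/3],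
    [q < 1 + p] and [1 + 1 / a < q] make the oscillation of [W1] and the two terms
    of the previous lemma [o (x)] after integration; powers of [r] keep the
    exponents integral, and the gain is one factor [1 / r]. *)
Lemma flux_far r : 1 <= r ->
  `|W1 (r ^+ 20)| <= flux_const * (s + b) * r ^+ 7 /\
  `|W (r ^+ 20)| <= flux_const * (s + b) * r ^+ 19.
Proof.
move=> r1; have r0 : 0 < r by exact: lt_le_trans r1.
have rn : r != 0 by rewrite gt_eqF.
pose x := r ^+ 20; pose l := r ^+ 12.
have x0 : 0 < x by rewrite exprn_gt0.
have l0 : 0 < l by rewrite exprn_gt0.
have lx : l <= x by rewrite /l /x ler_weXn2l.
pose k := s / r ^+ 31; have k0 : 0 < k by rewrite divr_gt0 ?exprn_gt0.
pose m := (4 * 2 `^ a + 3) * s * r ^+ 19.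
have small u v : x <= u -> v <= x + l -> v - u = l / 3 ->
    exists2 t, u < t < v & `|W t| <= m.
  move=> xu vl uv; have uv' : u < v by rewrite -subr_gt0 uv divr_gt0.
  have u0 : 0 <= u by rewrite (le_trans _ xu)// ltW.
  have [t /andP[ut tv] Wt] := flux_small_point u0 uv' k0.
  exists t; first by rewrite ut.
  apply: (le_trans Wt); have -> : m = 4 * 2 `^ a * s * r ^+ 19 + 3 * s * r ^+ 19.
    by rewrite /m; ring.
  have t0 : 0 < t by exact: le_lt_trans ut.
  have t2x : t <= 2 * x by lra.
  apply: lerD; last first.
    rewrite uv /k /l le_eqVlt; apply/orP; left; apply/eqP; field.
    by rewrite rn gt_eqF.
  rewrite [a + 2]addrC powRD; last by rewrite (gt_eqF t0) implybT.
  rewrite powR_mulrn ?(ltW t0)// -mulrA -powRM ?(ltW t0) ?(ltW k0)//.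
  have tk : t * k <= 2 * (s / r ^+ 11).
    apply: (@le_trans _ _ (2 * x * k)); first by rewrite ler_wpM2r// ltW.
    by rewrite /x /k le_eqVlt; apply/orP; left; apply/eqP; field.
  have sr0 : 0 < s / r ^+ 11 by rewrite divr_gt0 ?exprn_gt0.
  have sr1 : s / r ^+ 11 <= 1.
    by rewrite ler_pdivrMr ?exprn_gt0// mul1r (le_trans s1)// exprn_ege1.
  have P2 : 0 <= 2 `^ a :> R by exact: powR_ge0.
  have tka : (t * k) `^ a <= 2 `^ a * (s ^+ 2 / r ^+ 22).
    apply: (@le_trans _ _ ((2 * (s / r ^+ 11)) `^ a)).
      by apply: powR_le => //; rewrite mulr_ge0 ?(ltW t0) ?(ltW k0).
    rewrite powRM ?(ltW sr0)// ler_wpM2l//.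
    apply: (@le_trans _ _ ((s / r ^+ 11) `^ 2%:R)).
      by apply: ger_powR; [rewrite sr0|exact: ltW].
    rewrite powR_mulrn ?(ltW sr0)// le_eqVlt; apply/orP; left; apply/eqP; field.
    exact: rn.
  apply: (@le_trans _ _ ((2 * x) ^+ 2 * (2 `^ a * (s ^+ 2 / r ^+ 22)))).
    apply: ler_pM => //; [exact: sqr_ge0|exact: powR_ge0|].
    by rewrite !expr2 ler_pM// ltW.
  have -> : (2 * x) ^+ 2 * (2 `^ a * (s ^+ 2 / r ^+ 22)) =
      4 * 2 `^ a * s * r ^+ 18 * s by rewrite /x; field.
  have c0 : 0 <= 4 * 2 `^ a * s by rewrite !mulr_ge0// ltW.
  rewrite -mulrA ler_wpM2l// (@le_trans _ _ (r ^+ 18))//.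
    by rewrite ler_piMr// exprn_ge0 ?ltW.
  by rewrite ler_weXn2l.
have [y1 /andP[y1a y1b] Wy1] : exists2 t, x < t < x + l / 3 & `|W t| <= m.
  by apply: small; lra.
have [y2 /andP[y2a y2b] Wy2] : exists2 t, x + 2 * l / 3 < t < x + l & `|W t| <= m.
  by apply: small; lra.
have osc u v : x <= u -> u <= v -> v <= x + l -> `|W1 v - W1 u| <= b * r ^+ 6.
  move=> xu uv vl; apply: flux_osc => //.
  - exact: lt_le_trans xu.
  - by rewrite exprn_gt0.
  - by rewrite -exprM -/l; lra.
have dW' (t : R) : x <= t <= x + l -> is_derive t 1 W (W1 t).
  by move=> /andP[xt _]; apply: dW; exact: lt_le_trans xt.
have xx : x <= x <= x + l by rewrite lexx lerDl ltW.
have [] := two_point_bound (y1 := y1) (y2 := y2) l0 dW' osc _ _ _ Wy1 Wy2 xx.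
- exact: ltW.
- lra.
- exact: ltW.
have P2 : 0 <= 2 `^ a :> R by exact: powR_ge0.
pose c : R := 4 * 2 `^ a + 3; have c1 : 0 <= c by rewrite /c; lra.
move=> h1 h2.
have K1 : flux_const = 7 * c + 1 by [].
have mE : m = c * s * r ^+ 19 by [].
rewrite K1; have ps := exprn_gt0 7 r0.
have r67 : r ^+ 6 <= r ^+ 7 by rewrite ler_weXn2l.
have r189 : r ^+ 18 <= r ^+ 19 by rewrite ler_weXn2l.
have sb : 0 <= s + b by rewrite addr_ge0// ltW.
split.
  apply: (le_trans h1).
  have -> : 6 * m / l = 6 * (c * s) * r ^+ 7 by rewrite mE /l; field.
  have : b * r ^+ 6 <= b * r ^+ 7 by rewrite ler_wpM2l// ltW.
  have e0 : 0 <= r ^+ 7 by exact: ltW.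
  have e1 : 0 <= c * s * r ^+ 7 by rewrite !mulr_ge0// ltW.
  have e2 : 0 <= c * b * r ^+ 7 by rewrite !mulr_ge0// ltW.
  have e3 : 0 <= s * r ^+ 7 by rewrite !mulr_ge0// ltW.
  have -> : (7 * c + 1) * (s + b) * r ^+ 7 = 7 * (c * s * r ^+ 7) +
    7 * (c * b * r ^+ 7) + s * r ^+ 7 + b * r ^+ 7 by ring.
  have -> : 6 * (c * s) * r ^+ 7 = 6 * (c * s * r ^+ 7) by ring.
  lra.
apply: (le_trans h2).
have -> : 7 * m = 7 * (c * s * r ^+ 19) by rewrite mE; ring.
have -> : l * (b * r ^+ 6) = b * r ^+ 18 by rewrite /l; ring.
have : b * r ^+ 18 <= b * r ^+ 19 by rewrite ler_wpM2l// ltW.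
have e0 : 0 <= r ^+ 19 by rewrite exprn_ge0 ?ltW.
have e2 : 0 <= c * b * r ^+ 19 by rewrite !mulr_ge0// ltW.
have e3 : 0 <= s * r ^+ 19 by rewrite !mulr_ge0// ltW.
have -> : (7 * c + 1) * (s + b) * r ^+ 19 = 7 * (c * s * r ^+ 19) +
  7 * (c * b * r ^+ 19) + s * r ^+ 19 + b * r ^+ 19 by ring.
lra.
Qed.

Lemma flux_const_ge1 : 1 <= flux_const.
Proof. by rewrite /flux_const lerDr mulr_ge0// addr_ge0// mulr_ge0// powR_ge0. Qed.

(** No boundary condition is imposed on the flux. Were it bounded away from 0
    near 0, then [weight a F] would dominate a multiple of [x `^ (- (1 + 2 / a))] there,
    which is not integrable. *)
Lemma flux_vanishing_points x e : 0 < x -> 0 < e ->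
  exists2 y, 0 < y < x & `|W y| <= e.
Proof.
move=> x0 e0; pose k := e / 4; have k0 : 0 < k by rewrite divr_gt0.
have ka : 0 < k `^ a by rewrite powR_gt0.
pose d := Num.min (Num.min x 1) (e / 2 * k `^ a).
have d0 : 0 < d by rewrite !lt_min x0 ltr01/= mulr_gt0// divr_gt0.
have dx : d <= x by rewrite !ge_min lexx.
have d1 : d <= 1 by rewrite !ge_min lexx orbT.
have dk : d <= e / 2 * k `^ a by rewrite ge_min lexx orbT.
have dn : d != 0 by rewrite gt_eqF.
have kn : k != 0 by rewrite gt_eqF.
have dk0 : 0 < (d * k)^-1 by rewrite invr_gt0 mulr_gt0.
have [||t /andP[t1 t2] Wt] := @flux_small_point (d / 2) d (d * k)^-1 _ _ dk0.
- by rewrite divr_ge0// ltW.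
- by lra.
have t0 : 0 < t by rewrite (lt_trans _ t1)// divr_gt0.
exists t; first by rewrite t0/= (lt_le_trans t2).
apply: (le_trans Wt).
have -> : s ^+ 2 / ((d - d / 2) * (d * k)^-1) = 2 * s ^+ 2 * k.
  by field; rewrite kn dn.
have first_term : t `^ (a + 2) * (d * k)^-1 `^ a <= e / 2.
  rewrite [a + 2]addrC powRD; last by rewrite (gt_eqF t0) implybT.
  rewrite powR_mulrn ?(ltW t0)// -mulrA -powRM ?(ltW t0) ?(ltW dk0)//.
  apply: (@le_trans _ _ (d ^+ 2 * (k^-1) `^ a)).
    apply: ler_pM => //; [exact: sqr_ge0|exact: powR_ge0| |].
      by rewrite !expr2 ler_pM// ltW.
    apply: powR_le => //; first by rewrite mulr_ge0 ?(ltW t0) ?(ltW dk0).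
    by rewrite invfM mulrA ler_piMl ?invr_ge0 ?(ltW k0)// ler_pdivrMr// mul1r ltW.
  have -> : (k^-1) `^ a = (k `^ a)^-1.
    by rewrite -[k^-1]powR_inv1 ?ltW// -powRrM mulN1r powRN.
  by rewrite ler_pdivrMr// (le_trans _ dk)// expr2 ler_piMr// ltW.
have s21 : s ^+ 2 <= 1 by rewrite expr_le1// ltW.
have : 2 * s ^+ 2 * k <= e / 2.
  have : s ^+ 2 * k <= 1 * k by rewrite ler_wpM2r// ltW.
  rewrite /k; lra.
lra.
Qed.

Let K := flux_const + 1.

(** [W1] is bounded on the unit interval, and [W] is its integral from points
    near 0 where [W] is arbitrarily small. *)
Lemma flux_near x : 0 < x -> x <= 1 ->
  `|W1 x| <= K * (s + b) /\ `|W x| <= K * (s + b) * x.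
Proof.
move=> x0 x1.
have W1b y : 0 < y -> y <= 1 -> `|W1 y| <= K * (s + b).
  move=> y0 y1; have [W11 _] := flux_far (lexx 1).
  rewrite !expr1n mulr1 in W11.
  have := @flux_osc y 1 1 y0 y1 ltr01; rewrite expr1n => /(_ _).
  have h : 1 - y <= 1 by rewrite gerBl ltW.
  move=> /(_ h); rewrite mulr1 => osc.
  have := ler_normB (W1 1) (W1 1 - W1 y); rewrite opprB addrC subrK => tri.
  have := ltW s0; rewrite /K mulrDl mul1r; lra.
split; first exact: W1b.
set M := K * (s + b).
apply/ler_addgt0Pr => e e0.
have [y /andP[y0 yx] Wy] := flux_vanishing_points x0 e0.
have : `|W x - W y| <= M * x - M * y.
  apply: (@derive_compare _ W W1 (fun t => M * t) (fun=> M)).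
  - exact: ltW.
  - by move=> t /andP[yt _]; apply: dW; exact: lt_le_trans yt.
  - move=> t _; rewrite -[X in is_derive _ _ _ X]mulr1.
    exact: (@is_deriveZ R R R id M t 1 1).
  - move=> t /andP[yt tx]; apply: W1b; first exact: lt_le_trans yt.
    exact: le_trans x1.
have M0 : 0 <= M by rewrite (le_trans _ (W1b _ x0 x1)).
have My : 0 <= M * y by rewrite mulr_ge0// ltW.
have := ler_normD (W x - W y) (W y); rewrite subrK; lra.
Qed.

Lemma flux_quotient_bound x : 0 < x -> `|W x / x| <= K * (s + b).
Proof.
move=> x0; rewrite normrM normfV (gtr0_norm x0) ler_pdivrMr//.
have [x1|/ltW x1] := leP x 1; first by have [] := flux_near x0 x1.
pose r := x `^ (20%:R^-1); have rx : r ^+ 20 = x.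
  by rewrite -powR_mulrn ?powR_ge0// -powRrM mulVf// powRr1// ltW.
have r1 : 1 <= r.
  apply: (@le_trans _ _ (x `^ 0)); first by rewrite powRr0.
  by apply: ler_powR => //; rewrite invr_ge0.
have [_] := flux_far r1; rewrite rx => h; apply: (le_trans h).
have k0 : 0 <= s + b by rewrite addr_ge0// ltW.
have F0 := flux_const_ge1.
apply: ler_pM.
- by rewrite mulr_ge0//; lra.
- by rewrite exprn_ge0// (le_trans _ r1).
- by rewrite ler_wpM2r// lerDl.
- by rewrite -[leRHS]rx ler_weXn2l.
Qed.

Lemma flux_quotient_decay x : 1 <= x ->
  `|W x / x| <= K * (s + b) * x `^ (- (20%:R^-1)).
Proof.
move=> x1; have x0 : 0 < x by exact: lt_le_trans x1.
rewrite normrM normfV (gtr0_norm x0) ler_pdivrMr// powRN.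
set r := x `^ (20%:R^-1); have rx : r ^+ 20 = x.
  by rewrite -powR_mulrn ?powR_ge0// -powRrM mulVf// powRr1// ltW.
have r0 : 0 < r by rewrite powR_gt0.
have r1 : 1 <= r.
  apply: (@le_trans _ _ (x `^ 0)); first by rewrite powRr0.
  by apply: ler_powR => //; rewrite invr_ge0.
have [_] := flux_far r1; rewrite rx => h; apply: (le_trans h).
have k0 : 0 <= s + b by rewrite addr_ge0// ltW.
have -> : K * (s + b) / r * x = K * (s + b) * r ^+ 19.
  by rewrite -{1}rx; field; rewrite gt_eqF.
by rewrite ler_wpM2r ?exprn_ge0 ?(ltW r0)// ler_wpM2r// lerDl.
Qed.

(** [W1] is Hoelder continuous of exponent 1/2, so it has a limit at 0; the
    quotient has the same one since [W] vanishes along a sequence. *)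
Lemma flux_quotient_limit : exists L : R, forall x, 0 < x -> x <= 1 ->
  `|W x / x - L| <= 2 * b * Num.sqrt x.
Proof.
have osc x y : 0 < y -> y <= x -> `|W1 x - W1 y| <= b * Num.sqrt x.
  move=> y0 yx; have x0 : 0 < x by exact: lt_le_trans yx.
  apply: flux_osc => //; first by rewrite sqrtr_gt0.
  by rewrite sqr_sqrtr ?gerBl ltW.
pose E := [set W1 x - b * Num.sqrt x | x in [set x | 0 < x <= 1]].
have ubE y : 0 < y -> y <= 1 -> ubound E (W1 y + b * Num.sqrt y).
  move=> y0 y1 _ [x /andP[x0 x1] <-].
  have sx : 0 <= b * Num.sqrt x by rewrite mulr_ge0 ?sqrtr_ge0// ltW.
  have sy : 0 <= b * Num.sqrt y by rewrite mulr_ge0 ?sqrtr_ge0// ltW.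
  have [xy|/ltW yx] := leP x y.
    by have := osc y x x0 xy; rewrite ler_norml => /andP[+ _]; lra.
  by have := osc x y y0 yx; rewrite ler_norml => /andP[_ +]; lra.
have E0 : E !=set0 by exists (W1 1 - b * Num.sqrt 1), 1; rewrite //= ltr01 lexx.
exists (sup E) => x x0 x1.
have W1L : `|W1 x - sup E| <= b * Num.sqrt x.
  rewrite ler_norml; apply/andP; split.
    have : sup E <= W1 x + b * Num.sqrt x by apply: ge_sup => //; exact: ubE.
    lra.
  have : W1 x - b * Num.sqrt x <= sup E.
    apply: ub_le_sup; last by exists x => //=; rewrite x0.
    by exists (W1 1 + b * Num.sqrt 1); exact: ubE.
  lra.
suff WW : `|W x / x - W1 x| <= b * Num.sqrt x.
  have := ler_normD (W x / x - W1 x) (W1 x - sup E); rewrite addrA subrK; lra.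
have -> : W x / x - W1 x = (W x - W1 x * x) / x by field; rewrite gt_eqF.
rewrite normrM normfV (gtr0_norm x0) ler_pdivrMr//.
apply/ler_addgt0Pr => e e0.
pose M := `|W1 x| + 1; have M0 : 0 < M by rewrite ltr_wpDl.
have e2 : 0 < e / 2 by rewrite divr_gt0.
have m0 : 0 < Num.min x (e / 2 / M) by rewrite lt_min x0 !divr_gt0.
have [y /andP[y0]] := flux_vanishing_points m0 e2.
rewrite lt_min => /andP[yx ye] Wy.
have : `|(W x - W1 x * x) - (W y - W1 x * y)| <=
    b * Num.sqrt x * x - b * Num.sqrt x * y.
  apply: (@derive_compare _ (fun t => W t - W1 x * t) (fun t => W1 t - W1 x)
    (fun t => b * Num.sqrt x * t) (fun=> b * Num.sqrt x)).
  - exact: ltW.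
  - move=> t /andP[yt _]; apply: is_deriveB.
      by apply: dW; exact: lt_le_trans yt.
    rewrite -[X in is_derive _ _ _ X]mulr1.
    exact: (@is_deriveZ R R R id (W1 x) t 1 1).
  - move=> t _; rewrite -[X in is_derive _ _ _ X]mulr1.
    exact: (@is_deriveZ R R R id (b * Num.sqrt x) t 1 1).
  - move=> t /andP[yt tx]; rewrite distrC; apply: osc => //.
    exact: lt_le_trans yt.
have sx : 0 <= b * Num.sqrt x * y by rewrite !mulr_ge0 ?sqrtr_ge0 ?ltW.
have W1y : `|W1 x * y| <= e / 2.
  rewrite normrM (gtr0_norm y0); apply: (@le_trans _ _ (M * y)).
    by rewrite ler_wpM2r ?(ltW y0)// lerDl.
  by rewrite mulrC -ler_pdivlMr// ltW.
have t1 := ler_normD ((W x - W1 x * x) - (W y - W1 x * y)) (W y - W1 x * y).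
have t2 := ler_normB (W y) (W1 x * y).
rewrite subrK in t1; lra.
Qed.

End FluxEstimates.

(** * The velocity at a fixed time *)

Section FixedTime.
Context {R : realType}.
Implicit Types (f g h F H : R -> R) (a s t x y l : R).
Local Notation mu := (@lebesgue_measure R).

Definition extend0 f l x : R := if 0 < x then f x else l.

Lemma continuous_extend0 f l : (forall x, 0 < x -> {for x, continuous f}) ->
  f x @[x --> 0^'+] --> l -> continuous (extend0 f l).
Proof.
move=> cf fl x; have [x0|x0|->] := ltrgtP x 0.
- rewrite /continuous_at {2}/extend0 ltNge (ltW x0)/=.
  apply: cvg_near_cst; apply: filterS (lt_nbhsl x0) => y y0.
  by rewrite /extend0 ltNge ltW.
- rewrite /continuous_at {2}/extend0 x0.
  apply: cvg_trans (cf x x0); apply: near_eq_cvg; apply: filterS (lt_nbhsr x0) => y y0.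
  by rewrite /extend0 y0.
- rewrite /continuous_at {2}/extend0 ltxx; apply/cvgrPdist_lt => e e0.
  move/cvgrPdist_lt : fl => /(_ e e0) [d /= d0 hd].
  apply/nbhs_ballP; exists d => //= y yd; rewrite /extend0.
  by case: ifPn => y0; [exact: hd|rewrite subrr normr0].
Qed.

Lemma continuous_ae_eq f g : (forall x, 0 < x -> {for x, continuous f}) ->
  (forall x, 0 < x -> {for x, continuous g}) ->
  f = g %[ae mu in halfline] -> forall x, 0 < x -> f x = g x.
Proof.
move=> cf cg fg x x0; apply/eqP; rewrite -subr_eq0; apply/negPn/negP => d0.
have : f y - g y @[y --> x] --> f x - g x.
  by apply: cvgB; [exact: cf|exact: cg].
move/cvgrPdist_lt => /(_ `|f x - g x|); rewrite normr_gt0 => /(_ d0).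
move=> /nbhs_ballP[d /= dpos xd].
have xxd : x < x + d by rewrite ltrDl.
have m0 : measurable_fun halfline (cst 0 : R -> R) by exact: measurable_cst.
have i0 : (\int[mu]_(t in halfline) (cst (0 : R) t)%:E < 1%:E)%E.
  by rewrite integral0_eq ?lte_fin.
have [//|t [/andP[xt tx] ft _]] := exists_small_point (ltW x0) xxd m0 _ fg i0.
have /xd /= : ball x d t by rewrite /ball/= ltr_distlC; apply/andP; split; lra.
by rewrite ft subrr subr0 ltxx.
Qed.

(** The weak second derivative on the countable family of test functions that
    determines a regular representative. *)
Definition weak_D2_tested f h : Prop :=
  forall n (a b : rat), 0 < ratr a :> R -> (ratr a : R) < ratr b ->
    let psi := second_primitive (plateau n (ratr a) (ratr b)) in
    pairing f (derive1n 2 psi) = pairing h psi.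

Lemma power_decay (C e : R) : 0 <= C -> 0 < e ->
  exists M : R, forall x, M <= x -> C * x `^ (- (20%:R^-1)) <= e.
Proof.
move=> C0 e0; exists (Num.max 1 ((C / e) ^+ 20)) => x.
rewrite ge_max => /andP[x1 xC]; have x0 : 0 < x by exact: lt_le_trans x1.
have c0 : 0 <= C / e by rewrite divr_ge0// ltW.
rewrite powRN ler_pdivrMr ?powR_gt0// mulrC -ler_pdivrMr//.
have -> : C / e = ((C / e) ^+ 20) `^ (20%:R^-1).
  by rewrite -powR_mulrn// -powRrM mulfV// powRr1.
by apply: powR_le => //; rewrite exprn_ge0.
Qed.

(** The conclusion for one time slice, where [f], [F] and [H] stand for [u],
    its second derivative and the second derivative of the flux, and [D] for the
    dissipation at that time. *)
Definition fixed_time_bound a e K : Prop := forall f F H (D : R),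
    locally_integrable halfline f -> locally_integrable halfline F ->
    locally_integrable halfline H ->
    locally_integrable halfline (fun x => x `^ (a + 2) * gfun a (F x)) ->
    zero_trace f -> weak_D2_tested f F ->
    weak_D2_tested (fun x => x `^ (a + 2) * gfun a (F x)) H ->
    (\int[mu]_(x in halfline) (f x ^+ 2 + weight a F x)%:E < e%:E)%E ->
    (\int[mu]_(x in halfline) (weight a F x + H x ^+ 2)%:E <= D%:E)%E ->
  exists v : R -> R,
    [/\ continuous v,
        forall e', 0 < e' -> exists M : R, forall x, M <= x -> `|v x| <= e',
        forall x, v x ^+ 2 <= K * D &
        (fun x => 2^-1 * x `^ (a + 1) * (1 + f x) `^ (a / 2) * gfun a (F x)) = v
          %[ae mu in halfline]].

(** In terms of the representatives [U] and [W] of [f] and of the flux, the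
    velocity is the bounded factor [(1 + U) `^ (a / 2) / 2] times [W / x], which is
    continuous up to 0, decays at infinity and is at most a constant times
    [s + b], with [s ^+ 2] and [b ^+ 2] of the size of [D]. *)
Lemma velocity_fixed_time a : 2 < a ->
  exists e K : R, [/\ 0 < e, 0 <= K & fixed_time_bound a e K].
Proof.
move=> a2; have a0 : 0 < a by lra.
have [e0 e0p small] := @energy_small_sup R a a2.
pose K0 := flux_const a + 1; pose N : R := (3 / 2) `^ (a / 2).
exists (Num.min e0 1), ((N * K0) ^+ 2).
split; [by rewrite lt_min e0p ltr01|exact: sqr_ge0|].
move=> f F H D fi Fi Hi wi [h [fh ch h0]] fF wH en di.
have [U [U1 [dU fU incU]]] := weak_D2_representative fi Fi fF.
have [W [W1 [dW wW incW]]] := weak_D2_representative wi Hi wH.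
have [mf _ _] := fi; have [mF _ _] := Fi; have [mH _ _] := Hi.
have mw := measurable_weight a mF.
have mH2 : measurable_fun halfline (fun t => H t ^+ 2) by exact: measurable_funX.
have mf2 : measurable_fun halfline (fun t => f t ^+ 2) by exact: measurable_funX.
have Uhalf : forall x, 0 < x -> `|U x| <= 2^-1.
  apply: (small f F U U1) => //.
  by rewrite (lt_le_trans en)// lee_fin ge_min lexx.
have D0 : 0 <= D.
  rewrite -lee_fin (le_trans _ di)// integral_ge0// => x _.
  by rewrite lee_fin addr_ge0 ?weight_ge0 ?sqr_ge0.
have wD : (\int[mu]_(x in halfline) (weight a F x)%:E <= D%:E)%E.
  apply: le_trans di; apply: ge0_le_integral => //.
  - exact: measurable_halfline.
  - by move=> x _; rewrite lee_fin weight_ge0.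
  - exact/measurable_EFinP.
  - by apply/measurable_EFinP; exact: measurable_funD.
  - by move=> x _; rewrite lee_fin lerDl sqr_ge0.
have HD : (\int[mu]_(x in halfline) (H x ^+ 2)%:E <= D%:E)%E.
  apply: le_trans di; apply: ge0_le_integral => //.
  - exact: measurable_halfline.
  - by move=> x _; rewrite lee_fin sqr_ge0.
  - exact/measurable_EFinP.
  - by apply/measurable_EFinP; exact: measurable_funD.
  - by move=> x _; rewrite lee_fin lerDr weight_ge0.
have w1 : (\int[mu]_(x in halfline) (weight a F x)%:E < 1)%E.
  apply: (@le_lt_trans _ _ (\int[mu]_(x in halfline) (f x ^+ 2 + weight a F x)%:E)%E).
    apply: ge0_le_integral => //.
    - exact: measurable_halfline.
    - by move=> x _; rewrite lee_fin weight_ge0.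
    - exact/measurable_EFinP.
    - by apply/measurable_EFinP; exact: measurable_funD.
    - by move=> x _; rewrite lee_fin lerDr sqr_ge0.
  by rewrite (lt_le_trans en)// lee_fin ge_min lexx orbT.
have WF : {ae mu, forall t, halfline t -> W t = t `^ (a + 2) * gfun a (F t)}.
  apply: filterS wW; first exact: (ae_filter_ringOfSetsType mu).
  by move=> x Wx /Wx.
(* The energy being below 1, [s] may be taken at most 1; the slack [d] makes the
   bounds strict and [b] positive. *)
have sb (d : R) : 0 < d -> exists s b : R,
    [/\ 0 < s, s <= 1, 0 < b &
     [/\ (\int[mu]_(x in halfline) (weight a F x)%:E < (s ^+ 2)%:E)%E,
         (\int[mu]_(x in halfline) (H x ^+ 2)%:E <= (b ^+ 2)%:E)%E &
         s + b <= 2 * Num.sqrt (D + d)]].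
  move=> d0; have Dd : 0 < D + d by rewrite ltr_wpDl.
  exists (Num.sqrt (Num.min 1 (D + d))), (Num.sqrt (D + d)).
  have m0 : 0 < Num.min 1 (D + d) by rewrite lt_min ltr01.
  split; [by rewrite sqrtr_gt0| |by rewrite sqrtr_gt0|split].
  - by rewrite -[leRHS]sqrtr1 ler_wsqrtr// ge_min lexx.
  - rewrite sqr_sqrtr ?(ltW m0)// EFin_min lt_min w1/=.
    by rewrite (le_lt_trans wD)// lte_fin ltrDl.
  - rewrite sqr_sqrtr ?(ltW Dd)// (le_trans HD)// lee_fin lerDl ltW//.
  - by rewrite mulr2n mulrDl mul1r lerD2r ler_wsqrtr// ge_min lexx orbT.
have K0p : 0 <= K0 by rewrite /K0 addr_ge0// (le_trans _ (flux_const_ge1 a)).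
pose Q x := W x / x.
have [s [b [s0 s1 b0 [ws Hb _]]]] := sb 1 ltr01.
have [L QL] := flux_quotient_limit a2 dW incW Hi mF WF s0 s1 b0 ws Hb.
have cU x : 0 < x -> {for x, continuous U}.
  by move=> x0; exact: is_derive_continuous (dU _ x0).
have cW x : 0 < x -> {for x, continuous W}.
  by move=> x0; exact: is_derive_continuous (dW _ x0).
have chx x : 0 < x -> {for x, continuous h}.
  by move=> x0; apply: ch; rewrite in_itv/= andbT.
have Uh : forall x, 0 < x -> U x = h x.
  apply: continuous_ae_eq => //.
  apply: filterS2 fU fh; first exact: (ae_filter_ringOfSetsType mu).
  by move=> x fU fh hx; rewrite -fU// fh.
(* The zero trace gives the factor [1 + U] the limit 1 at 0. *)
have U0 : U x @[x --> 0^'+] --> (0 : R).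
  apply: cvg_trans h0; apply: near_eq_cvg; near=> x.
  by rewrite Uh//; near: x; exact: nbhs_right_gt.
have Q0 : Q x @[x --> 0^'+] --> L.
  apply/cvgrPdist_lt => e ep.
  pose d := Num.min 1 ((e / (2 * b + 1)) ^+ 2).
  have b1 : 0 < 2 * b + 1 by lra.
  have d0 : 0 < d by rewrite lt_min ltr01 exprn_gt0// divr_gt0.
  exists d => //= x xd x0.
  have : x < d by move: xd; rewrite /ball_/= sub0r normrN gtr0_norm.
  rewrite lt_min => /andP[x1 xe].
  rewrite distrC (le_lt_trans (QL x x0 (ltW x1)))//.
  have : Num.sqrt x < e / (2 * b + 1).
    rewrite -[ltRHS]ger0_norm ?divr_ge0 ?(ltW ep) ?(ltW b1)// -sqrtr_sqr.
    by rewrite ltr_sqrt// exprn_gt0// divr_gt0.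
  rewrite ltr_pdivlMr//; have := sqrtr_ge0 x; lra.
pose G x := (1 + U x) `^ (a / 2).
have U1p x : 0 < x -> 0 < 1 + U x.
  by move=> /Uhalf; rewrite ler_norml => /andP[]; lra.
have cG x : 0 < x -> {for x, continuous G}.
  move=> x0; apply: (@continuous_comp _ _ _ (fun x => 1 + U x) (fun z => z `^ (a / 2))).
    by apply: cvgD; [exact: cvg_cst|exact: cU].
  by apply: continuous_powR; exact: U1p.
have G0 : G x @[x --> 0^'+] --> (1 : R).
  have e1 : 1 + U x @[x --> 0^'+] --> (1 : R).
    by rewrite -[X in _ --> X]addr0; apply: cvgD => //; exact: cvg_cst.
  have : (1 + U x) `^ (a / 2) @[x --> 0^'+] --> (1 : R) `^ (a / 2).
    apply: (@continuous_cvg _ _ _ _ _ (fun x => 1 + U x) (fun z => z `^ (a / 2))) => //.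
    exact: continuous_powR.
  by rewrite powR1.
have GN x : 0 < x -> `|G x| <= N.
  move=> x0; rewrite ger0_norm ?powR_ge0//; apply: powR_le.
  - by rewrite divr_ge0// ltW.
  - exact: ltW (U1p _ x0).
  - by have := Uhalf _ x0; rewrite ler_norml => /andP[_]; lra.
have N0 : 0 <= N by exact: powR_ge0.
pose q x := 2^-1 * G x * Q x.
have cq x : 0 < x -> {for x, continuous q}.
  move=> x0; apply: cvgM; first by apply: cvgM; [exact: cvg_cst|exact: cG].
  apply: cvgM; first exact: cW.
  by apply: cvgV; [rewrite gt_eqF|exact: cvg_id].
have q0 : q x @[x --> 0^'+] --> 2^-1 * 1 * L.
  by apply: cvgM => //; apply: cvgM => //; exact: cvg_cst.
have vc := continuous_extend0 cq q0.
have qle x y : 0 < x -> `|Q x| <= y -> `|q x| <= 2^-1 * N * y.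
  move=> x0 Qy; rewrite /q -!mulrA normrM (ger0_norm (_ : 0 <= 2^-1 :> R)) ?invr_ge0//.
  rewrite ler_wpM2l ?invr_ge0// normrM; apply: ler_pM => //; exact: GN.
have qbound x : 0 < x -> q x ^+ 2 <= (N * K0) ^+ 2 * D.
  move=> x0; apply/ler_addgt0Pr => d d0.
  pose d' := d / ((N * K0) ^+ 2 + 1).
  have NK : 0 <= (N * K0) ^+ 2 by rewrite sqr_ge0.
  have NK1 : 0 < (N * K0) ^+ 2 + 1 by rewrite ltr_wpDl.
  have d'0 : 0 < d' by rewrite divr_gt0.
  have [s' [b' [s'0 s'1 b'0 [ws' Hb' sb']]]] := sb d' d'0.
  have := flux_quotient_bound a2 dW incW Hi mF WF s'0 s'1 b'0 ws' Hb' x0.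
  move=> /(qle x _ x0); rewrite -/K0 => qx.
  have Dd : 0 <= D + d' by rewrite addr_ge0// ltW.
  have : `|q x| <= N * K0 * Num.sqrt (D + d').
    apply: (le_trans qx); have := ler_wpM2l (mulr_ge0 N0 K0p) sb'; lra.
  move=> /(lerXn2r 2); rewrite !nnegrE normr_ge0 => /(_ isT).
  rewrite mulr_ge0 ?sqrtr_ge0 ?mulr_ge0// => /(_ isT).
  rewrite exprMn sqr_sqrtr// real_normK ?num_real// => /le_trans; apply.
  rewrite mulrDr lerD2l /d' mulrCA ler_piMr ?(ltW d0)//.
  by rewrite ler_pdivrMr// mul1r lerDl.
exists (extend0 q (2^-1 * 1 * L)); split => //.
- move=> e ep; have C0 : 0 <= 2^-1 * N * (K0 * (s + b)).
    by rewrite !mulr_ge0// addr_ge0 ?(ltW s0) ?(ltW b0).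
  have [M MC] := power_decay C0 ep; exists (Num.max 1 M) => x.
  rewrite ge_max => /andP[x1 Mx]; have x0 : 0 < x by exact: lt_le_trans x1.
  rewrite /extend0 x0; apply: le_trans (MC x Mx).
  apply: (@le_trans _ _ (2^-1 * N * (K0 * (s + b) * x `^ (- (20%:R^-1))))).
    by apply: qle => //; apply: (flux_quotient_decay a2 dW incW Hi mF WF).
  by rewrite !mulrA.
- have sq0 : forall x, 0 < x -> extend0 q (2^-1 * 1 * L) x ^+ 2 <= (N * K0) ^+ 2 * D.
    by move=> x x0; rewrite /extend0 x0; exact: qbound.
  move=> x; have [x0|x0] := ltP 0 x; first exact: sq0.
  have -> : extend0 q (2^-1 * 1 * L) x = 2^-1 * 1 * L by rewrite /extend0 ltNge x0.
  have : q x ^+ 2 @[x --> 0^'+] --> (2^-1 * 1 * L) ^+ 2 by rewrite expr2; exact: cvgM.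
  move=> /cvgr_to_le; apply; near=> y; apply: qbound.
  by near: y; exact: nbhs_right_gt.
- apply: filterS2 fU wW; first exact: (ae_filter_ringOfSetsType mu).
  move=> x fUx wWx hx; have x0 : 0 < x by rewrite -halflineE.
  rewrite /extend0 x0 /q /G /Q -fUx// -wWx//.
  have -> : x `^ (a + 2) = x `^ (a + 1) * x.
    have -> : a + 2 = (a + 1) + 1 by ring.
    by rewrite powRD ?powRr1 ?ltW// (gt_eqF x0) implybT.
  by field; rewrite gt_eqF.
Unshelve. all: by end_near. Qed.

End FixedTime.

(** * From the quadrant to almost every time slice *)

Section Slicing.
Context {R : realType}.
Implicit Types (u w : R -> R -> R) (f g : R -> R) (a b c d s t x y : R).
Local Notation mu := (@lebesgue_measure R).
Local Notation RM := (measurableTypeR R).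
Local Notation mu2 := (mu \x mu)%E.

Definition window (n : nat) : set R := [set` `[(n.+1%:R)^-1, n.+1%:R]].

Lemma window_halfline n : window n `<=` halfline.
Proof. by apply: itv_halfline; rewrite invr_gt0 ltr0n. Qed.

Lemma window_mono m n : (m <= n)%N -> window m `<=` window n.
Proof.
move=> mn x; rewrite /window/= !in_itv/= => /andP[mx xm]; apply/andP; split.
  by rewrite (le_trans _ mx)// lef_pV2 ?posrE ?ltr0n// ler_nat.
by rewrite (le_trans xm)// ler_nat.
Qed.

Lemma compact_window (K : set R) : compact K -> K `<=` halfline ->
  exists n, K `<=` window n.
Proof.
move=> cK Kh; have [M [_ hM]] := compact_bounded cK.
have cV : {within K, continuous (fun x : R => x^-1)}.
  apply: continuous_in_subspaceT => x; rewrite inE => /Kh; rewrite halflineE => x0.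
  by apply: cvgV; [rewrite gt_eqF|exact: cvg_id].
have [M' [_ hM']] := compact_bounded (continuous_compact cV cK).
pose N := Num.max `|M| `|M'| + 1.
have N0 : 0 <= N by rewrite addr_ge0// le_max normr_ge0.
have MN : M < N by rewrite ltr_pwDr// le_max ler_norm.
have MN' : M' < N by rewrite ltr_pwDr// le_max ler_norm orbT.
have NB := archi_boundP N0; set B := Num.Def.archi_bound N in NB.
exists B => x Kx; have := Kh _ Kx; rewrite halflineE => x0.
have NB1 : N <= B.+1%:R by rewrite (le_trans (ltW NB))// ler_nat.
rewrite /window/= in_itv/=; apply/andP; split.
  have : `|x^-1| <= N by apply: (hM' _ MN'); exists x.
  rewrite normfV (gtr0_norm x0) => xN.
  rewrite -[leRHS]invrK lef_pV2 ?posrE ?ltr0n ?invr_gt0//.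
  exact: le_trans NB1.
by rewrite (le_trans _ NB1)// (le_trans (ler_norm x))//; exact: hM.
Qed.

Lemma window_exists t : 0 < t -> exists n, window n t.
Proof.
move=> t0; have [||n tn] := @compact_window [set t].
- exact: compact_set1.
- by move=> _ ->; rewrite halflineE.
- by exists n; exact: tn.
Qed.

Lemma loc_int_windows f :
  (forall n, mu.-integrable (window n) (EFin \o f)) -> locally_integrable halfline f.
Proof.
move=> fi; split.
- have -> : (halfline : set R) = \bigcup_n window n.
    apply/seteqP; split=> [t|t [n _]]; last exact: window_halfline.
    by rewrite halflineE => /window_exists[n nt]; exists n.
  apply/measurable_fun_bigcup => [n|n]; first exact: measurable_itv.
  by apply/measurable_EFinP; exact: measurable_int (fi n).
- exact: interval_open.
- move=> K Kh cK; have [n Kn] := compact_window cK Kh.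
  have mK := compact_measurable cK.
  have /integrableP[_] // : mu.-integrable K (EFin \o f).
  apply: (@integrableS _ _ _ mu (window n)) => //; exact: measurable_itv.
Qed.

Lemma measurable_quadrant : measurable (quadrant : set (RM * RM)).
Proof. by apply: measurableX; exact: measurable_halfline. Qed.

Section box.
Variables (u : R -> R -> R) (ui : locally_integrable2 quadrant u).
Variables (a b c d : R) (a0 : 0 < a) (c0 : 0 < c).

Let box : set (RM * RM) := [set` `[a, b]] `*` [set` `[c, d]].

Lemma box_quadrant : box `<=` quadrant.
Proof. by move=> z [z1 z2]; split; [exact: itv_halfline z1|exact: itv_halfline z2]. Qed.

Lemma integrable_box :
  mu2.-integrable setT ((fun z : RM * RM => (u z.1 z.2)%:E) \_ box).
Proof.
have mb : measurable box by apply: measurableX.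
apply/(integrable_mkcond _ mb).1; apply/integrableP; split.
  apply/measurable_EFinP; apply: measurable_funS ui.1; first exact: measurable_quadrant.
  exact: box_quadrant.
apply: ui.2; first exact: box_quadrant.
by apply: compact_setX; exact: segment_compact.
Qed.

End box.

Lemma slice_loc_int u : locally_integrable2 quadrant u ->
  {ae mu, forall t, halfline t -> locally_integrable halfline (u t)}.
Proof.
move=> ui.
have p0 n : 0 < (n.+1%:R^-1 : R) by rewrite invr_gt0 ltr0n.
have : {ae mu, forall t, forall n, mu.-integrable setT (fun x : RM =>
    ((fun z : RM * RM => (u z.1 z.2)%:E) \_ (window n `*` window n)) (t, x))}.
  apply/ae_foralln => n; apply: (ae_integrable1 (m1 := mu) (m2 := mu)).
  exact: integrable_box.
apply: filterS; first exact: (ae_filter_ringOfSetsType mu).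
move=> t ti; rewrite halflineE => t0; have [n0 nt] := window_exists t0.
apply: loc_int_windows => m; pose n := maxn m n0.
have tn : window n t by apply: window_mono nt; exact: leq_maxr.
apply: (@integrableS _ _ _ mu (window n)).
- exact: measurable_itv.
- exact: measurable_itv.
- by apply: window_mono; exact: leq_maxl.
refine ((@integrable_mkcond _ _ _ mu (window n) (EFin \o u t) _).2 _).
  exact: measurable_itv.
apply: eq_integrable (ti n) => // x _.
rewrite !patchE; have [xn|xn] := pselect (window n x).
  by rewrite !mem_set//; split.
by rewrite !memNset// => -[].
Qed.

Section slice_pairing.
Variables (u : R -> R -> R) (ui : locally_integrable2 quadrant u).
Variables (c d : R) (c0 : 0 < c) (psi : R -> R).
Hypotheses (cpsi : continuous psi) (spsi : supp c d psi).

Let p t := pairing (u t) psi.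

Let Phi a b (z : RM * RM) : \bar R := (((fun z : RM * RM => (u z.1 z.2)%:E) \_
  ([set` `[a, b]] `*` [set` `[c, d]])) z * (psi z.2)%:E)%E.

Let Phi_integrable a b : 0 < a -> mu2.-integrable setT (Phi a b).
Proof.
move=> a0; have ib := integrable_box ui b d a0 c0.
have [M hM] := continuous_bounded_itv c d cpsi.
have : mu2.-integrable setT (fun z : RM * RM => (M%:E *
    ((fun z : RM * RM => (u z.1 z.2)%:E) \_ ([set` `[a, b]] `*` [set` `[c, d]])) z)%E).
  exact: integrableZl.
apply: le_integrable => //.
  apply: emeasurable_funM; first exact: measurable_int ib.
  apply/measurable_EFinP; apply: measurableT_comp measurable_snd.
  exact: continuous_measurable_fun.
move=> z _; rewrite /Phi patchE; case: ifPn => [|_]; last by rewrite mul0e mule0.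
rewrite inE => -[_ z2]; rewrite -!EFinM !abse_EFin lee_fin !normrM mulrC.
by rewrite ler_wpM2r// (le_trans (hM _ z2))// ler_norm.
Qed.

Let PhiE a b t : 0 < a -> a <= t <= b ->
  (\int[mu]_x Phi a b (t, x) = \int[mu]_(x in halfline) (u t x * psi x)%:E)%E.
Proof.
move=> a0 atb; rewrite [RHS]integral_mkcond; apply: eq_integral => x _.
rewrite /Phi !patchE; have [->|/spsi/andP[cx xd]] := eqVneq (psi x) 0.
  by rewrite mule0 mulr0; case: ifP.
rewrite !mem_set//; first by rewrite halflineE; exact: lt_le_trans cx.
by split; rewrite /= in_itv/= ?cx ?xd.
Qed.

Let Phi_out a b t : ~~ (a <= t <= b) -> (\int[mu]_x Phi a b (t, x) = 0)%E.
Proof.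
move=> atb; apply: integral0_eq => x _; rewrite /Phi patchE memNset ?mul0e//.
by case=> /=; rewrite in_itv/= (negbTE atb).
Qed.

Lemma slice_pairing_loc_int : locally_integrable halfline p.
Proof.
apply: loc_int_windows => n; set a := n.+1%:R^-1 : R; set b := n.+1%:R : R.
have a0 : 0 < a by rewrite invr_gt0 ltr0n.
have Fi := integrable_fubini_F (Phi_integrable b a0).
have wi : mu.-integrable (window n) (fubini_F mu (Phi a b)).
  apply: (@integrableS _ _ _ mu setT) => //; exact: measurable_itv.
have pE t : window n t -> p t = fine (fubini_F mu (Phi a b) t).
  by rewrite /window/= in_itv => nt; rewrite /fubini_F PhiE.
apply: le_integrable wi => //; first exact: measurable_itv.
  apply/measurable_EFinP; apply: (eq_measurable_fun (fine \o fubini_F mu (Phi a b))).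
    by move=> t; rewrite inE => /pE ->.
  apply: measurable_funTS; apply: measurableT_comp; first exact: fine_measurable.
  exact: measurable_int Fi.
move=> t nt; rewrite /= pE//; by case: (fubini_F _ _ t) => //=; rewrite leey.
Qed.

Lemma slice_pairing_fubini a b (theta : R -> R) : 0 < a ->
  continuous theta -> supp a b theta ->
  (\int[mu2]_(z in quadrant) (u z.1 z.2 * (theta z.1 * psi z.2))%:E =
    (pairing p theta)%:E)%E.
Proof.
move=> a0 ct st; have Fi := Phi_integrable b a0.
have [M hM] := continuous_bounded_itv a b ct.
have mt : measurable_fun (setT : set (RM * RM)) (fun z => theta z.1).
  by apply: measurableT_comp measurable_fst; exact: continuous_measurable_fun.
have tM t : `|theta t| <= `|M|.
  have [->|/st tab] := eqVneq (theta t) 0; first by rewrite normr0.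
  by rewrite (le_trans (hM t _) (ler_norm _))//= in_itv.
pose Psi (z : RM * RM) := ((theta z.1)%:E * Phi a b z)%E.
have Psi_i : mu2.-integrable setT Psi.
  have : mu2.-integrable setT (fun z : RM * RM => (`|M|%:E * Phi a b z)%E).
    exact: integrableZl.
  apply: le_integrable => //.
    by apply: emeasurable_funM; [exact/measurable_EFinP|exact: measurable_int Fi].
  move=> z _; rewrite /Psi !abseM lee_wpmul2r// !abse_EFin lee_fin normr_id.
  exact: tM.
transitivity (\int[mu2]_z Psi z)%E.
  rewrite integral_mkcond; apply: eq_integral => z _.
  rewrite /Psi /Phi !patchE.
  have [->|/st/andP[az zb]] := eqVneq (theta z.1) 0.
    by rewrite mul0r mulr0 mul0e; case: ifP.
  have [->|/spsi/andP[cz zd]] := eqVneq (psi z.2) 0.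
    by rewrite !mulr0 !mule0; case: ifP.
  rewrite !mem_set//.
  - by rewrite -!EFinM mulrCA.
  - by split; rewrite /= in_itv/= ?az ?zb ?cz ?zd.
  - by split; rewrite halflineE; [exact: lt_le_trans az|exact: lt_le_trans cz].
rewrite -(integral12_prod_meas1 Psi_i).
rewrite -(pairingE a0 slice_pairing_loc_int ct st).
rewrite [RHS]integral_mkcond.
have mF := measurable_int _ (integrable_fubini_F Psi_i).
apply: ae_eq_integral => //.
  apply/(measurable_restrictT _ _).1; first exact: measurable_halfline.
  exact: measurable_int (integrable_pairing a0 slice_pairing_loc_int ct st).
have Phi1 := ae_integrable1 Fi.
apply: filterS Phi1.
move=> t ti _; rewrite patchE /fubini_F /Psi/=.
have [->|/st atb] := eqVneq (theta t) 0.
  rewrite integral0_eq; last by move=> x _; rewrite mul0e.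
  by rewrite mulr0; case: ifP.
rewrite mem_set; last first.
  by rewrite halflineE; case/andP: atb => at_ _; exact: lt_le_trans at_.
rewrite integralZl// mulrC EFinM; congr (_ * _)%E.
rewrite PhiE// /p /pairing fineK// -(PhiE a0 atb).
exact: integrable_fin_num.
Qed.

End slice_pairing.

Lemma test_fun2_tensor a b c d f g : 0 < a -> 0 < c ->
  test_on a b f -> test_on c d g -> test_fun2 (fun t x => f t * g x).
Proof.
move=> a0 c0 [sf Sf] [sg Sg]; split.
  have gen k : forall f g, smooth f -> smooth g -> Ck2 k (fun t x => f t * g x).
    elim: k => [|k IH] f1 g1 sf1 sg1.
      split => // z; apply: cvgM.
        by apply: (@continuous_comp _ _ _ fst f1); [exact: cvg_fst|exact: smooth_continuous].
      by apply: (@continuous_comp _ _ _ snd g1); [exact: cvg_snd|exact: smooth_continuous].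
    have d1 (t x : R) : is_derive t 1 (fun s => f1 s * g1 x) (derive1 f1 t * g1 x).
      have := is_deriveM (smooth_is_derive t sf1) (is_derive_cst (g1 x) t 1).
      by move/is_derive_eq; apply; rewrite /GRing.scale/= mulr0 add0r mulrC.
    have d2 (t x : R) : is_derive x 1 (fun y => f1 t * g1 y) (f1 t * derive1 g1 x).
      exact: (@is_deriveZ R R R g1 (f1 t) x 1 _ (smooth_is_derive x sg1)).
    have c1 := (IH f1 g1 sf1 sg1).
    split; first by case: k {IH} c1 => [|k] [].
    split.
    - by move=> t x; apply: ex_derive.
    - by move=> t x; apply: ex_derive.
    - have -> : pdt (fun t x => f1 t * g1 x) = fun t x => derive1 f1 t * g1 x.
        by apply/funext => t; apply/funext => x; rewrite /pdt derive1E derive_val.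
      exact: IH (smooth_derive1 sf1) sg1.
    - have -> : pdx (fun t x => f1 t * g1 x) = fun t x => f1 t * derive1 g1 x.
        by apply/funext => t; apply/funext => x; rewrite /pdx derive1E derive_val.
      exact: IH sf1 (smooth_derive1 sg1).
  by move=> k; exact: gen.
exists ([set` `[a, b]] `*` [set` `[c, d]]); split.
- by apply: compact_setX; exact: segment_compact.
- by move=> z [z1 z2]; split; [exact: itv_halfline z1|exact: itv_halfline z2].
- move=> t x; apply: contra_notP => /eqP; rewrite mulf_eq0 negb_or => /andP[/Sf h1 /Sg h2].
  by split; rewrite /= in_itv.
Qed.

(** Test the weak derivative on the quadrant with products [theta t * psi x]:
    the difference of the two pairings with [psi] is, as a function of time,
    orthogonal to all [theta]. *)
Lemma slice_weak_D2 u w c d psi : is_wDxx u w -> 0 < c -> test_on c d psi ->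
  {ae mu, forall t, halfline t ->
    pairing (u t) (derive1n 2 psi) = pairing (w t) psi}.
Proof.
move=> [ui wi uw] c0 bpsi; have b2 := test_on_derive1 (test_on_derive1 bpsi).
have cp := smooth_continuous bpsi.1; have cp2 := smooth_continuous b2.1.
have pu := slice_pairing_loc_int ui c0 cp2 b2.2.
have pw := slice_pairing_loc_int wi c0 cp bpsi.2.
have : (fun t => pairing (u t) (derive1n 2 psi) - pairing (w t) psi) = cst 0
    %[ae mu in halfline].
  apply: (plateau_orthogonal_eq0 (loc_intB pu pw)).
  move=> n qa qb a0 ab; have bt := test_on_plateau n (ratr qa : R) (ratr qb).
  rewrite (pairingBl a0 pu pw bt); apply/eqP; rewrite subr_eq0; apply/eqP.
  apply: EFin_inj; have ct := smooth_continuous bt.1.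
  rewrite -(slice_pairing_fubini ui c0 cp2 b2.2 a0 ct bt.2).
  rewrite -(slice_pairing_fubini wi c0 cp bpsi.2 a0 ct bt.2).
  have /= <- := uw _ (test_fun2_tensor a0 c0 bt bpsi).
  apply: eq_integral => z _; congr (_ * _)%:E; rewrite /pdx/=.
  have sp : smooth (derive1 psi) by exact: smooth_derive1 bpsi.1.
  have e1 (g : R -> R) (k : R) : smooth g ->
      derive1 (fun y => k * g y) = fun y => k * derive1 g y.
    move=> sg; apply: is_derive_derive1 => x.
    exact: (@is_deriveZ R R R g k x 1 _ (smooth_is_derive x sg)).
  by rewrite (e1 _ _ bpsi.1) (e1 _ _ sp).
apply: filterS; first exact: (ae_filter_ringOfSetsType mu).
by move=> t H th; apply/eqP; rewrite -subr_eq0; apply/eqP; exact: H.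
Qed.

End Slicing.

(** * Strong measurability of functions vanishing at infinity *)

Section Separable.
Context {R : realType}.
Implicit Types (f g : R -> R) (t x y e : R).
Local Notation RM := (measurableTypeR R).

Lemma uniform_oscillation f (n : nat) e : continuous f -> 0 < e ->
  exists p : nat, forall x, 0 <= x <= n%:R -> forall y,
    `|x - y| <= p.+1%:R^-1 -> `|f x - f y| <= e.
Proof.
move=> cf e0; have e2 : 0 < e / 2 by rewrite divr_gt0.
have := (compact_near_coveringP _).1 (@segment_compact R 0 n%:R).
move=> /(_ nat \oo (fun p x => forall y, `|x - y| <= p.+1%:R^-1 ->
  `|f x - f y| <= e)) H.
have {H} : \forall p \near \oo, [set` `[0, n%:R]] `<=` (fun x => forall y,
    `|x - y| <= p.+1%:R^-1 -> `|f x - f y| <= e).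
  apply: H => x0 _; move: (x0 : R) => {x0} x.
  have /cvgrPdist_lt/(_ _ e2)/nbhs_ballP[d /= d0 xd] := cf x.
  have d2 : 0 < d / 2 by rewrite divr_gt0.
  have [k] := ltr_add_invr d2; rewrite add0r => kd.
  exists (ball x (d / 2), [set p | (k <= p)%N]) => /=.
    by split; [exact: nbhsx_ballx|exists k].
  move=> [x' p] /= [x'd kp] y xy.
  have p1 : p.+1%:R^-1 <= k.+1%:R^-1 :> R.
    by rewrite lef_pV2 ?posrE ?ltr0n// ler_nat ltnS.
  have {}x'd : `|x - x'| < d / 2 := x'd.
  have yd : ball x d y.
    suff : `|x - y| < d by [].
    rewrite (le_lt_trans (ler_distD x' x y))// [ltRHS]splitr ltrD//.
    by rewrite (le_lt_trans xy)// (le_lt_trans p1).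
  have x'd' : ball x d x'.
    suff : `|x - x'| < d by [].
    by rewrite (lt_trans x'd)// ltr_pdivrMr// mulr_natr mulr2n ltrDl.
  have := xd _ yd; have := xd _ x'd'; rewrite /= => h1 h2.
  rewrite (le_trans (ler_distD (f x) (f x') (f y)))// [leRHS]splitr lerD ?ltW//.
  by rewrite distrC.
move=> [p _ hp]; exists p => x x01; apply: (hp p) => //=.
Qed.

Lemma grid_index (h x : R) : 0 < h -> 0 <= x ->
  exists j : nat, j%:R * h <= x < j.+1%:R * h.
Proof.
move=> h0 x0; have xh : 0 <= x / h by rewrite divr_ge0// ltW.
have ex : exists j : nat, x < j.+1%:R * h.
  exists (Num.Def.archi_bound (x / h)); rewrite -ltr_pdivrMr//.
  by rewrite (lt_le_trans (archi_boundP xh))// ler_nat.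
case: (ex_minnP ex) => -[|j] xj jmin; first by exists 0%N; rewrite mul0r x0.
exists j.+1; rewrite xj andbT leNgt; apply/negP => /jmin.
by rewrite ltnn.
Qed.

(** A function vanishing at infinity is determined, up to [4 / (m + 1)] on the
    half-line, by finitely many rational data. *)
Definition coded (m n p : nat) (r : seq rat) f : Prop :=
  [/\ forall x, 0 <= x <= n%:R -> forall y, `|x - y| <= p.+1%:R^-1 ->
        `|f x - f y| <= m.+1%:R^-1,
      forall x, n%:R <= x -> `|f x| <= m.+1%:R^-1 &
      forall j : nat, (j <= n * p.+1)%N ->
        `|f (j%:R / p.+1%:R) - ratr (nth 0 r j)| <= m.+1%:R^-1].

Lemma coded_close m n p r f g : coded m n p r f -> coded m n p r g ->
  forall x, 0 <= x -> `|f x - g x| <= 4 / m.+1%:R.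
Proof.
move=> [of_ tf vf] [og tg vg] x x0.
have e0 : 0 <= m.+1%:R^-1 :> R by rewrite invr_ge0.
move: (m.+1%:R^-1 : R) e0 of_ tf vf og tg vg => e e0 of_ tf vf og tg vg.
have [nx|xn] := leP n%:R x.
  have := tf x nx; have := tg x nx; have := ler_normB (f x) (g x); lra.
have h0 : 0 < p.+1%:R^-1 :> R by rewrite invr_gt0 ltr0n.
have [j /andP[jx xj]] := grid_index h0 x0.
have jn : (j <= n * p.+1)%N.
  have : j%:R <= n%:R * p.+1%:R :> R.
    by rewrite -ler_pdivrMr ?ltr0n// (le_trans jx)// ltW.
  by rewrite -natrM ler_nat.
set y := j%:R / p.+1%:R in jx; have xy : `|x - y| <= p.+1%:R^-1.
  rewrite ger0_norm ?subr_ge0// lerBlDl; move: xj.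
  by rewrite -natr1 mulrDl mul1r => /ltW.
have x01 : 0 <= x <= n%:R by rewrite x0 ltW.
have := of_ x x01 y xy; have := og x x01 y xy.
have := vf j jn; have := vg j jn; rewrite -/y; set q := ratr _ => h1 h2 h3 h4.
have t1 := ler_distD (f y) (f x) q; have t2 := ler_distD (g y) (g x) q.
have := ler_distD q (f x) (g x); rewrite (distrC q (g x)); lra.
Qed.

Lemma coded_exists m f : continuous f ->
  (forall e, 0 < e -> exists M : R, forall x, M <= x -> `|f x| <= e) ->
  exists n p r, coded m n p r f.
Proof.
move=> cf df; have e0 : 0 < m.+1%:R^-1 :> R by rewrite invr_gt0 ltr0n.
have [M hM] := df _ e0.
pose n := Num.Def.archi_bound `|M|.
have nM : M <= n%:R.
  by rewrite (le_trans (ler_norm M))// ltW// archi_boundP.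
have [p hp] := uniform_oscillation n cf e0.
have /choice[q hq] : forall j : nat, exists q : rat,
    `|f (j%:R / p.+1%:R) - ratr q| <= m.+1%:R^-1.
  move=> j; have : f (j%:R / p.+1%:R) < f (j%:R / p.+1%:R) + m.+1%:R^-1.
    by rewrite ltrDl.
  move=> /rat_in_itvoo[q]; rewrite in_itv/= => /andP[q1 q2]; exists q.
  by rewrite distrC ger0_norm ?subr_ge0 ?(ltW q1)// lerBlDl ltW.
exists n, p, [seq q j | j <- iota 0 (n * p.+1).+1]; split => //.
  by move=> x nx; apply: hM; exact: le_trans nx.
move=> j jn; rewrite (nth_map 0%N) ?size_iota ?ltnS//.
by rewrite nth_iota ?ltnS// add0n.
Qed.

Lemma dense_points : exists xs : nat -> R, (forall i, 0 <= xs i) /\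
  forall x e, 0 <= x -> 0 < e -> exists i, `|xs i - x| < e.
Proof.
exists (fun i => if (unpickle i : option rat) is Some q then `|ratr q| else 0).
split; first by move=> i; case: unpickle.
move=> x e x0 e0; have : x < x + e by rewrite ltrDl.
move=> /rat_in_itvoo[q]; rewrite in_itv/= => /andP[q1 q2]; exists (pickle q).
rewrite pickleK (@ger0_norm _ (ratr q)); last by rewrite (le_trans x0)// ltW.
by rewrite ger0_norm ?subr_ge0 ?(ltW q1)//; lra.
Qed.

Lemma supnorm_dense (xs : nat -> R) f : continuous f ->
  (forall i, 0 <= xs i) ->
  (forall x e, 0 <= x -> 0 < e -> exists i, `|xs i - x| < e) ->
  supnorm f = esups (fun i => `|f (xs i)|%:E) 0.
Proof.
move=> cf xs0 xsd; apply/eqP; rewrite eq_le; apply/andP; split.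
  apply: ge_ereal_sup => _ [x /= x0 <-]; rewrite in_itv/= andbT in x0.
  apply/lee_addgt0Pr => e e0.
  have /cvgrPdist_lt/(_ _ e0)/nbhs_ballP[d /= d0 xd] := cf x.
  have [i xi] := xsd x d x0 d0.
  have : ball x d (xs i) by rewrite /ball/= distrC.
  move=> /xd /= fxi.
  apply: (@le_trans _ _ (`|f (xs i)|%:E + e%:E)%E).
    rewrite -EFinD lee_fin; have := ler_normD (f x - f (xs i)) (f (xs i)).
    by rewrite subrK; lra.
  by rewrite leeD2r// /esups; apply: ereal_sup_ubound; exists i.
apply: ge_ereal_sup => _ [i _ <-]; apply: ereal_sup_ubound.
by exists (xs i) => //=; rewrite in_itv/= andbT.
Qed.

Lemma supnorm_le f e : (forall x, 0 <= x -> `|f x| <= e) ->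
  (supnorm f <= e%:E)%E.
Proof.
move=> fe; apply: ge_ereal_sup => _ [x /= x0 <-]; rewrite lee_fin fe//.
by move: x0; rewrite in_itv/= andbT.
Qed.

Lemma supnorm_ge0 f : (0 <= supnorm f)%E.
Proof.
apply: (@le_trans _ _ `|f 0|%:E); first by rewrite lee_fin.
by apply: ereal_sup_ubound; exists 0 => //=; rewrite in_itv/= lexx.
Qed.

Lemma simple_BC0_cst f : BC0 f -> simple_BC0 (fun _ : R => f).
Proof.
move=> bf; exists 1%N, (fun _ => setT), (fun _ => f); split => // t x.
by rewrite big_ord1 indicT mul1r.
Qed.

Lemma simple_BC0_if (A : set R) f (s : R -> R -> R) : measurable A -> BC0 f ->
  simple_BC0 s ->
  simple_BC0 (fun t x => \1_A t * f x + \1_(~` A) t * s t x).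
Proof.
move=> mA bf [m [B [b [mB bb sE]]]].
exists m.+1, (fun i => if unlift ord0 i is Some j then ~` A `&` B j else A),
  (fun i => if unlift ord0 i is Some j then b j else f); split.
- move=> i; case: unliftP => [j _|_] //.
  by apply: measurableI => //; exact: measurableC.
- by move=> i; case: unliftP.
- move=> t x; rewrite big_ord_recl unlift_none; congr (_ + _).
  rewrite sE mulr_sumr; apply: eq_bigr => j _; rewrite liftK mulrA.
  by rewrite indicI.
Qed.

Section strong.
Variables (v : R -> R -> R) (q : nat -> R -> R).
Hypotheses (cv : forall t, continuous (v t)) (cq : forall k, continuous (q k)).
Hypothesis bq : forall k, BC0 (q k).
Hypothesis mv : forall x, 0 <= x -> measurable_fun (setT : set RM) (fun t => v t x).
Hypothesis qd : forall t (m : nat), exists k, forall x, 0 <= x ->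
  `|q k x - v t x| <= 4 / m.+1%:R.

Let dist t g : \bar R := supnorm (fun x => g x - v t x).

Let mdist k : measurable_fun (setT : set RM) (fun t => dist t (q k)).
Proof.
have [xs [xs0 xsd]] := dense_points.
have -> : (fun t => dist t (q k)) =
    (fun t => esups (fun i => `|q k (xs i) - v t (xs i)|%:E) 0).
  apply/funext => t; apply: (@supnorm_dense xs) => //.
  by move=> x; apply: cvgB; [exact: cq|exact: cv].
apply: measurable_fun_esups => i; apply/measurable_EFinP.
apply: measurableT_comp => //; apply: measurable_funB => //; exact: mv.
Qed.

(* Running best approximation among the first terms of [q]. *)
Let approx : nat -> R -> R -> R := fix approx n := match n with
  | 0 => fun _ => q 0
  | n'.+1 => fun t => if (dist t (q n'.+1) < dist t (approx n' t))%E then q n'.+1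
                      else approx n' t
  end.

Let approxS n t : dist t (approx n.+1 t) =
  Order.min (dist t (q n.+1)) (dist t (approx n t)).
Proof. by rewrite /= /Order.min; case: ifP. Qed.

Let mapprox n : measurable_fun (setT : set RM) (fun t => dist t (approx n t)).
Proof.
elim: n => [|n IH]; first exact: mdist.
have -> : (fun t => dist t (approx n.+1 t)) =
    (fun t => mine (dist t (q n.+1)) (dist t (approx n t))).
  by apply/funext => t; rewrite approxS.
exact: measurable_mine.
Qed.

Let simple_approx n : simple_BC0 (approx n).
Proof.
elim: n => [|n IH]; first exact: simple_BC0_cst.
pose A : set R := [set t | (dist t (q n.+1) < dist t (approx n t))%E].
have -> : approx n.+1 = fun t x => \1_A t * q n.+1 x + \1_(~` A) t * approx n t x.
  apply/funext => t; apply/funext => x; rewrite !indicE /=.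
  have [tA|tA] := boolP (dist t (q n.+1) < dist t (approx n t))%E.
    by rewrite mem_set// memNset// mul1r mul0r addr0.
  rewrite memNset//; last exact/negP.
  by rewrite mem_set/=; [rewrite mul0r mul1r add0r|exact/negP].
apply: simple_BC0_if => //; rewrite -[A]setTI.
exact: (@measurable_lte _ RM R setT measurableT _ _ (mdist n.+1) (mapprox n)).
Qed.

Let dist_approx_le n k t : (k <= n)%N -> (dist t (approx n t) <= dist t (q k))%E.
Proof.
elim: n => [|n IH]; first by rewrite leqn0 => /eqP ->.
rewrite leq_eqVlt => /predU1P[->|]; rewrite approxS ge_min; first by rewrite lexx.
by rewrite ltnS => /IH ->; rewrite orbT.
Qed.

(** Each value of [v] is a limit of functions of the sequence [q], so the best
    approximation among the first [n] of them converges, and it is a simple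
    function of time because the distances to [v t] are measurable. *)
Lemma strongly_measurable_of_dense : strongly_measurable_BC0 v.
Proof.
exists approx; split; first exact: simple_approx.
apply: aeW => t _ /=.
have near0 e : 0 < e -> \forall n \near \oo,
    (supnorm (approx n t \- v t)%R <= e%:E)%E.
  move=> e0; have [m] := ltr_add_invr (divr_gt0 e0 (ltr0n R 4)).
  rewrite add0r => me; have [k hk] := qd t m.
  exists k => // n /= kn; apply: le_trans (dist_approx_le t kn) _.
  apply: supnorm_le => x x0; apply: (le_trans (hk x x0)).
  by rewrite mulrC -ler_pdivlMr// ltW.
apply/fine_cvgP; split.
  apply: filterS (near0 1 ltr01) => n h.
  by rewrite ge0_fin_numE ?supnorm_ge0// (le_lt_trans h)// ltry.
apply/cvgrPdist_le => e e0; apply: filterS (near0 e e0) => n h.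
rewrite sub0r normrN ger0_norm ?fine_ge0 ?supnorm_ge0//.
by rewrite -lee_fin fineK// ge0_fin_numE ?supnorm_ge0// (le_lt_trans h)// ltry.
Qed.

End strong.

(** The continuous functions vanishing at infinity are separable, although all
    the bounded continuous ones are not: choosing one slice of [v] for each of the
    countably many codes in use gives a dense sequence of slices. *)
Lemma strongly_measurable_C0 (v : R -> R -> R) :
  (forall t, continuous (v t)) -> (forall t, BC0 (v t)) ->
  (forall t e, 0 < e -> exists M : R, forall x, M <= x -> `|v t x| <= e) ->
  (forall x, 0 <= x -> measurable_fun (setT : set RM) (fun t => v t x)) ->
  strongly_measurable_BC0 v.
Proof.
move=> cv bv dv mv.
have /choice[q hq] : forall k : nat, exists t : R,
    forall m n p r, unpickle k = Some (m, n, p, r) ->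
      (exists s, coded m n p r (v s)) -> coded m n p r (v t).
  move=> k; case: (unpickle k) => [[[[m n] p] r]|]; last by exists 0.
  have [[s hs]|ns] := pselect (exists s, coded m n p r (v s)).
    by exists s => m' n' p' r' [<- <- <- <-].
  by exists 0 => m' n' p' r' [<- <- <- <-] /ns.
apply: (@strongly_measurable_of_dense v (fun k => v (q k))) => // t m.
have [n [p [r c]]] := coded_exists m (cv t) (dv t).
exists (pickle (m, n, p, r)) => x x0; apply: coded_close x0; last exact: c.
by apply: hq; [rewrite pickleK|exists t].
Qed.

End Separable.

(** * Measurability in time of the continuous representatives *)

Section Traces.
Context {R : realType}.
Implicit Types (f V : R -> R) (G : set R) (t x y c : R).
Local Notation mu := (@lebesgue_measure R).
Local Notation RM := (measurableTypeR R).

(** Right neighbourhoods only, so that the boundary point 0 is included. *)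
Definition low_right V x c (n k : nat) : set RM :=
  [set y | [/\ x < y, y < x + n.+1%:R^-1 & V y < c + k.+1%:R^-1]].

(** The value of the continuous representative at a point is read off from
    measures, which do not see null sets. *)
Lemma low_right_null f V x c : continuous f ->
  0 <= x -> V = f %[ae mu in halfline] ->
  (forall n k, measurable (low_right V x c n k)) ->
  c < f x <-> exists n k, mu (low_right V x c n k) = 0%E.
Proof.
move=> cf x0 Vf mJ; split => [cx|[n [k J0]]].
  have [k] := ltr_add_invr cx => ck.
  have := cf x; move=> /cvgrPdist_lt/(_ (f x - (c + k.+1%:R^-1))).
  rewrite subr_gt0 => /(_ ck)/nbhs_ballP[d /= d0 xd].
  have [n] := ltr_add_invr d0; rewrite add0r => nd.
  exists n, k; apply: measure_negligible => //.
  apply: negligibleS Vf => y /= [xy yn yk] /(_ _).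
  rewrite halflineE => /(_ (le_lt_trans x0 xy)) Vy.
  have /xd /= : ball x d y.
    by rewrite /ball/= distrC gtr0_norm ?subr_gt0// ltrBlDl (lt_trans yn)// ltrD2l.
  move: yk; rewrite Vy => yk; apply/negP; rewrite -leNgt.
  by rewrite (le_trans _ (ler_norm _))// lerD2l lerN2 ltW.
rewrite ltNge; apply/negP => fc.
have k0 : 0 < k.+1%:R^-1 :> R by rewrite invr_gt0 ltr0n.
have n0 : 0 < n.+1%:R^-1 :> R by rewrite invr_gt0 ltr0n.
have := cf x; move=> /cvgrPdist_lt/(_ _ k0)/nbhs_ballP[d /= d0 xd].
pose e := Num.min d n.+1%:R^-1; have e0 : 0 < e by rewrite lt_min d0.
pose I : set R := [set` `]x, x + e[].
have : mu.-negligible I.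
  have NJ : mu.-negligible (low_right V x c n k).
    by exists (low_right V x c n k); split => //; exact: mJ.
  apply: negligibleS (negligibleU Vf NJ) => y; rewrite /I/= in_itv/= => /andP[xy ye].
  have y0 : 0 < y by exact: le_lt_trans xy.
  have [Vy|nVy] := eqVneq (V y) (f y).
    right; split => //; first by rewrite (lt_le_trans ye)// lerD2l ge_min lexx orbT.
    have /xd /= : ball x d y.
      rewrite /ball/= distrC gtr0_norm ?subr_gt0// ltrBlDl (lt_le_trans ye)//.
      by rewrite lerD2l ge_min lexx.
    by rewrite distrC Vy => /(le_lt_trans (ler_norm _)); rewrite ltrBlDl => /lt_le_trans; apply; rewrite lerD2r.
  by left; rewrite halflineE => /(_ y0) Vy; rewrite Vy eqxx in nVy.
move=> /measure_negligible => /(_ (measurable_itv _)) I0.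
have : mu I == 0%E by apply/eqP; exact: I0.
rewrite /I lebesgue_measure_itv/= lte_fin ltrDl e0 -EFinD eqe addrAC subrr add0r.
by rewrite gt_eqF.
Qed.

(** By the previous lemma, superlevel sets in time are countable unions of sets
    where a section of a measurable subset of the plane is null. *)
Lemma measurable_trace (V v : R -> R -> R) G :
  measurable_fun quadrant (fun z : R * R => V z.1 z.2) ->
  measurable (G : set RM) -> G `<=` halfline ->
  (forall t, G t -> continuous (v t) /\ V t = v t %[ae mu in halfline]) ->
  (forall t, ~ G t -> v t = cst 0) ->
  forall x, 0 <= x -> measurable_fun (setT : set RM) (fun t => v t x).
Proof.
move=> mV mG Gh vG vNG x x0.
pose A c n k : set (RM * RM) := quadrant `&` [set z | V z.1 z.2 < c + k.+1%:R^-1]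
  `&` (snd @^-1` [set` `]x, x + n.+1%:R^-1[]).
have mA c n k : measurable (A c n k).
  apply: measurableI; last first.
    rewrite -[X in measurable X]setTI; exact: (measurable_snd measurableT _ (measurable_itv _)).
  have -> : [set z : RM * RM | V z.1 z.2 < c + k.+1%:R^-1] =
      (fun z => V z.1 z.2) @^-1` [set` `]-oo, c + k.+1%:R^-1[].
    by apply/seteqP; split=> z /=; rewrite in_itv.
  exact: (mV measurable_quadrant _ (measurable_itv _)).
have AE c n k t : G t -> xsection (A c n k) t = low_right (V t) x c n k.
  move=> /Gh; rewrite halflineE => t0; apply/seteqP; split=> y /=.
    by move=> /xsectionP[[_ /= yc]] /=; rewrite in_itv/= => /andP[xy yx]; split.
  move=> [xy yx yc]; apply/xsectionP; split; last by rewrite /= in_itv/= xy.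
  by split => //; split; rewrite /= ?halflineE//= (le_lt_trans x0).
have mJ c t : G t -> forall n k, measurable (low_right (V t) x c n k).
  by move=> Gt n k; rewrite -(AE _ _ _ _ Gt); exact: measurable_xsection.
have mG0 : measurable_fun (G : set RM) (fun t => v t x).
  move=> mG'; apply: (measurability _ (RGenOInfty.measurableE R)) => //.
  move=> /= _ [_ [c ->] <-].
  have -> : G `&` (fun t => v t x) @^-1` `]c, +oo[%classic = G `&`
     \bigcup_n \bigcup_k ((fun t => mu (xsection (A c n k) t)) @^-1` [set 0%E]).
    apply/seteqP; split=> t [Gt].
      rewrite /= in_itv/= andbT.
      move/(low_right_null (vG _ Gt).1 x0 (vG _ Gt).2 (mJ c t Gt)) => [n [k e0]].
      by split => //; exists n => //; exists k => //=; rewrite AE.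
    move=> [n _ [k _ /= e0]]; split => //; rewrite /= in_itv/= andbT.
    apply/(low_right_null (vG _ Gt).1 x0 (vG _ Gt).2 (mJ c t Gt)).
    by exists n, k; rewrite -AE.
  apply: measurableI => //; apply: bigcup_measurable => n _.
  apply: bigcup_measurable => k _; rewrite -[X in measurable X]setTI.
  exact: (measurable_fun_xsection mu (mA c n k)).
have : measurable_fun (G `|` ~` G : set RM) (fun t => v t x).
  apply/measurable_funU => //; first exact: measurableC.
  split => //; apply: (eq_measurable_fun (fun _ : RM => 0 : R)).
    by move=> t; rewrite inE => /vNG ->.
  exact: measurable_cst.
by rewrite setUv.
Qed.

End Traces.

(** * Energy of the time slices *)

Section Slices.
Context {R : realType}.
Implicit Types (f h : R -> R) (u w : R -> R -> R) (a e p t x : R).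
Local Notation mu := (@lebesgue_measure R).

(** For a norm at most 1, passing to a power at least 1 only decreases it. *)
Lemma normLp_small p e f : 1 <= p -> 0 <= e <= 1 -> (normLp p f <= e%:E)%E ->
  (\int[mu]_(x in halfline) (`|f x| `^ p)%:E <= e%:E)%E.
Proof.
move=> p1 /andP[e0 e1] fe; have p0 : p != 0 by rewrite gt_eqF// (lt_le_trans ltr01).
have -> : (\int[mu]_(x in halfline) (`|f x| `^ p)%:E)%E = (normLp p f `^ p)%E.
  rewrite /normLp (powR_Lnorm _ _ p0) [LHS]integral_mkcond; apply: eq_integral => x _.
  rewrite /= !patchE; case: ifPn => _ //; by rewrite normr0 powR0.
apply: (@le_trans _ _ (e%:E `^ p)%E).
  apply: gt0_ler_poweR; rewrite ?in_itv/= ?leey ?andbT ?lee_fin//.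
    by rewrite (le_trans ler01).
  exact: Lnorm_ge0.
rewrite poweR_EFin lee_fin; have [->|en0] := eqVneq e 0; first by rewrite powR0.
have e01 : 0 < e <= 1 by rewrite lt0r en0 e0.
by have := ger_powR e01 p1; rewrite powRr1.
Qed.

Lemma energy_small a e f : 0 < a -> 0 <= e <= 1 -> Uspace a f ->
  (Unorm a f <= e%:E)%E -> (energy a f <= (e *+ 2)%:E)%E.
Proof.
move=> a0 e01 [[mf _] _ [mg _] _] fe.
have N0 p g : (0 <= normLp p g)%E by exact: Lnorm_ge0.
have f2 : (normLp 2 f <= e%:E)%E by apply: le_trans fe; rewrite leeDl.
have g2 : (normLp (a + 1) (weighted_D2 a f) <= e%:E)%E.
  by apply: le_trans fe; rewrite leeDr.
have eE x : halfline x -> (f x ^+ 2 + x `^ (a + 2) * `|wD2 f x| `^ (a + 1))%:E =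
    ((`|f x| `^ 2)%:E + (`|weighted_D2 a f x| `^ (a + 1))%:E)%E.
  rewrite halflineE => x0; rewrite -EFinD; congr (_ + _)%:E.
    by rewrite powR_mulrn// -normrX ger0_norm ?sqr_ge0.
  rewrite /weighted_D2 normrM powRM// (ger0_norm (powR_ge0 _ _)) -powRrM.
  by rewrite -mulrA mulVf ?mulr1// gt_eqF// ltr_wpDr.
rewrite /energy; under eq_integral => x /[!inE] x0 do rewrite eE//.
rewrite ge0_integralD//=.
- rewrite mulr2n EFinD; apply: leeD; apply: normLp_small => //.
    by rewrite lerDl.
  by rewrite lerDr ltW.
- exact: measurable_halfline.
- apply/measurable_EFinP; apply: (measurableT_comp (measurable_powR _)).
  exact: measurableT_comp.
- apply/measurable_EFinP; apply: (measurableT_comp (measurable_powR _)).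
  exact: measurableT_comp.
Qed.

Lemma energy_ge0 a f : (0 <= energy a f)%E.
Proof.
by apply: integral_ge0 => x _; rewrite lee_fin addr_ge0 ?sqr_ge0// weight_ge0.
Qed.

Lemma wDxxP u : has_wDxx u -> is_wDxx u (wDxx u).
Proof. by move=> h; exact: xgetPex h. Qed.

Lemma wDtP u : has_wDt u -> is_wDt u (wDt u).
Proof. by move=> h; exact: xgetPex h. Qed.

Lemma wD2P f : has_wD2 f -> is_wD2 f (wD2 f).
Proof. by move=> h; exact: xgetPex h. Qed.

(** The exceptional null sets of countably many test functions are merged. *)
Lemma ae_rational_boxes (P : nat -> rat -> rat -> R -> Prop) :
  (forall n (a b : rat), 0 < ratr a :> R -> (ratr a : R) < ratr b ->
    {ae mu, forall t, halfline t -> P n a b t}) ->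
  {ae mu, forall t, halfline t -> forall n (a b : rat),
    0 < ratr a :> R -> (ratr a : R) < ratr b -> P n a b t}.
Proof.
move=> H; pose Q (k : nat) t := halfline t -> forall n (a b : rat),
  unpickle k = Some (n, a, b) -> 0 < ratr a :> R -> (ratr a : R) < ratr b -> P n a b t.
have : {ae mu, forall t, forall k, Q k t}.
  apply/ae_foralln => k; rewrite /Q.
  case: (unpickle k : option (nat * rat * rat)%type) => [[[n a] b]|]; last by apply: aeW.
  have [/andP[a0 ab]|nab] := boolP ((0 < ratr a :> R) && ((ratr a : R) < ratr b)).
    apply: filterS (H n a b a0 ab); first exact: (ae_filter_ringOfSetsType mu).
    by move=> t Pt th n' a' b' [<- <- <-] _ _; exact: Pt.
  apply: aeW => t _ n' a' b' [<- <- <-] a0 ab; by rewrite a0 ab in nab.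
apply: filterS; first exact: (ae_filter_ringOfSetsType mu).
move=> t Qt th n a b; apply: (Qt (pickle (n, a, b)) th); exact: pickleK.
Qed.

Lemma slice_weak_D2_tested u w : is_wDxx u w ->
  {ae mu, forall t, halfline t -> weak_D2_tested (u t) (w t)}.
Proof.
move=> uw; apply: ae_rational_boxes => n a b a0 ab.
apply: (@slice_weak_D2 _ _ _ (Num.min (ratr a) 1) (Num.max (ratr b) 2)) => //.
  by rewrite lt_min a0 ltr01.
apply: test_on_second_primitive; rewrite ?ge_min ?le_max ?lexx ?orbT//.
apply: test_on_widen (test_on_plateau _ _ _); rewrite ?ge_min ?le_max ?lexx//.
Qed.

(** The energy is built on the weak derivative of each slice, the dissipation on
    the weak partial derivative in the quadrant; this identifies the two. *)
Lemma slice_wD2 u w : is_wDxx u w ->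
  (forall t, halfline t -> has_wD2 (u t)) ->
  {ae mu, forall t, halfline t -> w t = wD2 (u t) %[ae mu in halfline]}.
Proof.
move=> uw hu; have [ui wi _] := uw.
have wl := slice_loc_int wi.
have wt : {ae mu, forall t, halfline t -> forall n (a b : rat),
    0 < ratr a :> R -> (ratr a : R) < ratr b ->
    pairing (u t) (derive1n 2 (plateau n (ratr a) (ratr b))) =
    pairing (w t) (plateau n (ratr a) (ratr b))}.
  apply: ae_rational_boxes => n a b a0 ab.
  exact: slice_weak_D2 uw a0 (test_on_plateau _ _ _).
apply: filterS2 wl wt; first exact: (ae_filter_ringOfSetsType mu).
move=> t wl wt th; have {wl} wl := wl th; have {wt} wt := wt th.
have [fi hi fh] := wD2P (hu t th).
have : (fun x => w t x - wD2 (u t) x) = cst 0 %[ae mu in halfline].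
  apply: plateau_orthogonal_eq0; first exact: loc_intB.
  move=> n a b a0 ab; have bt := test_on_plateau n (ratr a : R) (ratr b).
  rewrite (pairingBl a0 wl hi bt) -wt//; apply/eqP; rewrite subr_eq0; apply/eqP.
  apply: EFin_inj; have b2 := test_on_derive1 (test_on_derive1 bt).
  rewrite -(pairingE a0 fi (smooth_continuous b2.1) b2.2).
  rewrite -(pairingE a0 hi (smooth_continuous bt.1) bt.2).
  exact: (fh _ (test_on_test_fun a0 bt)).
apply: filterS; first exact: (ae_filter_ringOfSetsType mu).
by move=> x H hx; apply/eqP; rewrite -subr_eq0; apply/eqP; exact: H.
Qed.

End Slices.

(** * The velocity as a function of time *)

Section Velocity.
Context {R : realType}.
Implicit Types (f : R -> R) (u v : R -> R -> R) (a e t x : R).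
Local Notation mu := (@lebesgue_measure R).
Local Notation RM := (measurableTypeR R).

Lemma ae_and (P Q : R -> Prop) : {ae mu, forall t, P t} ->
  {ae mu, forall t, Q t} -> {ae mu, forall t, P t /\ Q t}.
Proof.
by apply: filterS2; first exact: (ae_filter_ringOfSetsType mu).
Qed.

Lemma measurable_velocity a u : is_wDxx u (wDxx u) ->
  measurable_fun (quadrant : set (RM * RM)) (fun z => velocity a u z.1 z.2).
Proof.
move=> [[mu_ _] [mw _] _]; rewrite /velocity /gfun.
apply: measurable_funM; [apply: measurable_funM; [apply: measurable_funM|]|].
- exact: measurable_cst.
- apply: (measurableT_comp (measurable_powR _)); apply: measurable_funTS.
  exact: measurable_snd.
- apply: (measurableT_comp (measurable_powR _)); apply: measurable_funD => //.
- apply: measurable_funM => //; apply: (measurableT_comp (measurable_powR _)).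
  exact: measurableT_comp.
Qed.

Lemma measurable_slice_integral (g : R * R -> R) :
  measurable_fun (quadrant : set (RM * RM)) g -> (forall z, 0 <= g z) ->
  measurable_fun (halfline : set RM)
    (fun t => (\int[mu]_(x in halfline) (g (t, x))%:E)%E).
Proof.
move=> mg g0; pose G := (EFin \o g) \_ (quadrant : set (RM * RM)).
have mG : measurable_fun [set: RM * RM] G.
  apply/(measurable_restrictT _ measurable_quadrant); exact/measurable_EFinP.
have G0 z : (0 <= G z)%E by apply: erestrict_ge0 => y _; rewrite lee_fin.
have mF := measurable_fun_fubini_tonelli_F (m2 := mu) G mG G0.
apply: (eq_measurable_fun (fubini_F mu G)); last exact: measurable_funTS.
move=> t; rewrite inE => th; rewrite /fubini_F [RHS]integral_mkcond.
apply: eq_integral => x _; rewrite /G !patchE.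
have [xh|xh] := pselect (halfline x); first by rewrite !mem_set//; split.
by rewrite !memNset// => -[].
Qed.

Lemma supnorm_sqr_le f k : 0 <= k -> (forall x, f x ^+ 2 <= k) ->
  ((supnorm f) ^+ 2 <= k%:E)%E.
Proof.
move=> k0 fk; have fs : (supnorm f <= (Num.sqrt k)%:E)%E.
  by apply: supnorm_le => x _; rewrite -sqrtr_sqr ler_wsqrtr.
rewrite -(sqr_sqrtr k0) EFin_expe !expe2.
by apply: lee_pmul => //; exact: supnorm_ge0.
Qed.

Lemma measurable_supnorm v : (forall t, continuous (v t)) ->
  (forall x, 0 <= x -> measurable_fun [set: RM] (fun t => v t x)) ->
  measurable_fun [set: RM] (fun t => supnorm (v t)).
Proof.
move=> cv mv; have [xs [xs0 xsd]] := @dense_points R.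
have -> : (fun t => supnorm (v t)) = (fun t => esups (fun i => `|v t (xs i)|%:E) 0).
  by apply/funext => t; exact: supnorm_dense.
apply: measurable_fun_esups => i; apply/measurable_EFinP.
by apply: measurableT_comp => //; exact: mv.
Qed.

Section assembly.
Variables (a : R) (u : R -> R -> R) (e K : R).
Hypothesis fixed : fixed_time_bound a e K.
Hypotheses (hDt : has_wDt u) (hDxx : has_wDxx u) (hflux : has_wDxx (flux a u)).
Hypothesis ztr : {ae mu, forall t, halfline t -> zero_trace (u t)}.
Hypothesis hU : forall t, halfline t -> has_wD2 (u t).
Hypothesis small : forall t, halfline t -> (energy a (u t) < e%:E)%E.
Hypothesis finite : (dissipation a u < +oo)%E.

Let q (z : R * R) : R := (wDt u z.1 z.2) ^+ 2
  + z.2 `^ (a + 2) * `|wDxx u z.1 z.2| `^ (a + 1) + (wDxx (flux a u) z.1 z.2) ^+ 2.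

Let d t : \bar R := (\int[mu]_(x in halfline) (q (t, x))%:E)%E.

Let q_ge0 z : 0 <= q z.
Proof. by rewrite !addr_ge0 ?sqr_ge0// mulr_ge0 ?powR_ge0. Qed.

Let d_ge0 t : (0 <= d t)%E.
Proof. by apply: integral_ge0 => x _; rewrite lee_fin. Qed.

Let mq : measurable_fun (quadrant : set (RM * RM)) q.
Proof.
have [_ [mt _] _] := wDtP hDt; have [_ [mx _] _] := wDxxP hDxx.
have [_ [mf _] _] := wDxxP hflux.
apply: measurable_funD; [apply: measurable_funD|].
- exact: measurable_funX.
- apply: measurable_funM; apply: (measurableT_comp (measurable_powR _)).
    by apply: measurable_funTS; exact: measurable_snd.
  exact: measurableT_comp.
- exact: measurable_funX.
Qed.

Let md : measurable_fun (halfline : set RM) d.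
Proof. exact: measurable_slice_integral. Qed.

Let d_fin : {ae mu, forall t, halfline t -> d t \is a fin_num}.
Proof.
apply: integrable_ae; first exact: measurable_halfline.
apply/integrableP; split => //.
by under eq_integral => t _ do rewrite gee0_abs//.
Qed.

Lemma slice_velocity : {ae mu, forall t, halfline t -> exists v : R -> R,
  [/\ continuous v,
      forall e', 0 < e' -> exists M : R, forall x, M <= x -> `|v x| <= e',
      forall x, v x ^+ 2 <= K * fine (d t) &
      velocity a u t = v %[ae mu in halfline]]}.
Proof.
have ux := wDxxP hDxx; have fx := wDxxP hflux; have ut := wDtP hDt.
have [lu lx _] := ux; have [lf lfx _] := fx; have [_ lt _] := ut.
have A1 := ae_and (slice_loc_int lu) (slice_loc_int lx).
have A2 := ae_and (slice_loc_int lf) (slice_loc_int lfx).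
have A3 := ae_and (slice_weak_D2_tested ux) (slice_weak_D2_tested fx).
have A4 := ae_and ztr d_fin.
have A5 := ae_and (slice_wD2 ux hU) (slice_loc_int lt).
have := ae_and (ae_and A1 A2) (ae_and A3 (ae_and A4 A5)).
apply: filterS; first exact: (ae_filter_ringOfSetsType mu).
move=> t [[[h1 h2] [h3 h4]] [[h5 h6] [[h7 h8] [h9 h10]]]] th.
have {}h1 := h1 th; have {}h2 := h2 th; have {}h3 := h3 th; have {}h4 := h4 th.
have {}h9 := h9 th; have {}h10 := h10 th.
have [m1 _ _] := h1; have [m2 _ _] := h2; have [m4 _ _] := h4; have [m10 _ _] := h10.
have [_ [m9 _ _] _] := wD2P (hU th).
apply: (fixed h1 h2 h4 h3 (h7 th) (h5 th) (h6 th)).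
  apply: le_lt_trans (small th); rewrite /energy le_eqVlt; apply/orP; left.
  apply/eqP; apply: ge0_ae_eq_integral.
  - exact: measurable_halfline.
  - apply/measurable_EFinP; apply: measurable_funD; first exact: measurable_funX.
    exact: measurable_weight.
  - apply/measurable_EFinP; apply: measurable_funD; first exact: measurable_funX.
    exact: (measurable_weight a m9).
  - by move=> x _; rewrite lee_fin addr_ge0 ?sqr_ge0// weight_ge0.
  - by move=> x _; rewrite lee_fin addr_ge0 ?sqr_ge0// (weight_ge0 a (wD2 (u t)) x).
  - apply: filterS h9; first exact: (ae_filter_ringOfSetsType mu).
    by move=> x h9 hx; rewrite /weight h9.
rewrite fineK; last exact: h8.
apply: ge0_le_integral.
- exact: measurable_halfline.
- by move=> x _; rewrite lee_fin addr_ge0 ?sqr_ge0// weight_ge0.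
- apply/measurable_EFinP; apply: measurable_funD; last exact: measurable_funX.
  exact: measurable_weight.
- apply/measurable_EFinP; apply: measurable_funD; last exact: measurable_funX.
  apply: measurable_funD; first exact: measurable_funX.
  exact: (measurable_weight a m2).
- by move=> x _; rewrite lee_fin lerD2r lerDr sqr_ge0.
Qed.

Lemma velocity_version : 0 <= K -> exists v : R -> R -> R,
  [/\ continuous_version (velocity a u) v,
      forall t, BC0 (v t), strongly_measurable_BC0 v &
      (normsq_L2BC0 v <= K%:E * dissipation a u)%E].
Proof.
move=> K0; have [N [mN N0 sN]] := slice_velocity.
(* A measurable set of good times; elsewhere the version is set to 0. *)
pose G : set R := halfline `\` N.
have mG : measurable (G : set RM).
  by apply: measurableD => //; exact: measurable_halfline.
have Gh : G `<=` halfline by move=> t [].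
have /choice[v hv] : forall t, exists v : R -> R,
    (G t -> [/\ continuous v,
      forall e', 0 < e' -> exists M : R, forall x, M <= x -> `|v x| <= e',
      forall x, v x ^+ 2 <= K * fine (d t) &
      velocity a u t = v %[ae mu in halfline]]) /\ (~ G t -> v = cst 0).
  move=> t; have [[th tN]|nG] := pselect (G t); last by exists (cst 0); split.
  have [v Pv] : exists v : R -> R, [/\ continuous v,
      forall e', 0 < e' -> exists M : R, forall x, M <= x -> `|v x| <= e',
      forall x, v x ^+ 2 <= K * fine (d t) &
      velocity a u t = v %[ae mu in halfline]].
    apply: contrapT => nv; apply: tN; apply: sN => /= H; exact: nv (H th).
  by exists v; split => // nG; case: nG.
have vG t : G t -> continuous (v t) /\ velocity a u t = v t %[ae mu in halfline].
  by move=> /(hv t).1[].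
have v0 t : ~ G t -> v t = cst 0 by move=> /(hv t).2.
have cv t : continuous (v t).
  have [/vG[]//|/v0 ->] := pselect (G t); exact: cst_continuous.
have dv t e' : 0 < e' -> exists M : R, forall x, M <= x -> `|v t x| <= e'.
  have [/(hv t).1[] _ + _ _|/v0 -> e'0] := pselect (G t); first exact.
  by exists 0 => x _; rewrite /= normr0 ltW.
have bv t x : v t x ^+ 2 <= K * fine (d t).
  have [/(hv t).1[] _ _ + _|/v0 ->] := pselect (G t); first exact.
  by rewrite expr0n mulr_ge0// fine_ge0.
have Bv t : BC0 (v t).
  split; first exact: continuous_subspaceT (cv t).
  exists (Num.sqrt (K * fine (d t))) => x _; rewrite -sqrtr_sqr.
  exact: ler_wsqrtr.
have mv := measurable_trace (measurable_velocity a (wDxxP hDxx)) mG Gh vG v0.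
exists v; split => //.
- exists N; split => // t /= /not_implyP[th nt]; apply: contrapT => tN.
  by apply: nt; apply: (vG t _).2.
- exact: strongly_measurable_C0.
- rewrite /normsq_L2BC0 /dissipation.
  rewrite -(ge0_integralZl _ measurable_halfline md)//.
  apply: ge0_le_integral.
  + exact: measurable_halfline.
  + by move=> t _; rewrite expe2 mule_ge0// supnorm_ge0.
  + have mS : measurable_fun (halfline : set RM) (fun t => supnorm (v t)).
      by apply: measurable_funTS; exact: measurable_supnorm.
    by under eq_fun do rewrite expe2; exact: emeasurable_funM.
  + exact: measurable_funeM.
  + move=> t _; apply: (@le_trans _ _ (K * fine (d t))%:E).
      by apply: supnorm_sqr_le => //; rewrite mulr_ge0// fine_ge0.
    rewrite EFinM; apply: lee_wpmul2l; first by rewrite lee_fin.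
    by case: (d t) (d_ge0 t) => //= *; rewrite leey.
Qed.

End assembly.
End Velocity.

(** * The estimate *)

Theorem theorem2p2 (R : realType) (alpha : R) (halpha : 2 < alpha) (C0 : R) :
  exists eps0 : R, 0 < eps0 /\
  exists C : R,
  forall (u0 : R -> R) (u : R -> R -> R),
    Uspace alpha u0 ->
    (Unorm alpha u0 <= eps0%:E)%E ->
    locally_integrable2 closed_quadrant u ->
    {ae @lebesgue_measure R, forall t, halfline t -> zero_trace (u t)} ->
    solves_equation alpha u ->
    (sup_energy alpha u + dissipation alpha u <= C0%:E * energy alpha u0)%E ->
    holder_half_L2 u ->
    continuous_U alpha u ->
    u 0 = u0 %[ae @lebesgue_measure R in halfline] ->
    exists v : R -> R -> R,
      [/\ continuous_version (velocity alpha u) v,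
          inL2BC0 v &
          (normsq_L2BC0 v <= C%:E * energy alpha u0)%E].
Proof.
have a0 : 0 < alpha by exact: lt_trans halpha.
have [e [K [e0 K0 fixed]]] := velocity_fixed_time halpha.
(* [C0] may be nonpositive. *)
pose c := Num.max C0 1.
have c1 : 1 <= c by rewrite le_max lexx orbT.
have c0 : 0 < c by exact: lt_le_trans c1.
(* The initial energy is at most [2 * eps], so that [c] times it is at most
   [e / 2]. *)
pose eps := Num.min 1 (e / (4 * c)).
have c4 : 0 < 4 * c by rewrite mulr_gt0.
have eps0 : 0 < eps by rewrite lt_min ltr01 divr_gt0.
exists eps; split => //; exists (K * c).
move=> u0 u U0 Usmall _ ztr [hDt hDxx hflux _ _] bound _ [hU _] _.
have eps1 : 0 <= eps <= 1 by rewrite ltW// ge_min lexx.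
have Esmall := energy_small a0 eps1 U0 Usmall; have E0 := energy_ge0 alpha u0.
have {}bound : (sup_energy alpha u + dissipation alpha u <= c%:E * energy alpha u0)%E.
  by apply: (le_trans bound); rewrite lee_wpmul2r// lee_fin le_max lexx.
have dis0 : (0 <= dissipation alpha u)%E.
  apply: integral_ge0 => t _; apply: integral_ge0 => x _; rewrite lee_fin.
  by rewrite !addr_ge0 ?sqr_ge0// mulr_ge0 ?powR_ge0.
have sup_le t : 0 <= t -> (energy alpha (u t) <= sup_energy alpha u)%E.
  by move=> t0; apply: ereal_sup_ubound; exists t => //=; rewrite in_itv/= t0.
have sup0 : (0 <= sup_energy alpha u)%E.
  by apply: le_trans (sup_le 0 (lexx 0)); exact: energy_ge0.
have cE : (c%:E * energy alpha u0 < e%:E)%E.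
  apply: (@le_lt_trans _ _ (c%:E * (eps *+ 2)%:E)%E).
    by rewrite lee_wpmul2l// lee_fin ltW.
  rewrite -EFinM lte_fin.
  have : eps <= e / (4 * c) by rewrite ge_min lexx orbT.
  rewrite ler_pdivlMr//; nra.
have hwD2 t : halfline t -> has_wD2 (u t).
  by rewrite halflineE => t0; have [] := hU t (ltW t0).
have small t : halfline t -> (energy alpha (u t) < e%:E)%E.
  rewrite halflineE => t0; apply: le_lt_trans cE; apply: le_trans bound.
  by apply: (le_trans (sup_le t (ltW t0))); rewrite leeDl.
have dis_le : (dissipation alpha u <= c%:E * energy alpha u0)%E.
  by apply: le_trans bound; rewrite leeDr.
have dis_fin : (dissipation alpha u < +oo)%E.
  by apply: (le_lt_trans dis_le); apply: (lt_le_trans cE); rewrite leey.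
have [v [vV vB vs vn]] :=
  velocity_version fixed hDt hDxx hflux ztr hwD2 small dis_fin K0.
have vn' : (normsq_L2BC0 v <= (K * c)%:E * energy alpha u0)%E.
  by apply: (le_trans vn); rewrite EFinM -muleA lee_wpmul2l// lee_fin.
exists v; split => //; split => //.
apply: (le_lt_trans vn'); rewrite EFinM -muleA.
apply: (@le_lt_trans _ _ (K%:E * e%:E)%E); last by rewrite -EFinM ltry.
by rewrite lee_wpmul2l// ?lee_fin// ltW.
Qed.
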